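(* Let $u\in H$ be given and let $\mathcal H$ be the associated Hilbert space defined in the context. Let $\widehat u\in\mathcal H$ be a solution of $e(\widehat u)=\min\{e(v):v\in\mathcal H\}$ and assume: $e$ is three times differentiable near $\widehat u$ in $\mathcal H$; there exist $\delta_0,\alpha_0>0$ such that $e''(w;v,v)\ge\alpha_0\|v\|_{\mathcal H}^2$ for all $w$ with $\|w-\widehat u\|_{\mathcal H}\le\delta_0$ and all $v\in\mathcal H$; the map $v\in\mathcal H\mapsto e''(\widehat u;v,\cdot)\in\mathcal H'$ is invertible; and there are $0<m<M<\infty$ with $|e''(u;v,w)|\le M\|v\|_{\mathcal H}\|w\|_{\mathcal H}$ and $e''(u;v,v)\ge m\|v\|_{\mathcal H}^2$ for $v,w\in\mathcal H$. Let $\widehat\lambda\in\partial\Lambda^+$ be a solution of $j(\widehat\lambda)=\min\{j(\lambda):\lambda\in\partial\Lambda^+\}$, $g=g(\widehat\lambda)$, $T_u=\mathrm{span}\{g'(\widehat\lambda;\ell):\ell\in\widehat\Lambda\}$, and let $P_u:\mathcal H\to T_u$ be the projection operator with respect to the inner product $e''(u;\cdot,\cdot)$, i.e. $e''(u;w-P_uw,v)=0$ for all $w\in\mathcal H$, $v\in T_u$. Let $h$ be Newton's step, i.e. $h\in\mathcal H$ with $e''(u;h,v)=e'(u;v)$ for all $v\in\mathcal H$. Then $$P_uh=P_u(\kappa g)\qquad\text{and}\qquad d\le\dim(T_u)\le N-|I_0|-|I_\infty|,$$ where $d$ is the number of indices $i\in I$ such that $g\ne g_0$ in $\mathcal D'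(\Omega_i)$.
   Context: Let $\Omega$ be a sufficiently smooth (Lipschitz) domain in a Euclidean space, $H=H^1_0(\Omega)$, $\kappa>0$ a fixed step size, and $e$ a real functional with first and second derivatives $e'(u;v)$, $e''(u;v,w)$ at $u$ in directions $v$ and $v,w$. Let $\{\Omega_i\}_{i\in I}$, $I=\{1,\dots,N\}$, be a partition of $\Omega$ into open Lipschitz sets, $\Lambda$ the space of real functions on $\Omega$ that are constant, equal to $\lambda_i$, on each $\Omega_i$ (so $\lambda=[\lambda_1,\dots,\lambda_N]$), $\Lambda^+=\{\lambda\in\Lambda:0<\lambda_i<\infty\ \forall i\}$, and $\partial\Lambda^+$ the set of $\lambda=[\lambda_1,\dots,\lambda_N]\in[0,+\infty]^N$ with at least one $\lambda_i\in\{0,+\infty\}$. For $\lambda\in\partial\Lambda^+$: $I_{0,\lambda}=\{i:\lambda_i=0\}$, $I_{\infty,\lambda}=\{i:\lambda_i=+\infty\}$, $\Omega_{0,\lambda}=\bigcup_{i\in I_{0,\lambda}}\Omega_i$, $\Omega_{\infty,\lambda}=\bigcup_{i\in I_{\infty,\lambda}}\Omega_i$; for $\lambda=\widehat\lambda$ these are written $I_0,I_\infty,\Omega_0,\Omega_\infty$. For the given $u$, $g_0$ is the $L^2$ representation of $e'(u)$, i.e. the distribution on $\Omega$ with $\langle g_0,v\rangle=e'(u;v)$. $\Omega_{0,H^1}$ is the largest union of sets $\overline\Omega_i$ such that $g_0\in H^1(\Omega_{0,H^1})$, and $I_{0,H^1}=\{i\in I:\Omega_i\subset\Omega_{0,H^1}\}$.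 Then $$\mathcal H=\{v: v\in H^1(\Omega\setminus\Omega_{0,H^1}),\ v\in H^1(\Omega_i)\ \forall i\in I_{0,H^1},\ v=0\text{ on }\partial\Omega\},$$ $$(v,w)_{\mathcal H}=\int_{\Omega\setminus\Omega_{0,H^1}}\nabla v\cdot\nabla w+vw\,dx+\sum_{i\in I_{0,H^1}}\int_{\Omega_i}\nabla v\cdot\nabla w+vw\,dx,\qquad \|v\|_{\mathcal H}^2=(v,v)_{\mathcal H}.$$ For $\lambda\in\partial\Lambda^+$ with $I_{0,\lambda}\subset I_{0,H^1}$ let $V_\lambda=H^1_0(\Omega\setminus\Omega_{0,\lambda};\Omega_{\infty,\lambda}^{\mathrm{const}})\cap H^1(\Omega_{0,\lambda})$ be the set of $v\in H^1(\Omega\setminus\Omega_{0,\lambda})\cap H^1(\Omega_{0,\lambda})$ (i.e. the restrictions of $v$ to these sets are $H^1$) with $v=0$ on $\partial\Omega$ and $v$ equal to a constant $C_i\in\mathbb R$ in $\Omega_i$ for each $i\in I_{\infty,\lambda}$. The element $g(\lambda)\in V_\lambda$ is defined by $$\int_{\Omega\setminus\Omega_{0,\lambda}}\lambda\,\nabla g(\lambda)\cdot\nabla v+g(\lambda)v\,dx+\int_{\Omega_{0,\lambda}}g(\lambda)v\,dx=e'(u;v)\quad\forall v\in V_\lambda,$$ where the term with $\lambda$ is $0$ on $\Omega_{\infty,\lambda}$ (gradients vanish there). $j(\lambda)=f(g(\lambda))$ with $f(g)=\frac\kappa2e''(u;g,g)-e'(u;g)$; the minimization over $\partial\Lambda^+$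 is over those $\lambda$ for which $g(\lambda)$ is defined, i.e. $I_{0,\lambda}\subset I_{0,H^1}$. Let $\mathbb 1_{0,\infty}$ be the function equal to $0$ on $\Omega_0\cup\Omega_\infty$ and $1$ on $\Omega\setminus(\Omega_0\cup\Omega_\infty)$, and $\widehat\Lambda=\{\mathbb 1_{0,\infty}\lambda:\lambda\in\Lambda\}$. For $\ell\in\widehat\Lambda$, $g'(\widehat\lambda;\ell)$ is the derivative of $g$ at $\widehat\lambda$ in the direction $\ell$.
   Formalization: Here d counts only indices i not in I_∞ with g ≠ g₀ in D'(Ω_i); counting those in I_∞ makes d ≤ dim(T_u) false, e.g. N=1, e(v)=‖v‖²/2−∫fv, u=0, f in L² but not H¹, where λ̂=+∞, g=0, T_u={0} but d=1. *)

(* Defs.v *)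
From HB Require Import structures.
From mathcomp Require Import all_boot all_order all_algebra.
From mathcomp Require Import all_classical all_reals all_analysis.

Set Implicit Arguments.
Unset Strict Implicit.
Unset Printing Implicit Defensive.

Import Order.TTheory GRing.Theory Num.Theory.
Import numFieldNormedType.Exports.

Local Open Scope classical_set_scope.
Local Open Scope ring_scope.

(** * Lebesgue measure on row vectors *)

Section rV_measurable.
Context {R : realType} {n : nat}.

Definition rV_coord (i : 'I_n) (v : 'rV[R]_n) : R := v 0 i.

Let rV_measurable0 : g_sigma_preimage rV_coord set0.
Proof. exact: sigma_algebra0. Qed.

Let rV_measurableC A : g_sigma_preimage rV_coord A ->
  g_sigma_preimage rV_coord (~` A).
Proof. exact: sigma_algebraC. Qed.

Let rV_measurable_bigcup (F : (set 'rV[R]_n)^nat) :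
  (forall i, g_sigma_preimage rV_coord (F i)) ->
  g_sigma_preimage rV_coord (\bigcup_i (F i)).
Proof. exact: sigma_algebra_bigcup. Qed.

(* Generated by the coordinates, as the library does for tuples; this is the
   Borel sigma-algebra. *)
HB.instance Definition _ := @isMeasurable.Build default_measure_display
  'rV[R]_n (g_sigma_preimage rV_coord)
  rV_measurable0 rV_measurableC rV_measurable_bigcup.

End rV_measurable.

Definition rV_cons (R : realType) (n : nat) (p : 'rV[R]_n * R) : 'rV[R]_n.+1 :=
  row_mx (p.2%:M : 'rV_1) p.1.

Lemma measurable_rV_coord (R : realType) (n : nat) (i : 'I_n) :
  measurable_fun [set: 'rV[R]_n] (rV_coord i).
Proof.
move=> _ Y mY; rewrite setTI; apply: sub_sigma_algebra => /=.
rewrite -bigcup_seq/=; exists i => /=; first by rewrite mem_index_enum.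
by exists Y => //; rewrite setTI.
Qed.

Lemma measurable_rV_cons (R : realType) (n : nat) :
  measurable_fun [set: 'rV[R]_n * R] (@rV_cons R n).
Proof.
suff H : preimage_set_system setT (@rV_cons R n) (g_sigma_preimage rV_coord)
    `<=` measurable by move=> _ A mA; apply: H; exists A.
rewrite -g_sigma_preimage_comp.
apply: smallest_sub; first exact: sigma_algebra_measurable.
rewrite -bigcup_mkord_ord; apply: bigcup_sub => i ltin.
move=> A [B mB <-].
suff : measurable_fun [set: 'rV[R]_n * R]
  (rV_coord (inord i : 'I_n.+1) \o @rV_cons R n) by exact.
case: (@split_ordP 1 n (inord i)) => j ->.
  rewrite (_ : _ \o _ = snd); first exact: measurable_snd.
  apply/funext => p; rewrite /rV_coord/rV_cons/=.
  by rewrite (row_mxEl (p.2%:M : 'rV_1)) mxE !ord1 eqxx mulr1n.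
rewrite (_ : _ \o _ = rV_coord j \o fst).
  apply: measurableT_comp; first exact: measurable_rV_coord.
  exact: measurable_fst.
apply/funext => p; rewrite /rV_coord/rV_cons/=.
by rewrite (row_mxEr (p.2%:M : 'rV_1)).
Qed.

Section lebesgue_rV_succ.
Context {R : realType} {n : nat} (m : {measure set 'rV[R]_n -> \bar R}).

Definition lebesgue_rV_succ : set 'rV[R]_n.+1 -> \bar R :=
  pushforward (m \x (@lebesgue_measure R))%E (@rV_cons R n).

Let lebesgue_rV_succ0 : lebesgue_rV_succ set0 = 0%E.
Proof. by rewrite /lebesgue_rV_succ /pushforward preimage_set0 measure0. Qed.

Let lebesgue_rV_succ_ge0 A : (0 <= lebesgue_rV_succ A)%E.
Proof.
exact: (measure_ge0 (m \x (@lebesgue_measure R))%E (@rV_cons R n @^-1` A)).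
Qed.

Let lebesgue_rV_succ_sigma_additive : semi_sigma_additive lebesgue_rV_succ.
Proof.
move=> F mF tF mUF; rewrite /lebesgue_rV_succ /pushforward preimage_bigcup.
have mc A : measurable A -> measurable (@rV_cons R n @^-1` A).
  by move=> mA; rewrite -[X in measurable X]setTI; exact: measurable_rV_cons.
apply: measure_semi_sigma_additive => [k||]; first exact: mc.
- apply/trivIsetP => /= i j _ _ ij; rewrite -preimage_setI.
  by move/trivIsetP : tF => /(_ _ _ _ _ ij) ->//; rewrite preimage_set0.
- by rewrite -preimage_bigcup; exact: mc.
Qed.

HB.instance Definition _ := isMeasure.Build _ _ _ lebesgue_rV_succ
  lebesgue_rV_succ0 lebesgue_rV_succ_ge0 lebesgue_rV_succ_sigma_additive.

End lebesgue_rV_succ.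

Fixpoint lebesgue_rV (R : realType) (n : nat) :
    {measure set 'rV[R]_n -> \bar R} :=
  if n is k.+1 return {measure set 'rV[R]_n -> \bar R}
  then lebesgue_rV_succ (lebesgue_rV R k)
  else \d_(0 : 'rV[R]_0).

(** * Open sets, test functions and Sobolev spaces

  Functions are total functions on the space; a function "on [U]" is only
  looked at on [U], and only up to Lebesgue-null sets ([eq_on]). *)

Section sobolev.
Context {R : realType} {n : nat}.
Local Notation E := 'rV[R]_n.+1.
Local Notation mu := (lebesgue_rV R n.+1).
Implicit Types (U Om : set E) (f v w : E -> R) (k : 'I_n.+1).

Definition boundary U : set E := closure U `\` interior U.

(* Near each boundary point, after a linear isometry [Q], the set is the strict
   epigraph of a Lipschitz function of the last [n] coordinates. *)
Definition lipschitz_open U : Prop :=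
  open U /\
  forall x, boundary U x ->
    exists (Q : 'M[R]_n.+1) (gam : 'rV[R]_n -> R) (L r : R),
      [/\ Q *m Q^T = 1%:M, 0 < r,
          forall s t, `|gam s - gam t| <= L * `|s - t| &
          forall y, `|y - x| < r ->
            (U y <-> gam (col' ord0 (y *m Q)) < (y *m Q) 0 ord0)].

Definition lipschitz_domain Om : Prop :=
  [/\ lipschitz_open Om, Om !=set0 & connected Om].

(* For Lipschitz subsets, whose boundaries are null, the last clause is
   equivalent to [Om] being covered by the closures of the [Omi i]. *)
Definition lipschitz_partition Om N (Omi : 'I_N -> set E) : Prop :=
  [/\ forall i, [/\ lipschitz_open (Omi i), Omi i !=set0 & Omi i `<=` Om],
      trivIset setT Omi &
      mu.-negligible (Om `\` \bigcup_i Omi i)].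

Definition eq_on U f w : Prop := \forall x \ae mu, U x -> f x = w x.

Definition partial k f : E -> R :=
  fun x => 'D_(delta_mx 0 k : E) (f : E -> R^o) x.

Definition smooth f : Prop :=
  forall (s : seq 'I_n.+1) (x : E), differentiable (foldr partial f s : E -> R^o) x.

Definition support f : set E := closure [set x | f x != 0].

(* The space D(U). *)
Definition test_fun U f : Prop :=
  [/\ smooth f, compact (support f) & support f `<=` U].

Definition L2 U f : Prop :=
  measurable_fun U f /\ mu.-integrable U (fun x => ((f x) ^+ 2)%:E).

Definition weak_partial U k f d : Prop :=
  L2 U d /\
  forall phi, test_fun U phi ->
    \int[mu]_(x in U) (f x * partial k phi x) =
    - \int[mu]_(x in U) (d x * phi x).

Definition H1 U f : Prop := L2 U f /\ forall k, exists d, weak_partial U k f d.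

Definition wpartial U k f : E -> R := xget (cst 0) [set d | weak_partial U k f d].

Definition grad_dot U v w : E -> R :=
  fun x => \sum_(k < n.+1) wpartial U k v x * wpartial U k w x.

Definition ipH1 U v w : R := \int[mu]_(x in U) (grad_dot U v w x + v x * w x).

Definition H10 U v : Prop :=
  H1 U v /\
  forall eps, 0 < eps -> exists2 phi, test_fun U phi &
    Num.sqrt (ipH1 U (v \- phi) (v \- phi)) < eps.

Definition vanishes_near_boundary Om v : Prop :=
  exists2 r, 0 < r &
    eq_on (Om `&` [set x | exists2 y, boundary Om y & `|x - y| < r]) v (cst 0).

(* "[v = 0] on the boundary of [Om]" for [v] in a space [W] of piecewise [H1]
   functions on [Om] with norm [nrm]: as for [H10], membership in the closure of
   those elements of [W] that vanish in a neighbourhood of the boundary. *)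
Definition zero_on_boundary Om (W : set (E -> R)) (nrm : (E -> R) -> R) v : Prop :=
  forall eps, 0 < eps ->
    exists2 w, W w /\ vanishes_near_boundary Om w & nrm (v \- w) < eps.

(** * Spans and dimension, modulo equality almost everywhere *)

Definition lin_comb m (c : 'I_m -> R) (b : 'I_m -> E -> R) : E -> R :=
  fun x => \sum_(i < m) c i * b i x.

Definition span (S : set (E -> R)) : set (E -> R) :=
  [set w | exists m (c : 'I_m -> R) (b : 'I_m -> E -> R),
     (forall i, S (b i)) /\ w = lin_comb c b].

Definition has_dim Om (T : set (E -> R)) (m : nat) : Prop :=
  exists b : 'I_m -> E -> R,
    [/\ forall i, T (b i),
        forall c, eq_on Om (lin_comb c b) (cst 0) -> forall i, c i = 0 &
        forall w, T w -> exists c, eq_on Om w (lin_comb c b)].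

End sobolev.

(** * Functionals on a space of functions *)

Section functionals.
Context {X : Type} {R : realType}.
Implicit Types (HH : set (X -> R)) (nrm : (X -> R) -> R).

Definition linear_on HH (F : (X -> R) -> R) : Prop :=
  forall a v w, HH v -> HH w -> F (a \*o v \+ w) = a * F v + F w.

Definition in_dual HH nrm (F : (X -> R) -> R) : Prop :=
  linear_on HH F /\ exists C, forall v, HH v -> `|F v| <= C * nrm v.

Definition bilinear_on HH (B : (X -> R) -> (X -> R) -> R) : Prop :=
  (forall v, HH v -> linear_on HH (B v)) /\
  (forall w, HH w -> linear_on HH (B ^~ w)).

(* [e1 x v] and [e2 x v w] are the first and second directional derivatives
   e'(x; v) and e''(x; v, w) of [e] on [HH]. *)
Definition derivatives_on HH (e : (X -> R) -> R) (e1 : (X -> R) -> (X -> R) -> R)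
    (e2 : (X -> R) -> (X -> R) -> (X -> R) -> R) : Prop :=
  forall x, HH x ->
    [/\ linear_on HH (e1 x) /\
          forall v, HH v -> is_derive (0 : R^o) (1 : R^o)
            (fun t : R^o => e (x \+ t \*o v) : R^o) (e1 x v),
        bilinear_on HH (e2 x),
        forall v w, HH v -> HH w -> e2 x v w = e2 x w v &
        forall v w, HH v -> HH w -> is_derive (0 : R^o) (1 : R^o)
          (fun t : R^o => e1 (x \+ t \*o w) v : R^o) (e2 x v w)].

(* Three times Frechet differentiable at every point of a ball around [x0], the
   derivatives being measured in the norms of bounded multilinear forms. *)
Definition three_times_differentiable_near HH nrm e e1 e2 (x0 : X -> R) : Prop :=
  exists (r : R) (e3 : (X -> R) -> (X -> R) -> (X -> R) -> (X -> R) -> R), 0 < r /\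
  forall x, HH x -> nrm (x \- x0) < r ->
    [/\ in_dual HH nrm (e1 x),
        bilinear_on HH (e2 x) /\ (exists C, forall v w, HH v -> HH w ->
          `|e2 x v w| <= C * nrm v * nrm w),
        (forall k, HH k -> bilinear_on HH (fun v w => e3 x v w k)) /\
        (forall v w, HH v -> HH w -> linear_on HH (e3 x v w)) /\
        (exists C, forall v w k, HH v -> HH w -> HH k ->
          `|e3 x v w k| <= C * nrm v * nrm w * nrm k) &
        forall eps, 0 < eps -> exists2 del, 0 < del &
          forall k, HH k -> nrm k < del ->
          [/\ `|e (x \+ k) - e x - e1 x k| <= eps * nrm k,
              forall v, HH v ->
                `|e1 (x \+ k) v - e1 x v - e2 x v k| <= eps * nrm k * nrm v &
              forall v w, HH v -> HH w ->
                `|e2 (x \+ k) v w - e2 x v w - e3 x v w k|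
                  <= eps * nrm k * nrm v * nrm w]].

End functionals.

(** * The spaces and the functions [g(lambda)] attached to [e'(u)]

  [F] stands for e'(u; .) and [B] for e''(u; ., .); an element of [Lambda] is
  given by its values on the [Omi i]. *)

Section adapted.
Context {R : realType} {n N : nat}.
Local Notation E := 'rV[R]_n.+1.
Local Notation mu := (lebesgue_rV R n.+1).
Variables (Om : set E) (Omi : 'I_N -> set E).
Variables (F : (E -> R) -> R) (B : (E -> R) -> (E -> R) -> R) (kappa : R).
Implicit Types (J : {set 'I_N}) (lam : 'I_N -> \bar R) (l : 'I_N -> R).
Implicit Types (v w : E -> R).

(* The distribution [g0 : phi |-> F phi] on [U] is the function [w]. *)
Definition g0_eq (U : set E) w : Prop :=
  forall phi, test_fun U phi -> \int[mu]_(x in U) (w x * phi x) = F phi.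

Definition cl_union J : set E := \bigcup_(i in [set i | i \in J]) closure (Omi i).

Definition g0_in_H1 (D : set E) : Prop :=
  exists2 w, H1 (Om `&` interior D) w & g0_eq (Om `&` interior D) w.

(* [cl_union J] is a largest such union, that is, one contained in no other. *)
Definition largest_H1_union J : Prop :=
  g0_in_H1 (cl_union J) /\
  forall J', J \subset J' -> g0_in_H1 (cl_union J') -> J' = J.

(* [O] stands for the set Omega_{0,H1}. *)
Definition I0H1 (O : set E) : {set 'I_N} := [set i | `[< Omi i `<=` O >]].

Definition ipH (O : set E) v w : R :=
  ipH1 (Om `\` O) v w + \sum_(i in I0H1 O) ipH1 (Omi i) v w.

Definition normH (O : set E) v : R := Num.sqrt (ipH O v v).

Definition pieceH (O : set E) : set (E -> R) :=
  [set v | H1 (Om `\` O) v /\ forall i, i \in I0H1 O -> H1 (Omi i) v].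

Definition spaceH (O : set E) : set (E -> R) :=
  [set v | pieceH O v /\ zero_on_boundary Om (pieceH O) (normH O) v].

Definition I0 lam : {set 'I_N} := [set i | lam i == 0%E].
Definition Ioo lam : {set 'I_N} := [set i | lam i == +oo%E].

Definition bdLambda : set ('I_N -> \bar R) :=
  [set lam | (forall i, (0 <= lam i)%E) /\ exists i, i \in I0 lam :|: Ioo lam].

Definition Om0 lam : set E := \bigcup_(i in [set i | i \in I0 lam]) Omi i.

(* The open set meant by [Om \ Om0], from which it differs by a null set. *)
Definition Om1 lam : set E := interior (Om `\` Om0 lam).

Definition pieceV lam : set (E -> R) :=
  [set v | H1 (Om1 lam) v /\ H1 (Om0 lam) v].

Definition normV lam v : R :=
  Num.sqrt (ipH1 (Om1 lam) v v + ipH1 (Om0 lam) v v).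

Definition spaceV lam : set (E -> R) :=
  [set v | [/\ pieceV lam v, zero_on_boundary Om (pieceV lam) (normV lam) v &
     forall i, i \in Ioo lam -> exists C, eq_on (Omi i) v (cst C)]].

(* [fine +oo = 0]: no gradient term on the [Omi i] with [lam i = +oo]. *)
Definition coef lam : E -> R := fun x => \sum_(i < N) fine (lam i) * \1_(Omi i) x.

Definition is_g lam w : Prop :=
  spaceV lam w /\
  forall v, spaceV lam v ->
    \int[mu]_(x in Om `\` Om0 lam)
        (coef lam x * grad_dot (Om1 lam) w v x + w x * v x)
    + \int[mu]_(x in Om0 lam) (w x * v x) = F v.

Definition g_of lam : E -> R := xget (cst 0) [set w | is_g lam w].

Definition jfun lam : R := kappa / 2 * B (g_of lam) (g_of lam) - F (g_of lam).

Definition admissible (O : set E) lam : Prop :=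
  [/\ bdLambda lam, I0 lam \subset I0H1 O & exists w, is_g lam w].

Definition j_minimizer (O : set E) lam : Prop :=
  admissible O lam /\ forall lam', admissible O lam' -> jfun lam <= jfun lam'.

Definition hatLambda lam : set ('I_N -> R) :=
  [set l | forall i, i \in I0 lam :|: Ioo lam -> l i = 0].

Definition shift_lam lam (t : R) l : 'I_N -> \bar R :=
  fun i => (lam i + (t * l i)%:E)%E.

Definition is_g_derive (O : set E) lam l w : Prop :=
  [/\ spaceH O w,
      \forall t \near (0 : R), exists w', is_g (shift_lam lam t l) w' &
      normH O (t^-1 \*o (g_of (shift_lam lam t l) \- g_of lam) \- w)
        @[t --> (0 : R)^'] --> (0 : R)].

Definition spaceT (O : set E) lam : set (E -> R) :=
  span [set w | exists2 l, hatLambda lam l & is_g_derive O lam l w].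

(* The indices with [g <> g0] in D'(Omi i). Those with [lam i = +oo], where [g]
   is a constant that no variation in [hatLambda] releases, are left out: with
   them d <= dim T fails, e.g. for [N = 1], e(v) = |v|^2 / 2 - int f v on H10,
   u = 0 and f in L2 but not in H1, where [lam = +oo], g = 0, T = 0 and
   g0 = - f. *)
Definition d_indices lam : {set 'I_N} :=
  [set i | (i \notin Ioo lam) && `[< ~ g0_eq (Omi i) (g_of lam) >]].

End adapted.

(* Main.v *)
Require Import Defs.
From HB Require Import structures.
From mathcomp Require Import all_boot all_order all_algebra.
From mathcomp Require Import all_classical all_reals all_analysis.
From mathcomp Require Import measurable_realfun.
From mathcomp Require Import ring lra.

Set Implicit Arguments.
Unset Strict Implicit.
Unset Printing Implicit Defensive.

Import Order.TTheory GRing.Theory Num.Theory.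
Import numFieldNormedType.Exports.

Local Open Scope classical_set_scope.
Local Open Scope ring_scope.

(** Let [K] be the set of indices [i] with [0 < lam i < +oo], let [l] be a
   direction in [hatLambda lam], that is, supported in [K], and put
   lam_t = lam + t l.  For small [t] of either sign, lam_t has the same sets
   [I0] and [Ioo] as [lam], hence the same space V(lam), and it is again
   admissible for the minimization of [j].  Three facts give the theorem.

   1. Sensitivity.  Write a(lam; g, v) for the left-hand side of the equation
   that defines g(lam).  It is affine in [lam] on [K], with derivative
   b(l; g, v) = sum of l_i int_{Omega_i} grad g . grad v.  Subtracting the
   equations for lam_t and lam shows that g(lam_t) - g(lam) solves an elliptic
   problem with right-hand side - t b(l; g, v), posed on the elements of V(lam)
   that vanish on Omega_0, where a(lam; ., .) is coercive.  Hence g is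
   differentiable, and w = g'(lam; l) is the solution of a(lam; w, v) =
   - b(l; g, v) ([g_derivable], [is_g_derive_unique]).  In particular it depends
   linearly on [l].  Solvability of these problems is Riesz representation, so it
   needs HH to be complete.  That follows from the invertibility of
   e''(uhat; ., .): the limit functional of e''(uhat; v_n, .) along a Cauchy
   sequence is represented by some v, and coercivity turns the convergence of
   functionals into v_n --> v ([complete_of_representable]).

   2. First-order condition.  As [lam] minimizes j = f o g and both directions
   l and - l are allowed, the derivative of the quadratic function f along the
   curve g(lam_t) vanishes at t = 0, which reads kappa e''(u; g, w) = e'(u; w) for
   w = g'(lam; l) ([minimizer_derivative]).  With e'(u; w) = e''(u; h, w) and by
   linearity, kappa g - h is orthogonal to T_u for e''(u; ., .).  The difference
   of the projections of h and kappa g then lies in T_u and is orthogonal to T_u,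
   so it is 0 by coercivity.

   3. Dimension.  By linearity in [l], T_u is spanned by W_i = g'(lam; 1_i) for
   i in [K], and [K] has N - |I0| - |Ioo| elements.  Conversely the W_i with
   g <> g0 in D'(Omega_i) are independent ([d_indices_indep]): testing sum_i c_i W_i = 0
   with phi in D(Omega_i) leaves c_i int_{Omega_i} grad g . grad phi = 0, and if
   c_i <> 0 the equation for g reduces to int_{Omega_i} g phi = e'(u; phi), that is,
   g = g0 there.  The same equation shows g = g0 where [lam i = 0]; as [d_indices]
   leaves out the indices with [lam i = +oo], it is contained in [K]
   ([d_indices_sub]).

   All the norms that occur are compared through one form, [ipP], the sum over
   the pieces Omega_i of the H1 inner products: the norms of HH and of the
   V(lam) agree with it, because weak derivatives restrict to open subsets.
   Weak derivatives are unique by the fundamental lemma of the calculus of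
   variations, and they are the classical ones for test functions by
   integration by parts; both are proved here for Lebesgue measure on row
   vectors. *)

(** * Boxes, open sets and the Borel sigma-algebra *)

Section boxes.
Context {R : realType}.

Definition obox n (a b : 'rV[R]_n) : set 'rV[R]_n :=
  [set x | forall i, a 0 i < x 0 i < b 0 i].

Lemma measurable_obox n (a b : 'rV[R]_n) : measurable (obox a b).
Proof.
rewrite (_ : obox a b =
    \bigcap_(i in [set: 'I_n]) (rV_coord i @^-1` [set` `]a 0 i, b 0 i[])).
  apply: fin_bigcap_measurable => [|i _]; first exact: finite_finset.
  by rewrite -[X in measurable X]setTI; exact: measurable_rV_coord.
apply/seteqP; split=> x /= xab i => [_|]; first by rewrite /= in_itv/= xab.
by have := xab i I; rewrite /= in_itv.
Qed.

Lemma measurable_preimage_rV_cons n (A : set 'rV[R]_n.+1) :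
  measurable A -> measurable (@rV_cons R n @^-1` A).
Proof. by move=> mA; rewrite -[X in measurable X]setTI; exact: measurable_rV_cons. Qed.

Lemma rV_cons0 n (p : 'rV[R]_n * R) : rV_cons p 0 ord0 = p.2.
Proof.
rewrite /rV_cons (_ : ord0 = lshift n (ord0 : 'I_1)); last exact/val_inj.
by rewrite (row_mxEl (p.2%:M : 'rV_1)) mxE eqxx mulr1n.
Qed.

Lemma rV_consS n (p : 'rV[R]_n * R) i : rV_cons p 0 (lift ord0 i) = p.1 0 i.
Proof.
rewrite /rV_cons (_ : lift ord0 i = rshift 1 i); last exact/val_inj.
by rewrite (row_mxEr (p.2%:M : 'rV_1)).
Qed.

Lemma obox_rV_cons n (a b : 'rV[R]_n.+1) :
  @rV_cons R n @^-1` obox a b =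
  obox (\row_i a 0 (lift ord0 i)) (\row_i b 0 (lift ord0 i))
    `*` [set` `]a 0 ord0, b 0 ord0[].
Proof.
apply/seteqP; split=> [p pab|p [pab p0] i].
  split=> [i|]; first by have := pab (lift ord0 i); rewrite rV_consS !mxE.
  by have := pab ord0; rewrite rV_cons0 /= in_itv.
case: (unliftP ord0 i) => [j|] ->.
  by have := pab j; rewrite rV_consS !mxE.
by move: p0; rewrite rV_cons0 /= in_itv.
Qed.

Lemma lebesgue_rV_obox_fin n (a b : 'rV[R]_n) :
  (lebesgue_rV R n (obox a b) < +oo)%E.
Proof.
elim: n a b => [|n IHn] a b /=.
  by rewrite diracE; case: (_ \in _) => //=; rewrite ltry.
rewrite /lebesgue_rV_succ /pushforward obox_rV_cons product_measure1E //=.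
- by rewrite lebesgue_measure_itv /=; apply: lte_mul_pinfty => //;
    [rewrite ge0_fin_numE | case: ifP => _; rewrite ?EFinN -?EFinB ltry].
- exact: measurable_obox.
Qed.

Lemma obox_constP n (r : R) (x : 'rV[R]_n) :
  obox (const_mx (- r)) (const_mx r) x <-> forall i, `|x 0 i| < r.
Proof. by split=> h i; have := h i; rewrite !mxE ltr_norml. Qed.

Lemma lebesgue_rV_sigma_finite n :
  sigma_finite [set: 'rV[R]_n] (lebesgue_rV R n).
Proof.
exists (fun k => obox (const_mx (- k%:R)) (const_mx k%:R)); last first.
  by move=> k; split; [exact: measurable_obox|exact: lebesgue_rV_obox_fin].
apply/seteqP; split=> // x _.
exists (Num.Def.truncn (\sum_i `|x 0 i|)).+1 => //; apply/obox_constP => i.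
apply: le_lt_trans (truncnS_gt _); rewrite (bigD1 i) //= lerDl.
exact: sumr_ge0.
Qed.

End boxes.

Section open_sets.
Context {R : realType} {n : nat}.
Local Notation E := 'rV[R]_n.+1.

Definition cbox (a b : E) : set E := [set x | forall i, a 0 i <= x 0 i <= b 0 i].

Lemma ball_rVP (x y : E) e : 0 < e ->
  (forall i, `|x 0 i - y 0 i| < e) <-> ball x e y.
Proof.
move=> e0; split=> [xy|[_ xy] i]; last exact: xy.
by split=> // i j; rewrite !ord1; exact: xy.
Qed.

(** Rational boxes whose closure lies in [U] cover [U]. The closed boxes matter:
   the bump function of a box is a test function of [U] only if its closed box lies in [U]. *)
Lemma open_bigcup_obox (U : set E) : open U ->
  exists a b : nat -> E, U = \bigcup_k obox (a k) (b k) /\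
    forall k, cbox (a k) (b k) `<=` U.
Proof.
move=> oU.
pose box (p : 'rV[rat]_n.+1 * 'rV[rat]_n.+1) : E * E :=
  (map_mx ratr p.1, map_mx ratr p.2).
(* Indices that code no suitable box are sent to the empty box from 1 to 0. *)
pose c k := if unpickle k is Some p then
    if `[< cbox (box p).1 (box p).2 `<=` U >] then box p
    else (const_mx 1, const_mx 0) else (const_mx 1 : E, const_mx 0 : E).
have cU k : cbox (c k).1 (c k).2 `<=` U.
  have e0 : cbox (const_mx 1 : E) (const_mx 0) `<=` U.
    move=> x /(_ ord0); rewrite !mxE => /andP[/le_trans h /h].
    by rewrite ler10.
  by rewrite /c; case: unpickle => // p; case: asboolP.
exists (fun k => (c k).1), (fun k => (c k).2); split => //.
apply/seteqP; split=> [x Ux|x [k _ xk]]; last first.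
  by apply: (cU k) => i; have /andP[/ltW -> /ltW ->] := xk i.
have /nbhs_ballP[e /= e0 xeU] := open_nbhs_nbhs (conj oU Ux).
have l i : x 0 i - e < x 0 i by rewrite ltrBlDr ltrDl.
have r i : x 0 i < x 0 i + e by rewrite ltrDl.
pose p := (\row_i projT1 (cid (rat_in_itvoo (l i))),
           \row_i projT1 (cid (rat_in_itvoo (r i)))).
have p1 i : x 0 i - e < (box p).1 0 i < x 0 i.
  by rewrite !mxE; case: cid => q /=; rewrite in_itv.
have p2 i : x 0 i < (box p).2 0 i < x 0 i + e.
  by rewrite !mxE; case: cid => q /=; rewrite in_itv.
exists (pickle p) => //; rewrite /c pickleK asboolT.
  by move=> i; have /andP[_ ->] := p1 i; have /andP[-> _] := p2 i.
move=> y yp; apply: xeU; apply/(ball_rVP _ _ e0) => i.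
have /andP[p1l _] := p1 i; have /andP[_ p2r] := p2 i.
by have /andP[a b] := yp i; rewrite ltr_norml; apply/andP; split; lra.
Qed.

Lemma open_measurable_rV (U : set E) : open U -> measurable U.
Proof.
move=> /open_bigcup_obox[a [b [-> _]]].
by apply: bigcupT_measurable => k; exact: measurable_obox.
Qed.

Lemma continuous_measurable_rV (f : E -> R) (D : set E) :
  continuous f -> measurable_fun D f.
Proof.
move=> /continuousP cf; apply: measurable_funTS.
apply: (measurability _ (RGenOInfty.measurableE R)).
move=> _ [_ [a ->] <-]; rewrite setTI.
by apply: open_measurable_rV; apply: cf; exact: interval_open.
Qed.

(** A pi-system that generates the Borel sets: the one on which Dynkin's lemma
   is applied below. *)
Definition boxes : set (set E) := [set A | exists a b, A = obox a b].

Lemma obox_setI (a b c d : E) : obox a b `&` obox c d =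
  obox (\row_i Num.max (a 0 i) (c 0 i)) (\row_i Num.min (b 0 i) (d 0 i)).
Proof.
apply/seteqP; split=> [x [xa xc] i|x x0].
  by rewrite !mxE gt_max lt_min; have /andP[-> ->] := xa i; exact: xc.
by split=> i; have := x0 i; rewrite !mxE gt_max lt_min =>
  /andP[/andP[xa xc]] /andP[xb xd]; rewrite ?xa ?xb ?xc ?xd.
Qed.

Lemma boxes_setI : setI_closed boxes.
Proof.
move=> _ _ [a [b ->]] [c [d ->]]; rewrite obox_setI.
by do 2 eexists.
Qed.

Lemma measurable_boxesE : measurable = <<s boxes >> :> set (set E).
Proof.
apply/seteqP; split; last first.
  apply: smallest_sub; first exact: sigma_algebra_measurable.
  by move=> _ [a [b ->]]; exact: measurable_obox.
apply: smallest_sub; first exact: smallest_sigma_algebra.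
rewrite -bigcup_mkord_ord; apply: bigcup_sub => i ltin.
suff : measurable_fun [set: g_sigma_algebraType boxes]
    (rV_coord (inord i : 'I_n.+1) : g_sigma_algebraType boxes -> R).
  by move=> mi _ [B mB <-]; exact: mi.
apply: (measurability _ (RGenOInfty.measurableE R)).
move=> _ [B [x ->] <-]; rewrite setTI.
pose a k : E := \row_j if j == inord i then x else - k%:R.
rewrite (_ : _ @^-1` _ = \bigcup_k obox (a k) (const_mx k%:R)).
  apply: bigcupT_measurable => k; apply: sub_sigma_algebra.
  by exists (a k), (const_mx k%:R).
apply/seteqP; split=> y /=; rewrite /rV_coord /= in_itv /= andbT; last first.
  by move=> [k _ /(_ (inord i))]; rewrite !mxE eqxx => /andP[].
move=> xy; exists (Num.Def.truncn (\sum_j `|y 0 j|)).+1 => // j; rewrite !mxE.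
have : `|y 0 j| < (Num.Def.truncn (\sum_j `|y 0 j|)).+1%:R.
  apply: le_lt_trans (truncnS_gt _); rewrite (bigD1 j) //= lerDl.
  exact: sumr_ge0.
by rewrite ltr_norml => /andP[? ->]; case: eqP => [->|]; rewrite andbT.
Qed.

End open_sets.

(** * Bump functions *)

Section flat_functions.
Context {R : realType}.
Implicit Types (p : {poly R}) (x : R).

(** The functions p(1/x) exp(- 1/x) on the positive axis, extended by 0, are closed
   under differentiation because of the polynomial factor; so exp(- 1/x) is smooth. *)
Definition hexp p x : R := if 0 < x then p.[x^-1] * expR (- x^-1) else 0.

Definition hexp_deriv p : {poly R} := 'X^2 * (p - p^`()).

(** As exp(1/x) dominates every power of 1/x, there is a quadratic bound at 0,
   so that the derivative there exists and is 0. *)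
Lemma hexp_flat p : exists C, forall x, 0 < x -> x <= 1 ->
  `|hexp p x| <= C * x ^+ 2.
Proof.
pose A := \sum_(i < size p) `|p`_i|; pose m := (size p).+1.
have A0 : 0 <= A by exact: sumr_ge0.
exists (A * (m.+1)`!%:R) => x x0 x1; rewrite /hexp x0.
set t := x^-1; have t1 : 1 <= t by rewrite /t invf_ge1.
have t0 : 0 < t by exact: lt_le_trans t1.
have pA : `|p.[t]| <= A * t ^+ size p.
  rewrite horner_coef (le_trans (ler_norm_sum _ _ _)) // mulr_suml.
  apply: ler_sum => i _; rewrite normrM; apply: ler_wpM2l => //.
  by rewrite ger0_norm ?exprn_ge0 ?(ltW t0) // ler_weXn2l // ltnW.
have et : t ^+ m.+1 / (m.+1)`!%:R <= expR t.
  by apply: le_trans (expR_ge1Dxn m (ltW t0)); rewrite lerDr.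
have f0 : (0 : R) < (m.+1)`!%:R by rewrite ltr0n fact_gt0.
rewrite normrM (ger0_norm (expR_ge0 _)) expRN.
apply: (@le_trans _ _ (A * t ^+ size p * ((m.+1)`!%:R / t ^+ m.+1))).
  apply: ler_pM => //.
  rewrite -[leRHS]invrK invf_div lef_pV2 // posrE ?expR_gt0 //.
  by rewrite divr_gt0 ?exprn_gt0.
have -> : x = t^-1 by rewrite /t invrK.
rewrite (_ : _ * _ = A * (m.+1)`!%:R * t^-1 ^+ 2) // /m !exprS.
by field; rewrite ?expf_neq0 ?gt_eqF.
Qed.

Lemma is_derive_hexp p x : is_derive x 1 (hexp p) (hexp (hexp_deriv p) x).
Proof.
have [x0|x0|->] := ltgtP x 0.
- apply: (@near_eq_is_derive _ _ _ (cst 0)); last first.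
    by rewrite /hexp ltNge (ltW x0); exact: is_derive_cst.
  near=> y; rewrite /hexp ifF // lt_gtF //; near: y.
  exact: lt_nbhsl.
- apply: (@near_eq_is_derive _ _ _ (fun y : R => p.[y^-1] * expR (- y^-1))).
    by near=> y; rewrite /hexp ifT //; near: y; exact: lt_nbhsr.
  have xn0 : (x : R) != 0 by rewrite gt_eqF.
  have dV : is_derive x 1 (fun y : R => y^-1) (- x ^- 2).
    by have := @is_deriveV _ id x 1 1 xn0 _; rewrite scaler1; apply; exact: is_derive_id.
  have dp : is_derive x 1 (fun y : R => p.[y^-1]) (p^`().[x^-1] * - x ^- 2).
    exact: (@is_derive1_comp _ (horner p) (fun y : R => y^-1)).
  have dN : is_derive x 1 (fun y : R => - y^-1) (x ^- 2).
    by have := is_deriveN dV; rewrite opprK.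
  have de : is_derive x 1 (fun y : R => expR (- y^-1)) (expR (- x^-1) * x ^- 2).
    exact: (@is_derive1_comp _ expR (fun y : R => - y^-1)).
  have := is_deriveM dp de; congr is_derive.
  rewrite /hexp x0 /hexp_deriv !hornerE /= /GRing.scale /= !exprVn; ring.
- rewrite {2}/hexp ltxx; have [C hC] := hexp_flat p.
  have hp0 : hexp p 0 = 0 by rewrite /hexp ltxx.
  have cv : h^-1 *: (hexp p (h *: 1 + 0) - hexp p 0) @[h --> (0:R)^'] --> (0 : R).
    rewrite hp0; apply/cvgr0Pnorm_le => e e0.
    near=> h; rewrite subr0 addr0 /GRing.scale /= mulr1.
    have [h0|h0] := leP h 0; first by rewrite /hexp ltNge h0 mulr0 normr0 ltW.
    have h1 : h <= 1.
      by rewrite (le_trans (ler_norm _)) //; near: h; exact: dnbhs0_le.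
    have he : h <= e / (`|C| + 1).
      rewrite (le_trans (ler_norm _)) //; near: h; apply: dnbhs0_le.
      by rewrite divr_gt0 // ltr_wpDl.
    rewrite normrM normfV (gtr0_norm h0) ler_pdivrMl //.
    apply: le_trans (hC h h0 h1) _; rewrite expr2 mulrA mulrC ler_pM2l //.
    rewrite (@le_trans _ _ ((`|C| + 1) * h)) ?ler_pM2r //.
      by rewrite (le_trans (ler_norm _)) // lerDl.
    by rewrite mulrC -ler_pdivlMr // ltr_wpDl.
  split; last exact: cvg_lim cv.
  by apply/cvg_ex; exists 0.
Unshelve. all: by end_near. Qed.

Lemma hexp1_ge0 x : 0 <= hexp 1 x.
Proof. by rewrite /hexp hornerC mul1r; case: ifP => // _; exact: expR_ge0. Qed.

Lemma hexp1_le1 x : hexp 1 x <= 1.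
Proof.
rewrite /hexp hornerC mul1r; case: ifP => // x0.
by rewrite expR_le1 oppr_le0 invr_ge0 ltW.
Qed.

Lemma hexp1_neq0 x : (hexp 1 x != 0) = (0 < x).
Proof.
rewrite /hexp hornerC mul1r; case: ifP => _; last by rewrite eqxx.
by rewrite expR_eq0.
Qed.

Lemma hexp1_cvg x : 0 < x -> hexp 1 (k.+1%:R * x) @[k --> \oo] --> (1 : R).
Proof.
move=> x0.
have -> : (fun k : nat => hexp 1 (k.+1%:R * x)) =
    (fun k : nat => expR (- (k.+1%:R^-1 * x^-1))).
  by apply/funext => k; rewrite /hexp hornerC mul1r mulr_gt0 // invfM.
have h : (k.+1%:R^-1 * x^-1 : R) @[k --> \oo] --> (0 * x^-1 : R).
  by apply: cvgM; [exact: cvg_harmonic|exact: cvg_cst].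
rewrite [X in _ --> X](_ : 1 = expR (- (0 * x^-1))).
  by apply: continuous_cvg; [exact: continuous_expR|exact: cvgN].
by rewrite mul0r oppr0 expR0.
Qed.

End flat_functions.

Lemma is_derive_line (R : realType) (V : normedModType R) (f : V -> R) (x v : V) df :
  is_derive (0 : R) 1 (fun h : R => f (h *: v + x)) df -> is_derive x v f df.
Proof.
move=> [dv dE].
have E1 : (fun h : R => h^-1 *: (f (h *: v + x) - f x)) =
    (fun h : R => h^-1 *: (f ((h *: (1 : R) + 0) *: v + x) - f (0 *: v + x))).
  by apply/funext => h; rewrite addr0 scale0r add0r /GRing.scale /= mulr1.
by split; [rewrite /derivable E1|rewrite /derive E1].
Qed.

Section bumps.
Context {R : realType} {n : nat}.
Local Notation E := 'rV[R]_n.+1.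

(** An inductive class closed under partial derivatives all of whose members are
   differentiable: its members are smooth, without a formula for higher derivatives. *)
Inductive flat : (E -> R) -> Prop :=
| flat_hexp p c b (i : 'I_n.+1) : flat (fun x => hexp p (c * x 0 i + b))
| flat_cst r : flat (cst r)
| flat_mul f g : flat f -> flat g -> flat (f * g)
| flat_add f g : flat f -> flat g -> flat (f + g).

Lemma partial_hexp p c b (i k : 'I_n.+1) (x : E) :
  is_derive x (delta_mx 0 k : E) (fun x : E => hexp p (c * x 0 i + b))
    (c * (i == k)%:R * hexp (hexp_deriv p) (c * x 0 i + b)).
Proof.
apply: is_derive_line.
have dl : is_derive (0 : R) 1
    (fun h : R => c * (h *: (delta_mx 0 k : E) + x) 0 i + b) (c * (i == k)%:R).
  rewrite (_ : (fun h : R => _) =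
      (fun h : R => (c * (i == k)%:R) * h + (c * x 0 i + b))); last first.
    by apply/funext => h; rewrite !mxE eqxx /=; ring.
  have := is_deriveD (is_deriveZ (c * (i == k)%:R) (is_derive_id (0 : R) 1))
    (is_derive_cst (c * x 0 i + b : R) (0 : R) (1 : R)).
  by rewrite addr0 /GRing.scale /= mulr1.
have := @is_derive1_comp _ (hexp p) _ 0 _ _ (is_derive_hexp p _) dl.
by rewrite mulrC scale0r add0r.
Qed.

Lemma flat_differentiable f : flat f -> forall x, differentiable (f : E -> R^o) x.
Proof.
elim=> {f} [p c b i|r|f g _ df _ dg|f g _ df _ dg] x.
- have dh : differentiable (hexp p : R -> R^o) (c * x 0 i + b).
    by apply/derivable1_diffP; case: (is_derive_hexp p (c * x 0 i + b)).
  have dl : differentiable (fun x : E => c * x 0 i + b : R^o) x.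
    apply: differentiableD; last exact: differentiable_cst.
    apply: differentiableM; first exact: differentiable_cst.
    exact: differentiable_coord.
  exact: (@differentiable_comp _ _ _ _ (fun x : E => c * x 0 i + b : R^o)
    (hexp p : R^o -> R^o)).
- exact: differentiable_cst.
- exact: differentiableM.
- exact: differentiableD.
Qed.

Lemma flat_derivable f x v : flat f -> derivable (f : E -> R^o) x v.
Proof. by move=> ff; apply: diff_derivable; exact: flat_differentiable. Qed.

Lemma flat_partial f k : flat f -> flat (partial k f).
Proof.
elim=> {f} [p c b i|r|f g ff pf fg pg|f g ff pf fg pg].
- rewrite (_ : partial _ _ = cst (c * (i == k)%:R) *
      (fun x : E => hexp (hexp_deriv p) (c * x 0 i + b))).
    by apply: flat_mul; constructor.
  by apply/funext => x; have [_ e] := partial_hexp p c b i k x; exact: e.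
- rewrite (_ : partial _ _ = cst 0); first by constructor.
  by apply/funext => x; rewrite /partial derive_cst.
- rewrite (_ : partial _ _ = f * partial k g + g * partial k f).
    by apply: flat_add; apply: flat_mul.
  apply/funext => x; rewrite /partial.
  by rewrite (@deriveM _ _ (f : E -> R^o) g) //; exact: flat_derivable.
- rewrite (_ : partial _ _ = partial k f + partial k g).
    exact: flat_add.
  apply/funext => x; rewrite /partial.
  by rewrite (@deriveD _ _ _ (f : E -> R^o) g) //; exact: flat_derivable.
Qed.

Lemma flat_smooth f : flat f -> smooth f.
Proof.
move=> ff s x; apply: flat_differentiable.
by elim: s => //= k s; exact: flat_partial.
Qed.

Lemma flat_prod (I : Type) (s : seq I) (F : I -> E -> R) :
  (forall i, flat (F i)) -> flat (fun x => \prod_(i <- s) F i x).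
Proof.
move=> fF; elim: s => [|i s ih].
  rewrite (_ : (fun _ => _) = cst 1); first by constructor.
  by apply/funext => x; rewrite big_nil.
rewrite (_ : (fun _ => _) = F i * (fun x => \prod_(j <- s) F j x)).
  exact: flat_mul.
by apply/funext => x; rewrite big_cons.
Qed.

(** As [k] grows these functions tend to the indicator of the open box. *)
Definition bump (a b : E) (k : nat) : E -> R := fun x =>
  \prod_i (hexp 1 (k.+1%:R * (x 0 i - a 0 i)) * hexp 1 (k.+1%:R * (b 0 i - x 0 i))).

Lemma bump_ge0 a b k x : 0 <= bump a b k x.
Proof. by apply: prodr_ge0 => i _; rewrite mulr_ge0 // hexp1_ge0. Qed.

Lemma bump_le1 a b k x : bump a b k x <= 1.
Proof.
apply: prodr_ile1 => i _; rewrite mulr_ge0 ?hexp1_ge0 //=.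
by rewrite mulr_ile1 // ?hexp1_ge0 ?hexp1_le1.
Qed.

Lemma bump_neq0 a b k x : (bump a b k x != 0) <-> obox a b x.
Proof.
rewrite /bump; split=> [/prodf_neq0 h i|h].
  have := h i isT; rewrite mulf_eq0 negb_or !hexp1_neq0.
  by rewrite !pmulr_rgt0 // !subr_gt0.
apply/prodf_neq0 => i _; rewrite mulf_eq0 negb_or !hexp1_neq0.
by rewrite !pmulr_rgt0 // !subr_gt0; exact: h.
Qed.

Lemma bump_cvg a b x : obox a b x -> bump a b k x @[k --> \oo] --> (1 : R).
Proof.
move=> abx; rewrite /bump.
rewrite [X in _ --> X](_ : 1 = \prod_(i < n.+1) 1 :> R); last by rewrite big1.
apply: cvg_big; first exact: mul_continuous.
move=> i _; rewrite -[X in _ --> X]mulr1.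
by apply: cvgM; apply: hexp1_cvg; rewrite subr_gt0; have /andP[] := abx i.
Qed.

Lemma obox_sub_cbox (a b : E) : obox a b `<=` cbox a b.
Proof. by move=> x abx i; have /andP[/ltW -> /ltW ->] := abx i. Qed.

Lemma closed_cbox (a b : E) : closed (cbox a b).
Proof.
rewrite (_ : cbox a b =
   \bigcap_(i in [set: 'I_n.+1]) ((fun x : E => x 0 i) @^-1` [set` `[a 0 i, b 0 i]])).
  apply: closed_bigI => i _; apply: closed_comp; last exact: interval_closed.
  by move=> x _; exact: coord_continuous.
apply/seteqP; split=> x /= xab i => [_|]; first by rewrite /= in_itv/= xab.
by have := xab i I; rewrite /= in_itv.
Qed.

Lemma compact_cbox (a b : E) : compact (cbox a b).
Proof.
have := @rV_compact R n.+1 (fun i => [set` `[a 0 i, b 0 i]])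
   (fun i => @segment_compact R _ _).
congr compact; apply/seteqP; split=> x /= h i; have := h i; by rewrite /= in_itv.
Qed.

Lemma test_fun_bump (U : set E) a b k : cbox a b `<=` U -> test_fun U (bump a b k).
Proof.
move=> abU.
have sb : Defs.support (bump a b k) `<=` cbox a b.
  rewrite [X in _ `<=` X]((closure_id _).1 (@closed_cbox a b)).
  by apply: closure_subset => x /= /bump_neq0 /obox_sub_cbox.
split; last exact: subset_trans abU.
- apply: flat_smooth; apply: flat_prod => i.
  rewrite (_ : (fun _ => _) =
    (fun x : E => hexp 1 (k.+1%:R * x 0 i + - (k.+1%:R * a 0 i))) *
    (fun x : E => hexp 1 (- k.+1%:R * x 0 i + k.+1%:R * b 0 i))).
    by apply: flat_mul; constructor.
  by apply/funext => x /=; congr (hexp _ _ * hexp _ _); ring.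
- by apply: (subclosed_compact _ (@compact_cbox a b)) => //; exact: closed_closure.
Qed.

End bumps.

(** * The fundamental lemma of the calculus of variations *)

Section restriction_of_integrals.
Context d (T : measurableType d) (R : realType).
Variable mu : {measure set T -> \bar R}.
Implicit Types (f : T -> R) (D U : set T).

Lemma Rintegral_support D U f : D `<=` U ->
  (forall x, U x -> ~ D x -> f x = 0) ->
  \int[mu]_(x in U) f x = \int[mu]_(x in D) f x.
Proof.
move=> DU f0; rewrite Rintegral_mkcond [RHS]Rintegral_mkcond; congr Rintegral.
apply/funext => x; rewrite !patchE; case: ifPn => [/set_mem Ux|/negP nU].
  by case: ifPn => // /negP nD; apply: f0 => // Dx; apply: nD; rewrite inE.
by case: ifPn => // /set_mem /DU Ux; exfalso; apply: nU; rewrite inE.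
Qed.

Lemma bounded_integrable D f (M : R) : measurable D -> (mu D < +oo)%E ->
  measurable_fun D f -> (forall x, D x -> `|f x| <= M) ->
  mu.-integrable D (EFin \o f).
Proof.
move=> mD Dfin mf fM; apply: measurable_bounded_integrable => //.
by exists M; split; first exact: num_real; move=> y /ltW My x Dx; exact: le_trans (fM x Dx) My.
Qed.

End restriction_of_integrals.

Section fundamental_lemma.
Context {R : realType} {n : nat}.
Local Notation E := 'rV[R]_n.+1.
Local Notation mu := (lebesgue_rV R n.+1).

Lemma L2_integrable (U D : set E) (f : E -> R) : measurable U -> measurable D ->
  D `<=` U -> (mu D < +oo)%E -> L2 U f -> mu.-integrable D (EFin \o f).
Proof.
move=> mU mD DU finD [mf if2].
have i1 : mu.-integrable D (EFin \o (cst 1 : E -> R)).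
  apply: (@bounded_integrable _ _ _ _ _ _ 1) => // x _ /=.
  by rewrite normr1.
have i2 := integrableS mU mD DU if2.
apply: (le_integrable mD _ _ (integrableD mD i1 i2)).
  by apply/measurable_EFinP; exact: measurable_funS mf.
move=> x Dx /=; rewrite lee_fin [leRHS]ger0_norm; last by rewrite addr_ge0 ?sqr_ge0.
by case: (ler0P (f x)); nra.
Qed.

Lemma measurable_bump (a b : E) k D : measurable_fun D (bump a b k).
Proof.
apply: continuous_measurable_rV => x; apply: differentiable_continuous.
have [sm _ _] := @test_fun_bump _ _ setT a b k (@subsetT _ _).
exact: (sm [::] x).
Qed.

(** Dominated convergence along the bump functions of the box, which tend to its
   indicator. *)
Lemma integral_obox_eq0 (U : set E) (f : E -> R) a b : measurable U ->
  L2 U f -> cbox a b `<=` U ->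
  (forall phi, test_fun U phi -> \int[mu]_(x in U) (f x * phi x) = 0) ->
  (\int[mu]_(x in obox a b) (f x)%:E = 0)%E.
Proof.
move=> mU f2 abU f0; set D := obox a b.
have DU : D `<=` U := subset_trans (@obox_sub_cbox _ _ a b) abU.
have mD : measurable D by exact: measurable_obox.
have fi : mu.-integrable D (EFin \o f).
  by apply: L2_integrable f2 => //; exact: lebesgue_rV_obox_fin.
have mf : measurable_fun D f by apply/measurable_EFinP; exact: measurable_int fi.
have mfb k : measurable_fun D (fun x => (f x * bump a b k x)%:E).
  by apply/measurable_EFinP; apply: measurable_funM => //; exact: measurable_bump.
have fb k x : (`|(f x * bump a b k x)%:E| <= `|f x|%:E)%E.
  rewrite lee_fin normrM ler_piMr //.
  by rewrite ger0_norm ?bump_ge0 ?bump_le1.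
have ib k : mu.-integrable D (EFin \o (fun x => f x * bump a b k x)).
  apply: (le_integrable mD _ _ fi); first exact: mfb.
  by move=> x _; exact: fb.
have h k : (\int[mu]_(x in D) (f x * bump a b k x)%:E = 0)%E.
  rewrite -[LHS]fineK; last exact: (integrable_fin_num mD (ib k)).
  have := f0 _ (@test_fun_bump _ _ U a b k abU).
  rewrite (@Rintegral_support _ _ _ _ D) ?/Rintegral => [->|//|x _ nDx] //.
  rewrite (_ : bump _ _ _ _ = 0) ?mulr0 //.
  by apply/eqP; apply: contra_notT nDx => /bump_neq0.
have cv : {ae mu, forall x, D x ->
    (fun k => (f x * bump a b k x)%:E) @ \oo --> (f x)%:E}.
  apply: aeW => x Dx; apply: cvg_EFin; first exact: nearW.
  rewrite -[X in _ --> X]mulr1; apply: cvgM; first exact: cvg_cst.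
  exact: bump_cvg.
have [_ _] := @dominated_convergence _ _ _ mu D mD
  (fun k x => (f x * bump a b k x)%:E) (EFin \o f) (fun x => `|f x|%:E)
  mfb (measurable_int _ fi) cv (integrable_norm fi)
  (aeW _ (fun x k _ => fb k x)).
under eq_fun do rewrite h.
move=> cv0; have := cvg_unique _ cv0 (cvg_cst 0%E).
by apply.
Qed.

(** The integral of [f] vanishes on all small boxes, hence by Dynkin's lemma on all
   measurable subsets of a small box, so [f] is null on each of the countably many boxes
   that make up [U]. *)
Lemma fundamental_lemma (U : set E) (f : E -> R) : open U -> L2 U f ->
  (forall phi, test_fun U phi -> \int[mu]_(x in U) (f x * phi x) = 0) ->
  eq_on U f (cst 0).
Proof.
move=> oU f2 f0; have mU := open_measurable_rV oU.
have [a [b [UE abU]]] := open_bigcup_obox oU.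
suff h k : {ae mu, forall x, obox (a k) (b k) x -> f x = 0}.
  apply: filterS (ae_foralln h) => x hx; rewrite UE => -[k _].
  exact: hx.
set D := obox (a k) (b k).
have mD : measurable D by exact: measurable_obox.
have DU : D `<=` U := subset_trans (@obox_sub_cbox _ _ _ _) (abU k).
have fi : mu.-integrable D (EFin \o f).
  by apply: L2_integrable f2 => //; exact: lebesgue_rV_obox_fin.
have fiS A : measurable A -> mu.-integrable (A `&` D) (EFin \o f).
  by move=> mA; apply: integrableS fi => //; exact: measurableI.
have D0 : (\int[mu]_(x in D) (f x)%:E = 0)%E by exact: integral_obox_eq0 f2 _ f0.
have key A : measurable A -> (\int[mu]_(x in A `&` D) (f x)%:E = 0)%E.
  rewrite measurable_boxesE.
  apply: (@dynkin_induction _ _ boxes (fun A => \int[mu]_(x in A `&` D) (f x)%:E = 0)%E).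
  - exact: measurable_boxesE.
  - exact: boxes_setI.
  - by rewrite setTI.
  - move=> _ [c [d ->]].
    rewrite setIC obox_setI.
    apply: integral_obox_eq0 f2 _ f0 => //; apply: subset_trans (abU k) => x x0 i.
    have := x0 i; rewrite !mxE ge_max le_min =>
      /andP[/andP[xa xc]] /andP[xb xd].
    by rewrite xa xb.
  - move=> {}A mA A0.
    have := @integral_setU_EFin _ _ _ mu (A `&` D) (~` A `&` D) f.
    rewrite -setIUl setUv setTI D0 A0 add0e => <- //.
    + exact: measurableI.
    + by apply: measurableI => //; exact: measurableC.
    + by apply/measurable_EFinP; exact: measurable_int fi.
    + apply/disj_setPS => x [[Ax _] [nAx _]]; exact: nAx.
  - move=> F mF tF F0; rewrite setI_bigcupl integral_bigcup.
    + by apply: eseries0 => i _ _; exact: F0.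
    + exact: trivIset_setIr.
    + by move=> i; exact: measurableI.
    + by rewrite -setI_bigcupl; apply: fiS; exact: bigcupT_measurable.
have := @integral_ae_eq _ _ _ mu D mD (cst 0%E) (EFin \o f) fi.
case=> [//|A AD mA|N [mN N0 sN]].
  rewrite integral0 -(key A mA); congr integral.
  by apply/seteqP; split=> x; [move=> Ax; split => //; exact: AD|case].
exists N; split=> // x /= nx; apply: sN => /= nx'; apply: nx => Dx.
by have /= [] := nx' Dx.
Qed.
End fundamental_lemma.

(** * Integration by parts *)

Section integral_of_partial_derivatives.
Context {R : realType}.

(** The measures [lebesgue_rV R n] come from a fixpoint, on which instance inference
   does not fire; this name carries the sigma-finiteness that Fubini's theorem needs. *)
Definition lebesgue_rV_fun n : set 'rV[R]_n -> \bar R := lebesgue_rV R n.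
HB.instance Definition _ n := Measure.copy (@lebesgue_rV_fun n) (lebesgue_rV R n).
HB.instance Definition _ n := Measure_isSigmaFinite.Build _ _ _ (@lebesgue_rV_fun n)
  (@lebesgue_rV_sigma_finite R n).

Lemma bounded_support_integrable d (T : measurableType d)
    (mu : {measure set T -> \bar R}) (D : set T) (f : T -> R) (M : R) :
  measurable D -> (mu D < +oo)%E -> measurable_fun setT f ->
  (forall x, `|f x| <= M) -> (forall x, ~ D x -> f x = 0) ->
  mu.-integrable setT (EFin \o f).
Proof.
move=> mD Dfin mf fM f0.
have -> : EFin \o f = (EFin \o f) \_ D.
  apply/funext => x; rewrite patchE /=; case: ifPn => // /negP nD.
  by rewrite f0 // => Dx; apply: nD; rewrite inE.
apply/(integrable_mkcond _ mD); apply: (bounded_integrable (M := M)) => //.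
exact: measurable_funS mf.
Qed.

Lemma integral_derivative_eq0 (f g : R -> R) (r : R) : 0 < r ->
  (forall t : R, is_derive t 1 f (g t)) -> continuous g ->
  (forall t, r < `|t| -> f t = 0) -> (forall t, r < `|t| -> g t = 0) ->
  (\int[lebesgue_measure]_t (g t)%:E = 0)%E.
Proof.
move=> r0 df cg f0 g0; have rr : - (r + 1) < r + 1 by lra.
have fc : continuous f.
  move=> t; apply: differentiable_continuous; apply/derivable1_diffP.
  by case: (df t).
have f00 t : r + 1 <= `|t| -> f t = 0.
  by move=> ?; apply: f0; lra.
have -> : (\int[lebesgue_measure]_t (g t)%:E =
    \int[lebesgue_measure]_(t in `[(- (r + 1))%R, (r + 1)%R]) (g t)%:E)%E.
  rewrite [RHS]integral_mkcond; apply: eq_integral => t _.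
  rewrite patchE /=; case: ifPn => // /negP nt.
  rewrite g0 // ltNge; apply/negP => tr; apply: nt.
  by rewrite inE /= in_itv /= -ler_norml (le_trans tr) // lerDl.
rewrite (continuous_FTC2 rr (F := f)).
- by rewrite !f00 ?sube0 // ?normrN ger0_norm //; lra.
- by apply: continuous_subspaceT => x; exact: cg.
- split=> [t _||]; first by case: (df t).
  + by apply: cvg_at_right_filter; exact: fc.
  + by apply: cvg_at_left_filter; exact: fc.
- by move=> t _; rewrite derive1E; case: (df t).
Qed.

Lemma add_delta_mx n (x : 'rV[R]_n) s j i :
  (x + s *: delta_mx 0 j) 0 i = x 0 i + s * (i == j)%:R.
Proof. by rewrite !mxE eqxx. Qed.

(** By Fubini it is enough to integrate along the line in direction [k], where the
   fundamental theorem of calculus gives 0. The induction peels off the first coordinate: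
   either it is [k] itself, and the inner integral is one-dimensional, or the other
   coordinates are integrated first. *)
Lemma integral_partial_eq0 n (f g : 'rV[R]_n -> R) (k : 'I_n) (r M : R) :
  0 < r -> measurable_fun setT g -> (forall x, `|g x| <= M) ->
  (forall (x : 'rV[R]_n) i, r < `|x 0 i| -> f x = 0) ->
  (forall (x : 'rV[R]_n) i, r < `|x 0 i| -> g x = 0) ->
  (forall x, is_derive (0 : R) 1 (fun t : R => f (x + t *: delta_mx 0 k)) (g x)) ->
  (forall x, g (x + t *: delta_mx 0 k) @[t --> (0 : R)] --> g x) ->
  (\int[lebesgue_rV R n]_x (g x)%:E = 0)%E.
Proof.
move=> r0; elim: n f g k => [f g [] //|n IHn f g k mg gM f0 g0 df cg].
pose gc := g \o @rV_cons R n.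
have mgc : measurable_fun [set: 'rV[R]_n * R] gc.
  exact: (measurableT_comp mg (@measurable_rV_cons R n)).
pose box := @rV_cons R n @^-1` obox (const_mx (- (r + 1))) (const_mx (r + 1)).
have ig : (lebesgue_rV R n \x @lebesgue_measure R)%E.-integrable setT (EFin \o gc).
  refine (@bounded_support_integrable _ _ (lebesgue_rV R n \x @lebesgue_measure R)%E
    box gc M _ _ _ _ _) => //.
  - exact: (measurable_preimage_rV_cons (measurable_obox _ _)).
  - exact: (@lebesgue_rV_obox_fin R n.+1).
  - by move=> p; exact: gM.
  - move=> p np; apply: contrapT => gp; apply: np; apply/obox_constP => i.
    rewrite ltNge; apply/negP => h; apply: gp; apply: (g0 _ i); lra.
have -> : (\int[lebesgue_rV R n.+1]_x (g x)%:E =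
    \int[lebesgue_rV R n \x @lebesgue_measure R]_p (gc p)%:E)%E.
  rewrite -(preimage_setT (@rV_cons R n)).
  have mEg : measurable_fun setT (EFin \o g) by exact/measurable_EFinP.
  have mcons : measurable_fun [set: ('rV[R]_n * measurableTypeR R)%type]
      (@rV_cons R n : ('rV[R]_n * measurableTypeR R)%type -> _).
    exact: measurable_rV_cons.
  exact: (integral_pushforward mcons mEg ig measurableT).
have cons_lift x t s j : rV_cons (x + s *: delta_mx 0 j : 'rV[R]_n, t) =
    rV_cons (x, t) + s *: delta_mx 0 (lift ord0 j) :> 'rV[R]_n.+1.
  apply/rowP => i; rewrite add_delta_mx; case: (unliftP ord0 i) => [j'|] ->.
    by rewrite !rV_consS add_delta_mx (inj_eq (@lift_inj _ _)).
  by rewrite !rV_cons0 /= mulr0 addr0.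
have cons_0 x t s : rV_cons (x : 'rV[R]_n, t + s) =
    rV_cons (x, t) + s *: delta_mx 0 ord0 :> 'rV[R]_n.+1.
  apply/rowP => i; rewrite add_delta_mx; case: (unliftP ord0 i) => [j'|] ->.
    by rewrite !rV_consS /= mulr0 addr0.
  by rewrite !rV_cons0 /= mulr1.
case: (unliftP ord0 k) => [j|] kE; subst k.
  have inner t : (\int[lebesgue_rV R n]_x (gc (x, t))%:E = 0)%E.
    apply: (IHn (fun x => f (rV_cons (x, t))) (fun x => gc (x, t)) j).
    - by apply: measurableT_comp mgc _; exact: measurable_pair2.
    - by move=> x; exact: gM.
    - by move=> x i xi; apply: (f0 _ (lift ord0 i)); rewrite rV_consS.
    - by move=> x i xi; apply: (g0 _ (lift ord0 i)); rewrite rV_consS.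
    - by move=> x; under eq_fun do rewrite cons_lift; exact: df.
    - by move=> x; rewrite /gc /=; under eq_fun do rewrite cons_lift; exact: cg.
  rewrite -(@integral21_prod_meas1 _ _ _ _ R (@lebesgue_rV_fun n) (@lebesgue_measure R)) //.
  transitivity (\int[@lebesgue_measure R]_t 0%E)%E; last exact: integral0.
  by apply: eq_integral => t _; exact: inner.
have inner x : (\int[@lebesgue_measure R]_t (gc (x, t))%:E = 0)%E.
  apply: (@integral_derivative_eq0 (fun t => f (rV_cons (x, t))) (fun t => gc (x, t)) r) => //.
  - move=> t; have := df (rV_cons (x, t)).
    under eq_fun do rewrite -cons_0 addrC -[X in X + t]mulr1.
    exact: (@is_derive_line R R).
  - move=> t; have := cg (rV_cons (x, t)).
    under eq_fun do rewrite -cons_0.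
    move=> h; rewrite /continuous_at.
    rewrite (_ : (fun u => gc (x, u)) = (fun s => gc (x, t + s)) \o (fun u => u - t)).
      have sub0 : u - t @[u --> t] --> (0 : R).
        by rewrite -[X in _ --> X](subrr t); apply: cvgB; [exact: cvg_id|exact: cvg_cst].
      exact: cvg_comp sub0 h.
    by apply/funext => u /=; rewrite addrC subrK.
  - by move=> t tr; apply: (f0 _ ord0); rewrite rV_cons0.
  - by move=> t tr; apply: (g0 _ ord0); rewrite rV_cons0.
rewrite -(@integral12_prod_meas1 _ _ _ _ R (@lebesgue_rV_fun n) (@lebesgue_measure R)) //.
transitivity (\int[lebesgue_rV R n]_t 0%E)%E; last exact: integral0.
by apply: eq_integral => t _; exact: inner.
Qed.

End integral_of_partial_derivatives.

Section smooth_functions.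
Context {R : realType} {n : nat}.
Local Notation E := 'rV[R]_n.+1.
Local Notation mu := (lebesgue_rV R n.+1).
Implicit Types (U D : set E) (f phi psi : E -> R) (k : 'I_n.+1).

Lemma smooth_partial phi k : smooth phi -> smooth (Defs.partial k phi).
Proof. by move=> sphi s x; have := sphi (rcons s k) x; rewrite foldr_rcons. Qed.

Lemma smooth_continuous phi : smooth phi -> continuous phi.
Proof. by move=> sphi x; apply: differentiable_continuous; exact: (sphi [::] x). Qed.

Lemma smooth_is_derive phi k (x : E) : smooth phi ->
  is_derive x (delta_mx 0 k : E) (phi : E -> R^o) (Defs.partial k phi x).
Proof. by move=> sphi; apply: derivableP; apply: diff_derivable; exact: (sphi [::] x). Qed.

Lemma smooth_cst (c : R) : smooth (cst c : E -> R).
Proof. by apply: flat_smooth; constructor. Qed.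

Lemma partial_cst (c : R) k : Defs.partial k (cst c : E -> R) = cst 0.
Proof. by apply/funext => x; rewrite /Defs.partial derive_cst. Qed.

Lemma support_eq0 phi x : ~ Defs.support phi x -> phi x = 0.
Proof.
move=> nx; apply/eqP; apply: contra_notT nx => phix.
exact: subset_closure.
Qed.

Lemma partial_support_eq0 phi k x : ~ Defs.support phi x -> Defs.partial k phi x = 0.
Proof.
move=> nx; rewrite /Defs.partial (@near_eq_derive _ _ _ _ (cst 0)) ?derive_cst //.
have oC : open (~` Defs.support phi) by apply: closed_openC; exact: closed_closure.
have : nbhs x (~` Defs.support phi) by apply: open_nbhs_nbhs; split.
by apply: filterS => y /support_eq0.
Qed.

Lemma le_rV_norm (x : E) i : `|x 0 i| <= `|x|.
Proof.
by rewrite [leRHS]/Num.Def.normr /= mx_normrE; apply/bigmax_geP; right => /=; exists (0, i).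
Qed.

Lemma compact_support_bounded phi : compact (Defs.support phi) ->
  exists2 r, 0 < r & forall (x : E) i, r < `|x 0 i| -> ~ Defs.support phi x.
Proof.
move=> /compact_bounded[M [_ hM]]; exists (`|M| + 1); first by rewrite ltr_wpDl.
move=> x i xr sx; have := hM (`|M| + 1) _ x sx => /=.
rewrite (le_lt_trans (ler_norm M)) ?ltrDl // => /(_ isT) xM.
by have := lt_le_trans xr (le_trans (le_rV_norm x i) xM); rewrite ltxx.
Qed.

Lemma compact_support_continuous_bounded (S : set E) f :
  compact S -> continuous f -> (forall x, ~ S x -> f x = 0) ->
  exists M, forall x, `|f x| <= M.
Proof.
move=> cS cf f0.
have : compact (f @` S) by apply: continuous_compact => //; exact: continuous_subspaceT.
move=> /compact_bounded[M [_ hM]]; exists (`|M| + 1) => x.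
have [Sx|nSx] := pselect (S x); last by rewrite f0 // normr0 addr_ge0.
have := hM (`|M| + 1) _ (f x); rewrite (le_lt_trans (ler_norm M)) ?ltrDl //.
by apply=> //; exists x.
Qed.

Lemma compact_support_integrable (S : set E) f D : compact S -> continuous f ->
  (forall x, ~ S x -> f x = 0) -> measurable D -> mu.-integrable D (EFin \o f).
Proof.
move=> cS cf f0 mD; apply: (integrableS measurableT mD) => //.
have [M fM] := compact_support_continuous_bounded cS cf f0.
have [N [_ hN]] := compact_bounded cS; pose r := `|N| + 1.
have hr x : S x -> forall i, `|x 0 i| < r + 1.
  move=> Sx i; apply: (le_lt_trans (le_rV_norm x i)).
  apply: (@le_lt_trans _ _ r); last by rewrite ltrDl.
  by apply: hN => //; rewrite (le_lt_trans (ler_norm _)) // ltrDl.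
apply: (@bounded_support_integrable _ _ _ _
    (obox (const_mx (- (r + 1))) (const_mx (r + 1))) f M) => //.
- exact: measurable_obox.
- exact: lebesgue_rV_obox_fin.
- exact: continuous_measurable_rV.
- move=> x nx; apply: f0 => Sx; apply: nx; apply/obox_constP; exact: hr.
Qed.

Lemma continuous_mulr phi psi : continuous phi -> continuous psi ->
  continuous (fun x => phi x * psi x).
Proof. by move=> cphi cpsi x; exact: (cvgM (cphi x) (cpsi x)). Qed.

(** The integrand is the partial derivative of [psi * phi], which has compact support. *)
Lemma smooth_ibp_setT phi psi k : smooth phi -> smooth psi ->
  compact (Defs.support phi) ->
  (\int[mu]_x (psi x * Defs.partial k phi x + Defs.partial k psi x * phi x)%:E = 0)%E.
Proof.
move=> sphi spsi cphi.
set g := fun x => psi x * Defs.partial k phi x + Defs.partial k psi x * phi x.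
have cg : continuous g.
  have c1 := continuous_mulr (smooth_continuous spsi)
    (smooth_continuous (smooth_partial k sphi)).
  have c2 := continuous_mulr (smooth_continuous (smooth_partial k spsi))
    (smooth_continuous sphi).
  by move=> x; exact: (cvgD (c1 x) (c2 x)).
have g0 x : ~ Defs.support phi x -> g x = 0.
  by move=> nx; rewrite /g (partial_support_eq0 k nx) (support_eq0 nx) !mulr0 addr0.
have [r r0 hr] := compact_support_bounded cphi.
have [M hM] := compact_support_continuous_bounded cphi cg g0.
apply: (@integral_partial_eq0 R n.+1 (psi * phi) g k r M) => //.
- exact: continuous_measurable_rV.
- by move=> x i /hr /support_eq0 h; rewrite /GRing.mul /= h mulr0.
- by move=> x i /hr; exact: g0.
- move=> x.
  have := is_deriveM (smooth_is_derive k x spsi) (smooth_is_derive k x sphi).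
  rewrite /g /GRing.scale /= [phi x * _]mulrC.
  move=> [dv dE].
  have E1 : (fun h : R => h^-1 *: ((psi * phi) (x + (h *: (1 : R) + 0) *: delta_mx 0 k) -
      (psi * phi) (x + 0 *: delta_mx 0 k))) =
      (fun h : R => h^-1 *: ((psi * phi) (h *: delta_mx 0 k + x) - (psi * phi) x)).
    by apply/funext => h; rewrite addr0 scale0r addr0 /GRing.scale /= mulr1 [x + _]addrC.
  by split; [rewrite /derivable E1|rewrite /derive E1].
- move=> x; rewrite -[X in _ --> g X]addr0 -[X in _ --> g (_ + X)](scale0r (delta_mx 0 k)).
  apply: continuous_cvg; first exact: cg.
  apply: cvgD; first exact: cvg_cst.
  apply: cvgZ; [exact: cvg_id|exact: cvg_cst].
Qed.

Lemma smooth_ibp U phi psi k : measurable U -> smooth psi -> test_fun U phi ->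
  \int[mu]_(x in U) (psi x * Defs.partial k phi x) =
  - \int[mu]_(x in U) (Defs.partial k psi x * phi x).
Proof.
move=> mU spsi [sphi cphi sU].
have cp := continuous_mulr (smooth_continuous spsi)
  (smooth_continuous (smooth_partial k sphi)).
have cq := continuous_mulr (smooth_continuous (smooth_partial k spsi))
  (smooth_continuous sphi).
have p0 x : ~ Defs.support phi x -> psi x * Defs.partial k phi x = 0.
  by move=> nx; rewrite (partial_support_eq0 k nx) mulr0.
have q0 x : ~ Defs.support phi x -> Defs.partial k psi x * phi x = 0.
  by move=> nx; rewrite (support_eq0 nx) mulr0.
apply/eqP; rewrite -addr_eq0 -RintegralD //.
- rewrite -(@Rintegral_support _ _ _ _ U setT) //.
    by rewrite /Rintegral (smooth_ibp_setT k sphi spsi cphi).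
  move=> x _ nU; rewrite p0 ?q0 ?addr0 //; exact: contra_not (sU x) nU.
- exact: (compact_support_integrable cphi).
- exact: (compact_support_integrable cphi).
Qed.

End smooth_functions.

(** * Equality almost everywhere, L2 functions and weak derivatives *)

Section integral_almost_everywhere.
Context d (T : measurableType d) (R : realType).
Variable mu : {measure set T -> \bar R}.
Implicit Types (D U : set T).
Import HBNNSimple.

(** The integral of a nonnegative function is the supremum of the integrals of the
   simple functions below it, and setting a simple function to zero on a null set does not
   change its integral. *)
Let ge0_ae_le_integral (f g : T -> \bar R) :
  (forall x, (0 <= f x)%E) -> (forall x, (0 <= g x)%E) ->
  {ae mu, forall x, f x = g x} -> (\int[mu]_x f x <= \int[mu]_x g x)%E.
Proof.
move=> f0 g0 [N [mN N0 sN]]; rewrite !ge0_integralTE //.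
apply: ge_ereal_sup => _ [h /= hf <-].
have mC := measurableC mN.
suff -> : sintegral mu h = sintegral mu (proj_nnsfun h mC).
  apply: ereal_sup_ubound; exists (proj_nnsfun h mC) => //= x.
  have [Nx|nNx] := pselect (N x).
    by rewrite mindicE memNset ?mulr0 //; exact.
  rewrite mindicE mem_set // mulr1; apply: (le_trans (hf x)).
  by rewrite (_ : f x = g x) //; apply: contrapT => fg; apply: nNx; exact: sN.
rewrite -integralT_nnsfun -mrestrict -(integral_nnsfun mu mC) -setTD.
apply: ge0_negligible_integral => //.
- by apply/measurable_EFinP.
- by move=> x _; rewrite lee_fin; exact: fun_ge0.
Qed.

Lemma ae_eq_Rintegral D (f g : T -> R) :
  {ae mu, forall x, D x -> f x = g x} ->
  \int[mu]_(x in D) f x = \int[mu]_(x in D) g x.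
Proof.
move=> fg; rewrite /Rintegral; congr fine.
rewrite integral_mkcond [RHS]integral_mkcond integralE [RHS]integralE.
have fgD : {ae mu, forall x, ((fun x => (f x)%:E) \_ D) x = ((fun x => (g x)%:E) \_ D) x}.
  by apply: filterS fg => x fgx; rewrite !patchE; case: ifPn => // /set_mem /fgx ->.
have gfD : {ae mu, forall x, ((fun x => (g x)%:E) \_ D) x = ((fun x => (f x)%:E) \_ D) x}.
  by apply: filterS fgD => x ->.
congr (_ - _)%E; apply/eqP; rewrite eq_le; apply/andP; split;
  apply: ge0_ae_le_integral => // .
- by apply: filterS fgD => x h; rewrite !funeposE h.
- by apply: filterS gfD => x h; rewrite !funeposE h.
- by apply: filterS fgD => x h; rewrite !funenegE h.
- by apply: filterS gfD => x h; rewrite !funenegE h.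
Qed.

End integral_almost_everywhere.

Section eq_on_theory.
Context {R : realType} {n : nat}.
Local Notation E := 'rV[R]_n.+1.
Implicit Types (U V : set E) (f g h : E -> R).

Lemma eq_on_refl U f : eq_on U f f.
Proof. exact: aeW. Qed.

Lemma eq_on_sym U f g : eq_on U f g -> eq_on U g f.
Proof. by apply: filterS => x h /h. Qed.

Lemma eq_on_trans U f g h : eq_on U f g -> eq_on U g h -> eq_on U f h.
Proof. by apply: filterS2 => x fg gh Ux; rewrite fg // gh. Qed.

Lemma eq_on_sub U V f g : V `<=` U -> eq_on U f g -> eq_on V f g.
Proof. by move=> VU; apply: filterS => x h /VU/h. Qed.

Lemma eq_on_lin U a f f' g g' : eq_on U f f' -> eq_on U g g' ->
  eq_on U (a \*o f \+ g) (a \*o f' \+ g').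
Proof. by apply: filterS2 => x hf hg Ux /=; rewrite hf // hg. Qed.

Lemma eq_on_sub0 U f g : eq_on U (f \- g) (cst 0) <-> eq_on U f g.
Proof.
split; apply: filterS => x h Ux; have := h Ux => /=.
  by move/eqP; rewrite subr_eq0 => /eqP.
by move=> ->; rewrite subrr.
Qed.

End eq_on_theory.

Section L2_theory.
Context {R : realType} {n : nat}.
Local Notation E := 'rV[R]_n.+1.
Local Notation mu := (lebesgue_rV R n.+1).
Implicit Types (U V : set E) (f g h : E -> R).

Lemma L2_mul U f g : measurable U -> L2 U f -> L2 U g ->
  mu.-integrable U (EFin \o (fun x => f x * g x)).
Proof.
move=> mU [mf if2] [mg ig2].
apply: (le_integrable mU _ _ (integrableD mU if2 ig2)).
  by apply/measurable_EFinP; exact: measurable_funM.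
move=> x Ux /=; rewrite lee_fin [leRHS]ger0_norm ?addr_ge0 ?sqr_ge0 //.
rewrite normrM -(real_normK (num_real (f x))) -(real_normK (num_real (g x))).
by nra.
Qed.

Lemma L2_lin U a f g : measurable U -> L2 U f -> L2 U g -> L2 U (a \*o f \+ g).
Proof.
move=> mU Lf Lg; have [mf if2] := Lf; have [mg ig2] := Lg; split.
  by apply: measurable_funD => //; exact: measurable_funM.
have i1 := integrableZl mU (a ^+ 2) if2.
have i2 := integrableZl mU (2 * a) (L2_mul mU Lf Lg).
apply: eq_integrable (integrableD mU (integrableD mU i1 i2) ig2) => // x _ /=.
by rewrite -!EFinM -!EFinD; congr EFin; ring.
Qed.

Lemma L2_cst0 U : measurable U -> L2 U (cst 0).
Proof.
move=> mU; split; first exact: measurable_cst.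
by under eq_fun do rewrite expr0n; exact: integrable0.
Qed.

Lemma L2_sub U V f : measurable U -> measurable V -> V `<=` U -> L2 U f -> L2 V f.
Proof.
move=> mU mV VU [mf if2]; split; first exact: measurable_funS mf.
exact: integrableS if2.
Qed.

Lemma L2_ae U f g : measurable U -> measurable_fun U g -> eq_on U f g ->
  L2 U f -> L2 U g.
Proof.
move=> mU mg fg [mf if2]; split=> //.
have mg2 : measurable_fun U (fun x => (g x ^+ 2)%:E).
  by apply/measurable_EFinP; exact: measurable_funX.
apply/integrableP; split=> //; have /integrableP[mf2] := if2.
rewrite (@ae_eq_integral _ _ _ _ U (fun x => `|(g x ^+ 2)%:E|%E)) //.
- exact: measurableT_comp.
- exact: measurableT_comp.
- by apply: filterS fg => x h /h ->.
Qed.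

Lemma L2_compact_support (S : set E) f U : compact S -> continuous f ->
  (forall x, ~ S x -> f x = 0) -> measurable U -> L2 U f.
Proof.
move=> cS cf f0 mU; split; first exact: continuous_measurable_rV.
apply: (compact_support_integrable cS) => //.
  exact: (continuous_mulr cf cf).
by move=> x /f0 ->; rewrite expr0n.
Qed.

(** Locked, like [ipGrad] below: the later algebra treats these integrals as atoms,
   whose identity is never decided by unfolding them. *)
Definition ipL2 : set E -> (E -> R) -> (E -> R) -> R :=
  locked (fun U f g => \int[mu]_(x in U) (f x * g x)).

Lemma ipL2E U f g : ipL2 U f g = \int[mu]_(x in U) (f x * g x).
Proof. by rewrite /ipL2 -lock. Qed.

Lemma ipL2C U f g : ipL2 U f g = ipL2 U g f.
Proof. by rewrite !ipL2E; apply: eq_Rintegral => x _; rewrite mulrC. Qed.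

Lemma ipL2_lin U a f g h : measurable U -> L2 U f -> L2 U g -> L2 U h ->
  ipL2 U h (a \*o f \+ g) = a * ipL2 U h f + ipL2 U h g.
Proof.
move=> mU Lf Lg Lh; rewrite !ipL2E -RintegralZl ?L2_mul // -RintegralD //.
- by apply: eq_Rintegral => x _ /=; ring.
- exact: (integrableZl mU a (L2_mul mU Lh Lf)).
- exact: L2_mul.
Qed.

Lemma ipL2_ge0 U f : 0 <= ipL2 U f f.
Proof. by rewrite ipL2E; apply: Rintegral_ge0 => x _; exact: sqr_ge0. Qed.

Lemma ipL2_ae U f f' g g' : eq_on U f f' -> eq_on U g g' ->
  ipL2 U f g = ipL2 U f' g'.
Proof.
by move=> ff gg; rewrite !ipL2E; apply: ae_eq_Rintegral; apply: filterS2 ff gg => x hf hg Ux;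
  rewrite hf // hg.
Qed.

Lemma ipL2_eq0 U f : measurable U -> L2 U f -> ipL2 U f f = 0 -> eq_on U f (cst 0).
Proof.
move=> mU Lf f0; have if2 := L2_mul mU Lf Lf.
have mf2 : measurable_fun U (fun x => (f x * f x)%:E).
  exact: measurable_int if2.
have : (\int[mu]_(x in U) `|(f x * f x)%:E| = 0)%E.
  transitivity (\int[mu]_(x in U) (f x * f x)%:E)%E.
    by apply: eq_integral => x _ /=; rewrite ger0_norm ?sqr_ge0.
  by move: f0; rewrite ipL2E /Rintegral -[X in _ -> X = _]fineK ?integrable_fin_num // => ->.
move=> /(ae_eq_integral_abs mu mU mf2); apply: filterS => x /= h /h [] /eqP.
by rewrite mulf_eq0 orbb => /eqP.
Qed.

End L2_theory.

Section weak_derivatives.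
Context {R : realType} {n : nat}.
Local Notation E := 'rV[R]_n.+1.
Implicit Types (U V : set E) (f g h d : E -> R) (k : 'I_n.+1).

Lemma test_fun_sub U V phi : V `<=` U -> test_fun V phi -> test_fun U phi.
Proof. by move=> VU [sphi cphi sV]; split => //; exact: subset_trans VU. Qed.

Lemma test_fun_L2 U V phi : measurable V -> test_fun U phi -> L2 V phi.
Proof.
move=> mV [sphi cphi _]; apply: (L2_compact_support cphi) => //.
  exact: smooth_continuous.
exact: support_eq0.
Qed.

Lemma test_fun_L2_partial U V phi k : measurable V -> test_fun U phi ->
  L2 V (Defs.partial k phi).
Proof.
move=> mV [sphi cphi _]; apply: (L2_compact_support cphi) => //.
  exact/smooth_continuous/smooth_partial.
exact: partial_support_eq0.
Qed.

(** The difference of two weak derivatives is orthogonal to all test functions. *)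
Lemma weak_partial_unique U k f d d' : open U ->
  weak_partial U k f d -> weak_partial U k f d' -> eq_on U d d'.
Proof.
move=> oU [Ld hd] [Ld' hd']; have mU := open_measurable_rV oU.
apply: (iffLR (eq_on_sub0 U d d')).
have E1 : d \- d' = (-1) \*o d' \+ d.
  by apply/funext => x /=; ring.
apply: fundamental_lemma => //; first by rewrite E1; exact: L2_lin.
move=> phi tphi; have Lphi := test_fun_L2 mU tphi.
transitivity (ipL2 U phi ((-1) \*o d' \+ d)).
  by rewrite -E1 ipL2E; apply: eq_Rintegral => x _; rewrite mulrC.
rewrite ipL2_lin // ![ipL2 U phi _]ipL2C !ipL2E.
have := hd _ tphi; rewrite (hd' _ tphi) => /oppr_inj ->; ring.
Qed.

Lemma weak_partial_lin U k a f g d e : measurable U -> L2 U f -> L2 U g ->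
  weak_partial U k f d -> weak_partial U k g e ->
  weak_partial U k (a \*o f \+ g) (a \*o d \+ e).
Proof.
move=> mU Lf Lg [Ld hd] [Le he]; split; first exact: L2_lin.
move=> phi tphi; have Lphi := test_fun_L2 mU tphi.
have Lp := test_fun_L2_partial k mU tphi.
have := @ipL2_lin _ _ U a f g (Defs.partial k phi) mU Lf Lg Lp.
have := @ipL2_lin _ _ U a d e phi mU Ld Le Lphi.
rewrite ![ipL2 U phi _]ipL2C ![ipL2 U (Defs.partial _ _) _]ipL2C !ipL2E => -> ->.
rewrite (hd _ tphi) (he _ tphi); ring.
Qed.

(** A test function of [V] is one of [U], and both integrals live on its support. *)
Lemma weak_partial_sub U V k f d : open U -> open V -> V `<=` U ->
  weak_partial U k f d -> weak_partial V k f d.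
Proof.
move=> oU oV VU [Ld hd]; have mU := open_measurable_rV oU.
have mV := open_measurable_rV oV; split; first exact: L2_sub Ld.
move=> phi tphi; have := hd _ (test_fun_sub VU tphi).
have [_ _ sV] := tphi.
rewrite !(@Rintegral_support _ _ _ _ V U) // => x Ux nV.
  by rewrite (@support_eq0 _ _ phi) ?mulr0 //; exact: contra_not (sV x) nV.
by rewrite partial_support_eq0 ?mulr0 //; exact: contra_not (sV x) nV.
Qed.

Lemma weak_partial_ae U k f f' d d' : measurable U -> eq_on U f f' ->
  measurable_fun U d' -> eq_on U d d' ->
  weak_partial U k f d -> weak_partial U k f' d'.
Proof.
move=> mU ff' md' dd' [Ld hd]; split; first exact: L2_ae Ld.
move=> phi tphi; have := hd _ tphi.
have := @ipL2_ae _ _ U f f' _ _ ff' (eq_on_refl U (Defs.partial k phi)).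
have := @ipL2_ae _ _ U d d' _ _ dd' (eq_on_refl U phi).
by rewrite !ipL2E => -> ->.
Qed.

Lemma weak_partial_smooth U k f : open U -> smooth f -> L2 U (Defs.partial k f) ->
  weak_partial U k f (Defs.partial k f).
Proof.
move=> oU sf Lf; split=> // phi tphi; apply: smooth_ibp => //.
exact: open_measurable_rV.
Qed.

Lemma wpartialP U f k : H1 U f -> weak_partial U k f (wpartial U k f).
Proof. by move=> [_ /(_ k) hd]; rewrite /wpartial; exact: xgetPex hd. Qed.

Lemma L2_wpartial U f k : H1 U f -> L2 U (wpartial U k f).
Proof. by move=> /(wpartialP k) []. Qed.

Lemma H1_lin U a f g : measurable U -> H1 U f -> H1 U g -> H1 U (a \*o f \+ g).
Proof.
move=> mU [Lf df] [Lg dg]; split; first exact: L2_lin.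
move=> k; have [d hd] := df k; have [e he] := dg k.
by exists (a \*o d \+ e); exact: weak_partial_lin.
Qed.

Lemma H1_sub U V f : open U -> open V -> V `<=` U -> H1 U f -> H1 V f.
Proof.
move=> oU oV VU [Lf df]; split.
  by apply: L2_sub Lf => //; exact: open_measurable_rV.
by move=> k; have [d hd] := df k; exists d; exact: weak_partial_sub hd.
Qed.

Lemma H1_cst0 U : open U -> H1 U (cst 0).
Proof.
move=> oU; have L0 := L2_cst0 (open_measurable_rV oU); split=> // k.
exists (cst 0); have := @weak_partial_smooth U k (cst 0) oU (smooth_cst 0).
by rewrite partial_cst; exact.
Qed.

Lemma H1_test_fun U V phi : open V -> test_fun U phi -> H1 V phi.
Proof.
move=> oV tphi; have mV := open_measurable_rV oV; split; first exact: test_fun_L2 tphi.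
move=> k; exists (Defs.partial k phi); apply: weak_partial_smooth => //.
  by case: tphi.
exact: test_fun_L2_partial tphi.
Qed.

Lemma H1_ae U f g : measurable U -> measurable_fun U g -> eq_on U f g ->
  H1 U f -> H1 U g.
Proof.
move=> mU mg fg [Lf df]; split; first exact: L2_ae Lf.
move=> k; have [d hd] := df k; exists d.
have [[md _] _] := hd.
exact: weak_partial_ae mU fg md (eq_on_refl U d) hd.
Qed.

Lemma wpartial_eq U k f d : open U -> H1 U f -> weak_partial U k f d ->
  eq_on U (wpartial U k f) d.
Proof. by move=> oU Hf; apply: weak_partial_unique => //; exact: wpartialP. Qed.

Lemma wpartial_lin U k a f g : open U -> H1 U f -> H1 U g ->
  eq_on U (wpartial U k (a \*o f \+ g)) (a \*o wpartial U k f \+ wpartial U k g).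
Proof.
move=> oU Hf Hg; have mU := open_measurable_rV oU.
apply: wpartial_eq => //; first exact: H1_lin.
apply: weak_partial_lin; rewrite //; try exact: wpartialP.
  by case: Hf.
by case: Hg.
Qed.

Lemma wpartial_sub U V k f : open U -> open V -> V `<=` U -> H1 U f ->
  eq_on V (wpartial V k f) (wpartial U k f).
Proof.
move=> oU oV VU Hf; apply: wpartial_eq => //; first exact: H1_sub Hf.
by apply: weak_partial_sub (wpartialP k Hf).
Qed.

Lemma wpartial_ae U k f g : open U -> H1 U f -> H1 U g -> eq_on U f g ->
  eq_on U (wpartial U k f) (wpartial U k g).
Proof.
move=> oU Hf Hg fg; have mU := open_measurable_rV oU.
apply: wpartial_eq => //; apply: weak_partial_ae (wpartialP k Hg) => //.
- exact: eq_on_sym.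
- by have [] := L2_wpartial k Hg.
- exact: eq_on_refl.
Qed.

(** The classical derivative 0 of the constant is a weak derivative of [f]. This is why
   no gradient term appears on the pieces with [lam i = +oo]. *)
Lemma wpartial_eq_cst U k f c : open U -> H1 U f -> eq_on U f (cst c) ->
  eq_on U (wpartial U k f) (cst 0).
Proof.
move=> oU Hf fc; have mU := open_measurable_rV oU; apply: wpartial_eq => //.
have := @weak_partial_smooth U k (cst c) oU (smooth_cst c).
rewrite partial_cst => /(_ (L2_cst0 mU)).
by apply: weak_partial_ae => //; [exact: eq_on_sym|exact: eq_on_refl].
Qed.

End weak_derivatives.

(** * Quadratic forms and Hilbert spaces *)

Lemma discriminant_le0 (R : realFieldType) (a b c : R) : 0 <= a ->
  (forall t, 0 <= a * t ^+ 2 + 2 * b * t + c) -> b ^+ 2 <= a * c.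
Proof.
rewrite le_eqVlt => /predU1P[<-|a0] h.
  rewrite mul0r; have [->|b0] := eqVneq b 0; first by rewrite expr0n.
  have := h (- (c + 1) / (2 * b)).
  have -> : 0 * (- (c + 1) / (2 * b)) ^+ 2 + 2 * b * (- (c + 1) / (2 * b)) + c = -1.
    by field.
  by rewrite lerNr oppr0 ler10.
have := h (- b / a); have -> : a * (- b / a) ^+ 2 + 2 * b * (- b / a) + c = c - b ^+ 2 / a.
  by field; rewrite gt_eqF.
by rewrite subr_ge0 ler_pdivrMr // mulrC.
Qed.

Section quadratic_forms.
Context {X : Type} {R : realType}.
Implicit Types (v w x : X -> R) (a t : R).

Definition lin_closed (V : set (X -> R)) : Prop :=
  V (cst 0) /\ forall a v w, V v -> V w -> V (a \*o v \+ w).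

Lemma sub_lin v w : v \- w = (-1) \*o w \+ v.
Proof. by apply/funext => x /=; ring. Qed.

Lemma add_lin v w : v \+ w = 1 \*o v \+ w.
Proof. by apply/funext => x /=; ring. Qed.

Lemma scale_lin a v : a \*o v = a \*o v \+ cst 0.
Proof. by apply/funext => x /=; ring. Qed.

Variables (V : set (X -> R)) (linV : lin_closed V).

Lemma lin_sub v w : V v -> V w -> V (v \- w).
Proof. by rewrite sub_lin => Vv Vw; apply linV.2. Qed.

Lemma lin_add v w : V v -> V w -> V (v \+ w).
Proof. by rewrite add_lin => Vv Vw; apply linV.2. Qed.

Lemma lin_scale a v : V v -> V (a \*o v).
Proof. by rewrite scale_lin => Vv; apply linV.2 => //; case: linV. Qed.

Section linear_functionals.
Variables (F : (X -> R) -> R) (linF : linear_on V F).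

Lemma linear_on_add v w : V v -> V w -> F (v \+ w) = F v + F w.
Proof. by move=> Vv Vw; rewrite add_lin linF // mul1r. Qed.

Lemma linear_on0 : F (cst 0) = 0.
Proof.
have V0 := linV.1; have := linear_on_add V0 V0.
rewrite (_ : cst 0 \+ cst 0 = cst 0); last by apply/funext => x /=; rewrite addr0.
by move=> h; apply: (@addrI _ (F (cst 0))); rewrite addr0 -h.
Qed.

Lemma linear_on_sub v w : V v -> V w -> F (v \- w) = F v - F w.
Proof. by move=> Vv Vw; rewrite sub_lin linF // mulN1r addrC. Qed.

Lemma linear_on_scale a v : V v -> F (a \*o v) = a * F v.
Proof. by move=> Vv; rewrite scale_lin linF ?linear_on0 ?addr0 //; case: linV. Qed.

End linear_functionals.

Variables (B : (X -> R) -> (X -> R) -> R).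
Hypothesis bilB : bilinear_on V B.
Hypothesis symB : forall v w, V v -> V w -> B v w = B w v.
Hypothesis psdB : forall v, V v -> 0 <= B v v.

Lemma form_sub_sq v w : V v -> V w ->
  B (v \- w) (v \- w) = B v v - 2 * B v w + B w w.
Proof.
move=> Vv Vw; have Vs := lin_sub Vv Vw.
rewrite (linear_on_sub (bilB.1 _ Vs)) // (linear_on_sub (bilB.2 _ Vv)) //.
rewrite (linear_on_sub (bilB.2 _ Vw)) // (symB Vw Vv); ring.
Qed.

Lemma form_lin_sq t v w : V v -> V w ->
  B (t \*o v \+ w) (t \*o v \+ w) = B v v * t ^+ 2 + 2 * B v w * t + B w w.
Proof.
move=> Vv Vw; have Vs : V (t \*o v \+ w) by apply linV.2.
rewrite (bilB.1 _ Vs) // (bilB.2 _ Vv) // (bilB.2 _ Vw) // (symB Vw Vv); ring.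
Qed.

(** The quadratic polynomial t |-> B(t v + w, t v + w) is nonnegative. *)
Lemma form_sqr_le v w : V v -> V w -> B v w ^+ 2 <= B v v * B w w.
Proof.
move=> Vv Vw; apply: discriminant_le0 => [|t]; first exact: psdB.
rewrite -form_lin_sq //.
by apply: psdB; apply linV.2.
Qed.

Definition fnorm v : R := Num.sqrt (B v v).

Lemma fnorm_ge0 v : 0 <= fnorm v. Proof. exact: sqrtr_ge0. Qed.

Lemma sqr_fnorm v : V v -> fnorm v ^+ 2 = B v v.
Proof. by move=> Vv; rewrite sqr_sqrtr ?psdB. Qed.

Lemma cauchy_schwarz v w : V v -> V w -> `|B v w| <= fnorm v * fnorm w.
Proof.
move=> Vv Vw; rewrite -(@ler_pXn2r _ 2) ?nnegrE ?mulr_ge0 ?fnorm_ge0 //.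
by rewrite real_normK ?num_real // exprMn !sqr_fnorm // form_sqr_le.
Qed.

Lemma fnorm_le v (e : R) : V v -> 0 <= e -> (fnorm v <= e) = (B v v <= e ^+ 2).
Proof. by move=> Vv e0; rewrite -sqr_fnorm // ler_pXn2r ?nnegrE ?fnorm_ge0. Qed.

Lemma fnorm_add v w : V v -> V w -> fnorm (v \+ w) <= fnorm v + fnorm w.
Proof.
move=> Vv Vw; rewrite fnorm_le ?addr_ge0 ?fnorm_ge0 //; last exact: lin_add.
rewrite add_lin form_lin_sq // -!sqr_fnorm //.
have := cauchy_schwarz Vv Vw; have := ler_norm (B v w); nra.
Qed.

Lemma fnorm_scale a v : V v -> fnorm (a \*o v) = `|a| * fnorm v.
Proof.
move=> Vv; have Va := lin_scale a Vv; rewrite /fnorm.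
rewrite (linear_on_scale (bilB.1 _ Va)) // (linear_on_scale (bilB.2 _ Vv)) //.
by rewrite mulrA -expr2 sqrtrM ?sqr_ge0 // sqrtr_sqr.
Qed.

Lemma fnorm0 : fnorm (cst 0) = 0.
Proof. by rewrite /fnorm (linear_on0 (bilB.1 _ linV.1)) sqrtr0. Qed.

Lemma fnorm_subC v w : V v -> V w -> fnorm (v \- w) = fnorm (w \- v).
Proof.
move=> Vv Vw; rewrite (_ : v \- w = (-1) \*o (w \- v)).
  by rewrite fnorm_scale ?normrN1 ?mul1r //; exact: lin_sub.
by apply/funext => x /=; ring.
Qed.

Lemma fnorm_dist v w x : V v -> V w -> V x ->
  fnorm (v \- x) <= fnorm (v \- w) + fnorm (w \- x).
Proof.
move=> Vv Vw Vx; rewrite (_ : v \- x = (v \- w) \+ (w \- x)).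
  by apply: fnorm_add; exact: lin_sub.
by apply/funext => y /=; ring.
Qed.

End quadratic_forms.

Lemma cauchy_real_cvg (R : realType) (u : nat -> R) :
  (forall e, 0 < e -> exists N, forall m n, (N <= m)%N -> (N <= n)%N ->
    `|u m - u n| <= e) -> cvgn u.
Proof.
move=> h; apply: cauchy_cvg; apply: cauchy_exP => e e0.
have e20 : 0 < e / 2 by rewrite divr_gt0.
have [N hN] := h _ e20; exists (u N); exists N => // n /= Nn.
rewrite /ball /=; apply: le_lt_trans (hN N n _ Nn) _ => //.
by rewrite ltr_pdivrMr // ltr_pMr // ltr1n.
Qed.

Lemma squeeze_cvg0 (R : realType) (u b : nat -> R) :
  (forall n, `|u n| <= b n) -> b n @[n --> \oo] --> 0 -> u n @[n --> \oo] --> 0.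
Proof.
move=> ub cb; apply: norm_cvg0.
have c0 : (0 : R) @[_ --> \oo] --> (0 : R) by exact: cvg_cst.
apply: (squeeze_cvgr _ c0 cb).
by apply: nearW => n; rewrite normr_ge0 ub.
Qed.

Section hilbert.
Context {X : Type} {R : realType}.
Variables (V : set (X -> R)) (B : (X -> R) -> (X -> R) -> R).
Hypothesis linV : lin_closed V.
Hypothesis bilB : bilinear_on V B.
Hypothesis symB : forall v w, V v -> V w -> B v w = B w v.
Hypothesis psdB : forall v, V v -> 0 <= B v v.

Definition complete_form (W : set (X -> R)) (A : (X -> R) -> (X -> R) -> R) : Prop :=
  forall v_ : nat -> X -> R, (forall n, W (v_ n)) ->
  (forall e, 0 < e -> exists N, forall m n, (N <= m)%N -> (N <= n)%N ->
    fnorm A (v_ m \- v_ n) <= e) ->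
  exists2 v, W v & fnorm A (v_ n \- v) @[n --> \oo] --> (0 : R).

Lemma bounded_functional_cvg (F : (X -> R) -> R) C v_ v : linear_on V F ->
  (forall w, V w -> `|F w| <= C * fnorm B w) -> (forall n, V (v_ n)) -> V v ->
  fnorm B (v_ n \- v) @[n --> \oo] --> (0 : R) -> F (v_ n) @[n --> \oo] --> F v.
Proof.
move=> linF Fb Vn Vv cv; apply/subr_cvg0.
apply: (@squeeze_cvg0 _ _ (fun n => C * fnorm B (v_ n \- v))).
  by move=> n; rewrite -(linear_on_sub linF) //; apply: Fb; exact: lin_sub.
by rewrite -(mulr0 C); apply: cvgM cv; exact: cvg_cst.
Qed.

(** A minimizing sequence of B(v, v) - 2 G(v) is Cauchy by the parallelogram identity;
   the first-order condition at its limit [z] is B(z, v) = G(v). As [B] may be degenerate,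
   the limit need not be unique, and the condition is obtained from a discriminant by passing
   to the limit in the inequality that expresses minimality. *)
Lemma riesz_representation (G : (X -> R) -> R) : complete_form V B ->
  linear_on V G -> (exists C, forall v, V v -> `|G v| <= C * fnorm B v) ->
  exists2 z, V z & forall v, V v -> B z v = G v.
Proof.
move=> compl linG [C hC].
pose Q v := B v v - 2 * G v.
have Qlb v : V v -> - C ^+ 2 <= Q v.
  move=> Vv; rewrite /Q -(sqr_fnorm psdB Vv); have := hC _ Vv; have := ler_norm (G v).
  by have := sqr_ge0 (fnorm B v - C); nra.
pose S := [set Q v | v in V].
have hS : has_inf S.
  split; first by exists (Q (cst 0)), (cst 0) => //; case: linV.
  by exists (- C ^+ 2) => _ [v Vv <-]; exact: Qlb.
pose I := inf S.
have IQ v : V v -> I <= Q v by move=> Vv; apply: (ge_inf hS.2); exists v.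
have hn (n : nat) : exists v, V v /\ Q v < I + n.+1%:R^-1.
  have i0 : (0 : R) < n.+1%:R^-1 by rewrite invr_gt0.
  by have [_ [v Vv <-] h] := inf_adherent i0 hS; exists v.
pose v_ n := projT1 (cid (hn n)).
have Vn n : V (v_ n) by rewrite /v_; case: cid => v [].
have Qn n : Q (v_ n) < I + n.+1%:R^-1 by rewrite /v_; case: cid => v [].
have Qlin t v w : V v -> V w -> Q (t \*o v \+ w) =
    B v v * t ^+ 2 + 2 * B v w * t + B w w - 2 * (t * G v + G w).
  by move=> Vv Vw; rewrite /Q (form_lin_sq linV bilB symB) // linG.
have [z Vz cz] : exists2 z, V z & fnorm B (v_ n \- z) @[n --> \oo] --> (0 : R).
  (* 1 / (n + 1) <= e ^ 2 / 4 for n >= N, which the parallelogram identity turns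
     into a distance of at most e. *)
  apply: compl => // e e0; pose N := Num.Def.truncn (4 / e ^+ 2); exists N => m n Nm Nn.
  have inv_le k : (N <= k)%N -> k.+1%:R^-1 <= e ^+ 2 / 4.
    move=> Nk; rewrite -[leRHS]invf_div lef_pV2 ?posrE ?divr_gt0 ?exprn_gt0 //.
    apply: ltW; apply: lt_le_trans (truncnS_gt _) _.
    by rewrite ler_nat ltnS.
  rewrite (fnorm_le psdB _ (ltW e0)); last exact: lin_sub.
  rewrite (form_sub_sq linV bilB symB) //; have Vmn := lin_add linV (Vn m) (Vn n).
  have := IQ _ (lin_scale linV 2^-1 Vmn).
  rewrite scale_lin Qlin //; last by case: linV.
  rewrite !(linear_on0 linV linG) !(linear_on0 linV (bilB.1 _ _)) //; last by case: linV.
  have := @form_lin_sq _ _ _ linV _ bilB symB 1 _ _ (Vn m) (Vn n).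
  rewrite -add_lin => ->; rewrite (linear_on_add linG) //.
  have := Qn m; have := Qn n; have := inv_le _ Nm; have := inv_le _ Nn.
  rewrite /Q; move: (B _ _) (B _ _) (B _ _) (G _) (G _) => b1 b2 b3 g1 g2.
  move: (n.+1%:R^-1) (m.+1%:R^-1) (e ^+ 2) => a1 a2 e2 h1 h2 h3 h4.
  have -> : (b2 * 1 ^+ 2 + 2 * b1 * 1 + b3) * 2^-1 ^+ 2 + 2 * 0 / 2 + 0 -
    2 * (2^-1 * (g1 + g2) + 0) = (b2 + 2 * b1 + b3) / 4 - g1 - g2 by field.
  lra.
exists z => // w Vw.
apply/eqP; rewrite -subr_eq0 -sqrf_eq0; apply/eqP/le_anti; rewrite sqr_ge0 andbT.
have := @discriminant_le0 _ (B w w) (B z w - G w) 0; rewrite mulr0; apply.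
  exact: psdB.
move=> t; rewrite addr0.
have cB : B (v_ n) w @[n --> \oo] --> B z w.
  apply: (@bounded_functional_cvg (B ^~ w) (fnorm B w)) => //; first exact: bilB.2.
  by move=> x Vx; rewrite mulrC; exact: (cauchy_schwarz linV bilB symB psdB).
pose u n := B w w * t ^+ 2 + 2 * (B (v_ n) w - G w) * t + n.+1%:R^-1.
have cu : u n @[n --> \oo] --> B w w * t ^+ 2 + 2 * (B z w - G w) * t + 0.
  apply: cvgD; last exact: cvg_harmonic.
  apply: cvgD; first exact: cvg_cst.
  apply: cvgM; last exact: cvg_cst.
  apply: cvgM; first exact: cvg_cst.
  by apply: cvgB => //; exact: cvg_cst.
rewrite -[leRHS]addr0; apply: (ler_cvg_to (@cvg_cst _ (0 : R) _ _ _) cu).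
apply: nearW => n; rewrite /u.
have := Qn n; have := IQ _ (linV.2 t _ _ Vw (Vn n)).
rewrite Qlin // /Q (symB Vw (Vn n)).
move: (B _ _) (B _ _) (B _ _) (G _) (G _) (n.+1%:R^-1) => b1 b2 b3 g1 g2 i h1 h2.
lra.
Qed.

(** For a Cauchy sequence v_n the functionals e(v_n, .) converge to a bounded
   functional, represented by some [v] by hypothesis. With w = v_n - v, e(w, w) is the
   limit in m of e(v_n - v_m, w), hence small compared with the norm of w, and coercivity
   of [e] makes w small. *)
Lemma complete_of_representable (e : (X -> R) -> (X -> R) -> R) (al C : R) :
  0 < al -> bilinear_on V e ->
  (forall v, V v -> al * fnorm B v ^+ 2 <= e v v) ->
  (forall v w, V v -> V w -> `|e v w| <= C * fnorm B v * fnorm B w) ->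
  (forall G, in_dual V (fnorm B) G ->
    exists2 v, V v & forall w, V w -> e v w = G w) ->
  complete_form V B.
Proof.
move=> al0 bile coer bnd repr v_ Vn cauchy.
pose D := `|C| + 1; have D0 : 0 < D by rewrite ltr_wpDl.
have bndD v w : V v -> V w -> `|e v w| <= D * fnorm B v * fnorm B w.
  move=> Vv Vw; apply: le_trans (bnd _ _ Vv Vw) _.
  rewrite ler_wpM2r ?fnorm_ge0 // ler_wpM2r ?fnorm_ge0 //.
  by rewrite (le_trans (ler_norm C)) // lerDl.
have cw w : V w -> cvgn (fun n => e (v_ n) w).
  move=> Vw; apply: cauchy_real_cvg => eps eps0.
  pose d := eps / (D * fnorm B w + 1).
  have q0 : 0 < D * fnorm B w + 1 by rewrite ltr_wpDl // mulr_ge0 ?fnorm_ge0 // ltW.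
  have [N hN] := cauchy d (divr_gt0 eps0 q0); exists N => m n Nm Nn.
  rewrite -(linear_on_sub (bile.2 _ Vw)) //.
  apply: le_trans (bndD _ _ (lin_sub linV (Vn m) (Vn n)) Vw) _.
  rewrite mulrAC; apply: (@le_trans _ _ (D * fnorm B w * d)).
    by rewrite ler_wpM2l ?hN // mulr_ge0 ?fnorm_ge0 // ltW.
  rewrite /d mulrCA; apply: ler_piMr; first exact: ltW.
  by rewrite ler_pdivrMr // mul1r lerDl.
pose G w := limn (fun n => e (v_ n) w).
have cG w : V w -> e (v_ n) w @[n --> \oo] --> G w by exact: cw.
have [N1 hN1] := cauchy 1 ltr01; pose K := fnorm B (v_ N1) + 1.
have vK n : (N1 <= n)%N -> fnorm B (v_ n) <= K.
  move=> Nn; rewrite (_ : v_ n = (v_ n \- v_ N1) \+ v_ N1).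
    apply: le_trans (fnorm_add linV bilB symB psdB (lin_sub linV _ _) _) _ => //.
    by rewrite addrC lerD2l hN1.
  by apply/funext => x /=; rewrite subrK.
have [v Vv hv] : exists2 v, V v & forall w, V w -> e v w = G w.
  apply: repr; split.
    move=> a w x Vw Vx; have Vl := linV.2 a _ _ Vw Vx.
    have : e (v_ n) (a \*o w \+ x) @[n --> \oo] --> a * G w + G x.
      under eq_fun do rewrite (bile.1 _ (Vn _)) //.
      by apply: cvgD; [apply: cvgM; [exact: cvg_cst|exact: cG]|exact: cG].
    by move=> c; exact: (cvg_unique _ (cG _ Vl) c).
  exists (D * K) => w Vw.
  have cn : `|e (v_ n) w| @[n --> \oo] --> `|G w| by apply: cvg_norm; exact: cG.
  apply: (ler_cvg_to cn (@cvg_cst _ (D * K * fnorm B w) _ _ _)).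
  exists N1 => // n /= Nn; apply: le_trans (bndD _ _ (Vn n) Vw) _.
  by rewrite ler_wpM2r ?fnorm_ge0 // ler_wpM2l ?vK // ltW.
exists v => //; apply/cvgr0Pnorm_le => eps eps0.
pose d := al * eps / D; have d0 : 0 < d by rewrite divr_gt0 // mulr_gt0.
have [N hN] := cauchy d d0; exists N => // n /= Nn.
rewrite ger0_norm ?fnorm_ge0 //; set w := v_ n \- v.
have Vw : V w by exact: lin_sub.
have key : e w w <= D * d * fnorm B w.
  rewrite {1}/w (linear_on_sub (bile.2 _ Vw)) // hv //.
  have cn : e (v_ n) w - e (v_ m) w @[m --> \oo] --> e (v_ n) w - G w.
    by apply: cvgB; [exact: cvg_cst|exact: cG].
  apply: (ler_cvg_to cn (@cvg_cst _ (D * d * fnorm B w) _ _ _)).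
  exists N => // m /= Nm; rewrite -(linear_on_sub (bile.2 _ Vw)) //.
  apply: le_trans (ler_norm _) _.
  apply: le_trans (bndD _ _ (lin_sub linV (Vn n) (Vn m)) Vw) _.
  by rewrite ler_wpM2r ?fnorm_ge0 // ler_wpM2l ?hN // ltW.
have := le_trans (coer _ Vw) key.
have -> : D * d = al * eps by rewrite /d; field; rewrite gt_eqF.
have [->|w0] := eqVneq (fnorm B w) 0; first by move=> _; exact: ltW.
have wp : 0 < fnorm B w by rewrite lt_def w0 fnorm_ge0.
by rewrite expr2 mulrA ler_pM2r // ler_pM2l //.
Qed.

End hilbert.

(** * Forms over the pieces of a partition *)

Lemma ae_forall d (T : measurableType d) (R : realType)
    (mu : {measure set T -> \bar R}) (I : finType) (P : I -> T -> Prop) :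
  (forall i, {ae mu, forall x, P i x}) -> {ae mu, forall x i, P i x}.
Proof. by move=> h; apply: filter_forall. Qed.

Section gradient_form.
Context {R : realType} {n : nat}.
Local Notation E := 'rV[R]_n.+1.
Local Notation mu := (lebesgue_rV R n.+1).
Implicit Types (U V : set E) (f g h : E -> R) (k : 'I_n.+1).

Lemma Rintegral_sum d (T : measurableType d) (nu : {measure set T -> \bar R})
    (D : set T) (I : Type) (s : seq I) (P : pred I) (F : I -> T -> R) :
  measurable D -> (forall i, P i -> nu.-integrable D (EFin \o F i)) ->
  \int[nu]_(x in D) (\sum_(i <- s | P i) F i x) =
  \sum_(i <- s | P i) \int[nu]_(x in D) F i x.
Proof.
move=> mD iF; elim: s => [|i s ih].
  rewrite big_nil; transitivity (\int[nu]_(x in D) (0 : R)).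
    by apply: eq_Rintegral => x _; rewrite big_nil.
  by rewrite Rintegral_cst // mul0r.
have is_ : nu.-integrable D (EFin \o (fun x => \sum_(j <- s | P j) F j x)).
  have := @integrable_sum _ _ _ nu D mD _ s P (fun i => EFin \o F i) iF.
  by apply: eq_integrable => // x _; rewrite /= sumEFin.
rewrite big_cons; case: ifPn => Pi; last first.
  by rewrite -ih; apply: eq_Rintegral => x _; rewrite big_cons (negbTE Pi).
rewrite -ih -RintegralD //; last exact: iF.
by apply: eq_Rintegral => x _; rewrite big_cons Pi.
Qed.

Definition ipGrad : set E -> (E -> R) -> (E -> R) -> R :=
  locked (fun U f g => \int[mu]_(x in U) grad_dot U f g x).

Lemma ipGradE U f g : ipGrad U f g = \int[mu]_(x in U) grad_dot U f g x.
Proof. by rewrite /ipGrad -lock. Qed.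

Lemma integrable_grad_dot U f g : open U -> H1 U f -> H1 U g ->
  mu.-integrable U (EFin \o grad_dot U f g).
Proof.
move=> oU Hf Hg; have mU := open_measurable_rV oU.
have := @integrable_sum _ _ _ mu U mU _ (index_enum 'I_n.+1) xpredT
  (fun k => EFin \o (fun x => wpartial U k f x * wpartial U k g x))
  (fun k _ => L2_mul mU (L2_wpartial k Hf) (L2_wpartial k Hg)).
by apply: eq_integrable => // x _; rewrite /= sumEFin.
Qed.

Lemma ipGrad_sum U f g : open U -> H1 U f -> H1 U g ->
  ipGrad U f g = \sum_k ipL2 U (wpartial U k f) (wpartial U k g).
Proof.
move=> oU Hf Hg; have mU := open_measurable_rV oU; rewrite ipGradE.
under [RHS]eq_bigr do rewrite ipL2E.
rewrite -Rintegral_sum // => k _; apply: L2_mul => //; exact: L2_wpartial.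
Qed.

Lemma ipL2_ae0 U f g : measurable U -> eq_on U f (cst 0) -> ipL2 U f g = 0.
Proof.
move=> mU f0; rewrite (ipL2_ae f0 (eq_on_refl U g)) ipL2E.
under eq_Rintegral do rewrite mul0r.
by rewrite Rintegral_cst // mul0r.
Qed.

Lemma ipGradC U f g : ipGrad U f g = ipGrad U g f.
Proof.
by rewrite !ipGradE; apply: eq_Rintegral => x _; apply: eq_bigr => k _; rewrite mulrC.
Qed.

Lemma ipGrad_lin U a f g h : open U -> H1 U f -> H1 U g -> H1 U h ->
  ipGrad U h (a \*o f \+ g) = a * ipGrad U h f + ipGrad U h g.
Proof.
move=> oU Hf Hg Hh; have mU := open_measurable_rV oU.
have Hl : H1 U (a \*o f \+ g) by exact: H1_lin.
rewrite (ipGrad_sum oU Hh Hl) (ipGrad_sum oU Hh Hf) (ipGrad_sum oU Hh Hg).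
rewrite mulr_sumr -big_split /=; apply: eq_bigr => k _.
rewrite -ipL2_lin ?mU //; try exact: L2_wpartial.
by apply: ipL2_ae; [exact: eq_on_refl|exact: wpartial_lin].
Qed.

Lemma ipGrad_ge0 U f : 0 <= ipGrad U f f.
Proof. by rewrite ipGradE; apply: Rintegral_ge0 => x _; apply: sumr_ge0 => k _; exact: sqr_ge0. Qed.

Lemma ipGrad_ae U f f' g g' : open U -> H1 U f -> H1 U f' -> H1 U g -> H1 U g' ->
  eq_on U f f' -> eq_on U g g' -> ipGrad U f g = ipGrad U f' g'.
Proof.
move=> oU Hf Hf' Hg Hg' ff gg; rewrite (ipGrad_sum oU Hf Hg) (ipGrad_sum oU Hf' Hg').
apply: eq_bigr => k _.
by apply: ipL2_ae; exact: wpartial_ae.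
Qed.

Lemma ipGrad_cst0 U f c : open U -> H1 U f -> eq_on U f (cst c) -> ipGrad U f f = 0.
Proof.
move=> oU Hf fc; rewrite (ipGrad_sum oU Hf Hf) big1 // => k _.
have f0 := wpartial_eq_cst k oU Hf fc; rewrite (ipL2_ae f0 f0) ipL2E.
transitivity (\int[mu]_(x in U) (0 : R)).
  by apply: eq_Rintegral => x _ /=; rewrite mulr0.
by rewrite Rintegral_cst ?mul0r //; exact: open_measurable_rV.
Qed.

Lemma grad_dot_sub U V f g : open U -> open V -> V `<=` U -> H1 U f -> H1 U g ->
  eq_on V (grad_dot U f g) (grad_dot V f g).
Proof.
move=> oU oV VU Hf Hg.
have h k : {ae mu, forall x, V x -> wpartial U k f x * wpartial U k g x =
    wpartial V k f x * wpartial V k g x}.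
  apply: filterS2 (wpartial_sub k oU oV VU Hf) (wpartial_sub k oU oV VU Hg).
  by move=> x hf hg Vx; rewrite hf // hg.
have := ae_forall h.
by apply: filterS => x hx Vx; apply: eq_bigr => k _; exact: hx.
Qed.

End gradient_form.

Section pieces.
Context {R : realType} {n N : nat}.
Local Notation E := 'rV[R]_n.+1.
Local Notation mu := (lebesgue_rV R n.+1).
Variables (Om : set E) (Omi : 'I_N -> set E).
Implicit Types (a b : 'I_N -> R) (v w : E -> R) (S : {set 'I_N}) (U : set E).

(** The consequences of a partition into Lipschitz sets on which the argument
   rests. *)
Definition open_partition : Prop :=
  [/\ open Om, forall i, open (Omi i), forall i, Omi i `<=` Om,
      forall i j x, Omi i x -> Omi j x -> i = j &
      {ae mu, forall x, Om x -> exists i, Omi i x}].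

Hypothesis part : open_partition.

Let oOmi i : open (Omi i). Proof. by case: part. Qed.
Let mOmi i : measurable (Omi i). Proof. exact: open_measurable_rV. Qed.

Definition pieces_cover U S : Prop :=
  (forall i, i \in S -> Omi i `<=` U) /\
  {ae mu, forall x, U x -> exists2 i, i \in S & Omi i x}.

Lemma Rintegral_pieces U S (f : E -> R) (F : 'I_N -> E -> R) : pieces_cover U S ->
  (forall i, i \in S -> eq_on (Omi i) f (F i)) ->
  (forall i, i \in S -> mu.-integrable (Omi i) (EFin \o F i)) ->
  \int[mu]_(x in U) f x = \sum_(i in S) \int[mu]_(x in Omi i) F i x.
Proof.
move=> [SU cU] fF iF.
have iF' i : i \in S -> mu.-integrable setT (EFin \o (F i \_ (Omi i))).
  by move=> iS; rewrite -restrict_EFin; apply/(integrable_mkcond _ (mOmi i)); exact: iF.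
transitivity (\int[mu]_x \sum_(i in S) (F i \_ (Omi i)) x); last first.
  rewrite Rintegral_sum //; apply: eq_bigr => i iS.
  by rewrite [RHS]Rintegral_mkcond.
rewrite Rintegral_mkcond; apply: ae_eq_Rintegral.
have fFall : {ae mu, forall x i, i \in S -> Omi i x -> f x = F i x}.
  suff : {ae mu, forall x (i : 'I_N), i \in S -> Omi i x -> f x = F i x} by [].
  apply: ae_forall => i; have [iS|iS] := boolP (i \in S).
    by apply: filterS (fF i iS) => x h _.
  by apply: aeW => x.
apply: filterS2 cU fFall => x cx fx _; rewrite patchE; case: ifPn => [/set_mem Ux|/negP nU].
  have [i iS xi] := cx Ux; rewrite (bigD1 i) //= big1 ?addr0.
    by rewrite patchE mem_set // (fx i iS xi).
  move=> j /andP[jS ji]; rewrite patchE memNset // => xj.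
  by case: part => _ _ _ dis _; rewrite (dis _ _ _ xj xi) eqxx in ji.
rewrite [RHS]big1 // => i iS; rewrite patchE memNset // => xi.
by apply: nU; rewrite inE; exact: (SU i).
Qed.

Definition pieceH1 : set (E -> R) := [set v | forall i, H1 (Omi i) v].

(** The forms used here are all weighted sums over the pieces: the inner product of
   HH, the bilinear form that defines g(lambda), and its derivative in lambda. *)
Definition wform a b v w : R :=
  \sum_i (a i * ipGrad (Omi i) v w + b i * ipL2 (Omi i) v w).

Lemma pieceH1_lin : lin_closed pieceH1.
Proof.
split=> [i|t v w Hv Hw i]; first exact: H1_cst0.
exact: H1_lin.
Qed.

Lemma wformC a b v w : wform a b v w = wform a b w v.
Proof. by apply: eq_bigr => i _; rewrite ipGradC ipL2C. Qed.

Lemma wform_bilinear a b : bilinear_on pieceH1 (wform a b).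
Proof.
have lin v : pieceH1 v -> linear_on pieceH1 (wform a b v).
  move=> Hv t w x Hw Hx; rewrite /wform mulr_sumr -big_split /=.
  apply: eq_bigr => i _; rewrite ipGrad_lin // ipL2_lin //.
  - move: (ipGrad _ v w) (ipGrad _ v x) (ipL2 _ v w) (ipL2 _ v x) => p q r s.
    ring.
  - by case: (Hw i).
  - by case: (Hx i).
  - by case: (Hv i).
split=> // w Hw t v x Hv Hx.
by rewrite ![wform a b _ w]wformC lin.
Qed.

Lemma wform_ge0 a b v : (forall i, 0 <= a i) -> (forall i, 0 <= b i) ->
  0 <= wform a b v v.
Proof.
by move=> a0 b0; apply: sumr_ge0 => i _; rewrite addr_ge0 // mulr_ge0 ?ipGrad_ge0 ?ipL2_ge0.
Qed.

Lemma wform_ae a b v v' w w' : pieceH1 v -> pieceH1 v' -> pieceH1 w -> pieceH1 w' ->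
  (forall i, eq_on (Omi i) v v') -> (forall i, eq_on (Omi i) w w') ->
  wform a b v w = wform a b v' w'.
Proof.
move=> Hv Hv' Hw Hw' vv ww; apply: eq_bigr => i _.
rewrite (ipGrad_ae (@oOmi i) (Hv i) (Hv' i) (Hw i) (Hw' i) (vv i) (ww i)).
by rewrite (ipL2_ae (vv i) (ww i)).
Qed.

Lemma eq_on_pieces v w : eq_on Om v w <-> forall i, eq_on (Omi i) v w.
Proof.
have [_ _ sub _ cov] := part; split=> [vw i|vw]; first exact: eq_on_sub (sub i) vw.
have h := ae_forall vw.
by apply: filterS2 cov h => x cx hx /cx[i xi]; exact: hx xi.
Qed.

(** The inner product of HH as well as of each V(lambda), on their elements. *)
Definition ipP : (E -> R) -> (E -> R) -> R := wform (fun=> 1) (fun=> 1).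

Lemma ipP_ge0 v : 0 <= ipP v v.
Proof. by apply: wform_ge0. Qed.

Lemma ipP_le v w :
  (forall i, ipGrad (Omi i) v v + ipL2 (Omi i) v v <=
             ipGrad (Omi i) w w + ipL2 (Omi i) w w) -> ipP v v <= ipP w w.
Proof. by move=> h; apply: ler_sum => i _; rewrite !mul1r h. Qed.

Lemma ipP_eq0 v : pieceH1 v -> ipP v v = 0 -> eq_on Om v (cst 0).
Proof.
move=> Hv v0; apply/eq_on_pieces => i; apply: ipL2_eq0 => //; first by case: (Hv i).
have : 1 * ipGrad (Omi i) v v + 1 * ipL2 (Omi i) v v = 0.
  apply: (psumr_eq0P _ v0) => // j _.
  by rewrite !mul1r addr_ge0 ?ipGrad_ge0 ?ipL2_ge0.
have := ipGrad_ge0 (Omi i) v; have := ipL2_ge0 (Omi i) v.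
by move: (ipGrad _ _ _) (ipL2 _ _ _) => p q; lra.
Qed.

(** Weak derivatives on [U] restrict to weak derivatives on the pieces, and the pieces
   cover [U] up to a null set. *)
Lemma ipH1_pieces U S v w : open U -> pieces_cover U S -> H1 U v -> H1 U w ->
  ipH1 U v w = \sum_(i in S) (ipGrad (Omi i) v w + ipL2 (Omi i) v w).
Proof.
move=> oU cU Hv Hw; have mU := open_measurable_rV oU.
have Hvi i : i \in S -> H1 (Omi i) v by move=> iS; apply: H1_sub Hv => //; exact: cU.1.
have Hwi i : i \in S -> H1 (Omi i) w by move=> iS; apply: H1_sub Hw => //; exact: cU.1.
have iG i : i \in S -> mu.-integrable (Omi i) (EFin \o grad_dot (Omi i) v w).
  by move=> iS; apply: integrable_grad_dot; auto.
have iL i : i \in S -> mu.-integrable (Omi i) (EFin \o (fun x => v x * w x)).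
  by move=> iS; apply: L2_mul => //; [have [] := Hvi i iS|have [] := Hwi i iS].
rewrite /ipH1 (Rintegral_pieces (F := fun i x => grad_dot (Omi i) v w x + v x * w x) cU).
- by apply: eq_bigr => i iS; rewrite RintegralD ?iG ?iL // ipGradE ipL2E.
- move=> i iS; have cl := cU.1 i iS; apply: filterS (grad_dot_sub oU (@oOmi i) cl Hv Hw).
  by move=> x h xi; rewrite h.
- by move=> i iS; exact: (integrableD (mOmi i) (iG i iS) (iL i iS)).
Qed.

End pieces.

(** * Vanishing on the boundary *)

Section boundary_values.
Context {R : realType} {n N : nat}.
Local Notation E := 'rV[R]_n.+1.
Variables (Om : set E) (Omi : 'I_N -> set E).
Hypothesis part : open_partition Om Omi.
Local Notation P := (pieceH1 Omi).
Local Notation nP := (fnorm (ipP Omi)).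

Lemma pieceH1_linear : lin_closed P. Proof. exact: pieceH1_lin part. Qed.
Lemma ipP_bilinear : bilinear_on P (ipP Omi). Proof. exact: wform_bilinear part _ _. Qed.
Lemma ipP_sym v w : P v -> P w -> ipP Omi v w = ipP Omi w v.
Proof. by move=> _ _; exact: wformC. Qed.
Lemma ipP_psd v : P v -> 0 <= ipP Omi v v. Proof. by move=> _; exact: ipP_ge0. Qed.

Lemma vanishes_near_boundary_lin a (v w : E -> R) :
  vanishes_near_boundary Om v -> vanishes_near_boundary Om w ->
  vanishes_near_boundary Om (a \*o v \+ w).
Proof.
move=> [r r0 v0] [s s0 w0]; exists (Num.min r s); first by rewrite lt_min r0.
apply: filterS2 v0 w0 => x hv hw [Ox [y By]]; rewrite lt_min => /andP[yr ys] /=.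
by rewrite hv ?hw ?mulr0 ?addr0 //; split => //; exists y.
Qed.

(* [W] and [nrm] stand for the pairs [pieceH], [normH] and [pieceV], [normV]. *)
Variables (W : set (E -> R)) (nrm : (E -> R) -> R).
Hypothesis linW : lin_closed W.
Hypothesis WP : W `<=` P.
Hypothesis nrmE : forall v, W v -> nrm v = nP v.
Local Notation zob := (zero_on_boundary Om W nrm).

Lemma zero_on_boundary_vanishes v : W v -> vanishes_near_boundary Om v -> zob v.
Proof.
move=> Wv v0 eps eps0; exists v => //.
rewrite nrmE; last exact: lin_sub.
rewrite (_ : v \- v = cst 0); first by rewrite (fnorm0 pieceH1_linear ipP_bilinear).
by apply/funext => x /=; rewrite subrr.
Qed.

Lemma zero_on_boundary_lin a v w : W v -> W w -> zob v -> zob w -> zob (a \*o v \+ w).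
Proof.
move=> Wv Ww v0 w0 eps eps0.
have q0 : 0 < `|a| + 1 by rewrite ltr_wpDl.
have e20 : 0 < eps / 2 by rewrite divr_gt0.
have [v' [Wv' bv'] hv] := v0 (eps / 2 / (`|a| + 1)) (divr_gt0 e20 q0).
have [w' [Ww' bw'] hw] := w0 (eps / 2) e20.
exists (a \*o v' \+ w').
  by split; [exact: linW.2|exact: vanishes_near_boundary_lin].
have Wvv : W (v \- v') by exact: lin_sub.
have Www : W (w \- w') by exact: lin_sub.
have Wav : W (a \*o (v \- v')) by exact: lin_scale.
rewrite (_ : (_ \- _) = (a \*o (v \- v')) \+ (w \- w')); last first.
  by apply/funext => x /=; ring.
rewrite nrmE; last exact: lin_add.
apply: le_lt_trans (fnorm_add pieceH1_linear ipP_bilinear ipP_sym ipP_psd (WP Wav) (WP Www)) _.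
rewrite (fnorm_scale pieceH1_linear ipP_bilinear _ (WP Wvv)) -!nrmE // [ltRHS]splitr.
apply: ler_ltD => //; apply: (@le_trans _ _ ((`|a| + 1) * nrm (v \- v'))).
  by rewrite ler_wpM2r ?lerDl // nrmE // fnorm_ge0.
by rewrite mulrC -ler_pdivlMr // ltW.
Qed.

Lemma zero_on_boundary_lim v : W v ->
  (forall eps, 0 < eps -> exists2 w, W w /\ zob w & nP (w \- v) < eps) -> zob v.
Proof.
move=> Wv h eps eps0; have e20 : 0 < eps / 2 by rewrite divr_gt0.
have [w [Ww zw] hw] := h _ e20; have [x [Wx bx] hx] := zw _ e20.
exists x => //; rewrite nrmE; last exact: lin_sub.
apply: le_lt_trans (fnorm_dist pieceH1_linear ipP_bilinear ipP_sym ipP_psd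
  (WP Wv) (WP Ww) (WP Wx)) _.
rewrite (fnorm_subC pieceH1_linear ipP_bilinear (WP Wv) (WP Ww)) [ltRHS]splitr ltrD //.
by rewrite -nrmE //; exact: lin_sub.
Qed.

End boundary_values.

Section compact_support.
Context {R : realType} {n : nat}.
Local Notation E := 'rV[R]_n.+1.

Lemma compact_sub_open_thickening (K U : set E) : compact K -> open U -> K `<=` U ->
  exists2 r, 0 < r & forall x y, K x -> `|x - y| < r -> U y.
Proof.
move=> /compact_near_coveringP cK oU KU.
have h : \forall r \near (0 : R)^'+, forall x, K x -> ball x r `<=` U.
  apply: cK => x Kx; have /nbhs_ballP[e /= e0 xeU] := open_nbhs_nbhs (conj oU (KU _ Kx)).
  have e20 : 0 < e / 2 by rewrite divr_gt0.
  exists (ball x (e / 2), [set r | r < e / 2]) => /=.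
    by split; [exact: nbhsx_ballx|exact: nbhs_right_lt].
  move=> [z r] /= [xz re] y zy; apply: xeU.
  rewrite [e]splitr; apply: ball_triangle xz _; apply: le_ball zy; exact: ltW.
have /filter_ex[r [r0 hr]] : \forall r \near (0 : R)^'+, 0 < r /\ forall x, K x -> ball x r `<=` U.
  by apply: filterS2 h (nbhs_right_gt (0 : R)) => r h1 h2; split.
exists r => // x y Kx xy; apply: (hr x Kx).
by rewrite -ball_normE.
Qed.

(** The compact support has a positive distance to the complement of [Om], hence to
   its boundary. *)
Lemma vanishes_near_boundary_test_fun (Om U : set E) phi : open Om -> U `<=` Om ->
  test_fun U phi -> vanishes_near_boundary Om phi.
Proof.
move=> oOm UOm [_ cphi sU].
have [r r0 hr] := compact_sub_open_thickening cphi oOm (subset_trans sU UOm).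
exists r => //; apply: aeW => x [_ [y [_ nOy] xy]].
apply: support_eq0 => sx; apply: nOy; rewrite ((interior_id _).1 oOm).
exact: hr sx xy.
Qed.

End compact_support.

(** * The spaces attached to the partition *)

Section spaces.
Context {R : realType} {n N : nat}.
Local Notation E := 'rV[R]_n.+1.
Local Notation mu := (lebesgue_rV R n.+1).
Variables (Om : set E) (Omi : 'I_N -> set E).
Implicit Types (lam : 'I_N -> \bar R) (v w : E -> R) (S : {set 'I_N}).

Lemma lipschitz_open_partition : lipschitz_domain Om -> lipschitz_partition Om Omi ->
  open_partition Om Omi.
Proof.
move=> [[oOm _] _ _] [lip tri neg]; split=> //.
- by move=> i; have [[]] := lip i.
- by move=> i; have [] := lip i.
- move=> i j x xi xj; apply: (tri i j I I); by exists x.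
- apply: negligibleS neg => x /= /not_implyP[Ox nx]; split=> // -[i _ xi].
  by apply: nx; exists i.
Qed.

Hypothesis part : open_partition Om Omi.
Let oOm : open Om. Proof. by case: part. Qed.
Let oOmi i : open (Omi i). Proof. by case: part. Qed.
Let subOm i : Omi i `<=` Om. Proof. by case: part. Qed.
Let dis i j x : Omi i x -> Omi j x -> i = j. Proof. by case: part => _ _ _ h _; exact: h. Qed.
Let cov : {ae mu, forall x, Om x -> exists i, Omi i x}. Proof. by case: part. Qed.

Local Notation P := (pieceH1 Omi).
Local Notation nP := (fnorm (ipP Omi)).

Lemma open_bigcup_pieces S : open (\bigcup_(i in [set i | i \in S]) Omi i).
Proof. by apply: bigcup_open => i _; exact: oOmi. Qed.

Lemma open_Om0 lam : open (Om0 Omi lam).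
Proof. exact: open_bigcup_pieces. Qed.

Lemma open_Om1 lam : open (Om1 Om Omi lam).
Proof. exact: open_interior. Qed.

Lemma pieces_cover_Om0 lam : pieces_cover Omi (Om0 Omi lam) (I0 lam).
Proof.
split=> [i iI x xi|]; first by exists i.
by apply: aeW => x [i iI xi]; exists i.
Qed.

Lemma Om0P lam i x : Omi i x -> Om0 Omi lam x <-> i \in I0 lam.
Proof.
move=> xi; split=> [[j jI xj]|iI]; last by exists i.
by rewrite (dis xi xj).
Qed.

Lemma pieces_cover_OmD lam : pieces_cover Omi (Om `\` Om0 Omi lam) (~: I0 lam).
Proof.
split=> [i iI x xi|].
  rewrite finset.in_setC in iI; split; first exact: subOm xi.
  by move/(Om0P lam xi); exact/negP.
apply: filterS cov => x cx [/cx[i xi] nx]; exists i => //.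
by rewrite finset.in_setC; apply/negP => /(Om0P lam xi).
Qed.

Lemma pieces_cover_Om1 lam : pieces_cover Omi (Om1 Om Omi lam) (~: I0 lam).
Proof.
have [c1 c2] := pieces_cover_OmD lam; split=> [i iI|].
  by rewrite -[X in X `<=` _]((interior_id _).1 (@oOmi i)); apply: interiorS; exact: c1.
by apply: filterS c2 => x cx xO; apply: cx; exact: interior_subset xO.
Qed.

Section closed_union.
Variable J : {set 'I_N}.
Local Notation O := (cl_union Omi J).

Lemma closed_cl_union : closed O.
Proof.
by apply: closed_bigcup => [|i _]; [exact: finite_finset|exact: closed_closure].
Qed.

Lemma open_OmDO : open (Om `\` O).
Proof. by apply: openI => //; apply: closed_openC; exact: closed_cl_union. Qed.

(** A piece that meets the complement of [O] is disjoint from it: an open set that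
   meets a closure meets the set itself, and distinct pieces are disjoint. *)
Lemma pieces_cover_OmDO : pieces_cover Omi (Om `\` O) (~: I0H1 Omi O).
Proof.
split=> [i iI x xi|].
  split; first exact: subOm xi.
  move=> [j /= jJ xj]; have := iI; rewrite finset.in_setC inE => /asboolPn; apply.
  have [y [yj yi]] := xj _ (open_nbhs_nbhs (conj (@oOmi i) xi)).
  rewrite (dis yi yj) => z zj; exists j => //; exact: subset_closure zj.
apply: filterS cov => x cx [/cx[i xi] nx]; exists i => //.
by rewrite finset.in_setC inE; apply/asboolPn => iO; exact: nx (iO _ xi).
Qed.

Lemma pieceH_H1 v : pieceH Om Omi O v -> P v.
Proof.
move=> [H1v Hiv] i; have [iO|iO] := boolP (i \in I0H1 Omi O); first exact: Hiv.
apply: H1_sub H1v => //; first exact: open_OmDO.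
by apply pieces_cover_OmDO.1; rewrite finset.in_setC.
Qed.

Lemma ipH_ipP v w : pieceH Om Omi O v -> pieceH Om Omi O w ->
  ipH Om Omi O v w = ipP Omi v w.
Proof.
move=> Hv Hw; have [Hv1 Hvi] := Hv; have [Hw1 Hwi] := Hw.
rewrite /ipH (ipH1_pieces part open_OmDO pieces_cover_OmDO) // addrC.
rewrite /ipP /wform [RHS](bigID (fun i => i \in I0H1 Omi O)) /=; congr (_ + _).
- apply: eq_bigr => i iO; rewrite !mul1r.
  have c1 : pieces_cover Omi (Omi i) [set i].
    split=> [j|]; first by rewrite inE => /eqP ->.
    by apply: aeW => x xi; exists i => //; rewrite inE.
  by rewrite (ipH1_pieces part (@oOmi i) c1) ?big_set1 //; [exact: Hvi|exact: Hwi].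
- by apply: eq_big => [i|i _]; rewrite ?inE // !mul1r.
Qed.

Lemma normH_nP v : pieceH Om Omi O v -> normH Om Omi O v = nP v.
Proof. by move=> Hv; rewrite /normH ipH_ipP. Qed.

Lemma pieceH_lin : lin_closed (pieceH Om Omi O).
Proof.
have oD := open_OmDO; have mD := open_measurable_rV oD; split.
  by split=> [|i _]; exact: H1_cst0.
move=> a v w [v1 vi] [w1 wi]; split=> [|i iO]; first exact: H1_lin.
by apply: H1_lin; [exact: open_measurable_rV|exact: vi|exact: wi].
Qed.

Lemma spaceH_H1 v : spaceH Om Omi O v -> P v.
Proof. by move=> [/pieceH_H1]. Qed.

Lemma spaceH_lin : lin_closed (spaceH Om Omi O).
Proof.
have [p0 plin] := pieceH_lin; split.
  split=> //; apply: (zero_on_boundary_vanishes part pieceH_lin) => //.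
    exact: normH_nP.
  by exists 1 => //; exact: aeW.
move=> a v w [pv zv] [pw zw]; split; first exact: plin.
apply: (zero_on_boundary_lin part pieceH_lin) => //.
- exact: pieceH_H1.
- exact: normH_nP.
Qed.

Lemma H10_spaceH u : H10 Om u -> spaceH Om Omi O u.
Proof.
have sub1 : Om `\` O `<=` Om by move=> x [].
have pOm v : H1 Om v -> pieceH Om Omi O v.
  move=> Hv; split=> [|i _]; apply: H1_sub Hv => //.
  exact: open_OmDO.
move=> [Hu au]; split=> [|eps eps0]; first exact: pOm.
have [phi tphi hphi] := au eps eps0; exists phi.
  split; first by apply: pOm; exact: H1_test_fun tphi.
  exact: vanishes_near_boundary_test_fun tphi.
have Hphi : H1 Om phi by exact: H1_test_fun tphi.
have Hd : H1 Om (u \- phi).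
  by rewrite sub_lin; apply: H1_lin => //; exact: open_measurable_rV.
rewrite normH_nP; last exact: pOm.
have c1 : pieces_cover Omi Om [set: 'I_N]%SET.
  split=> [i _|]; first exact: subOm.
  by apply: filterS cov => x cx /cx[i xi]; exists i => //; rewrite finset.in_setT.
apply: le_lt_trans hphi; rewrite (ipH1_pieces part oOm c1 Hd Hd).
rewrite /fnorm /ipP /wform ler_wsqrtr // le_eqVlt; apply/orP; left; apply/eqP.
by apply: eq_big => [i|i _]; rewrite ?finset.in_setT // !mul1r.
Qed.

End closed_union.

Section lambda_spaces.
Variable lam : 'I_N -> \bar R.
Local Notation pV := (pieceV Om Omi lam).
Local Notation sV := (spaceV Om Omi lam).

Lemma pieceV_H1 v : pV v -> P v.
Proof.
move=> [v1 v0] i; have [iI|iI] := boolP (i \in I0 lam).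
  by apply: H1_sub v0 => //; [exact: open_Om0|exact: (pieces_cover_Om0 lam).1].
apply: H1_sub v1 => //; first exact: open_Om1.
by apply (pieces_cover_Om1 lam).1; rewrite finset.in_setC.
Qed.

Lemma normV_nP v : pV v -> normV Om Omi lam v = nP v.
Proof.
move=> Hv; have [v1 v0] := Hv; rewrite /normV /fnorm; congr Num.sqrt.
rewrite (ipH1_pieces part (@open_Om1 lam) (pieces_cover_Om1 lam)) //.
rewrite (ipH1_pieces part (@open_Om0 lam) (pieces_cover_Om0 lam)) // addrC.
rewrite /ipP /wform [RHS](bigID (fun i => i \in I0 lam)) /=; congr (_ + _).
  by apply: eq_bigr => i _; rewrite !mul1r.
by apply: eq_big => [i|i _]; rewrite ?finset.in_setC // !mul1r.
Qed.

Lemma pieceV_lin : lin_closed pV.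
Proof.
have m1 := open_measurable_rV (@open_Om1 lam).
have m0 := open_measurable_rV (@open_Om0 lam); split.
  by split; apply: H1_cst0; [exact: open_Om1|exact: open_Om0].
by move=> a v w [v1 v0] [w1 w0]; split; exact: H1_lin.
Qed.

Lemma spaceV_lin : lin_closed sV.
Proof.
have [p0 plin] := pieceV_lin; split.
  split=> // [|i iI]; last by exists 0; exact: eq_on_refl.
  apply: (zero_on_boundary_vanishes part pieceV_lin) => //.
    exact: normV_nP.
  by exists 1 => //; exact: aeW.
move=> a v w [pv zv cv] [pw zw cw]; split; first exact: plin.
  apply: (zero_on_boundary_lin part pieceV_lin) => //.
  - exact: pieceV_H1.
  - exact: normV_nP.
move=> i iI; have [c hc] := cv i iI; have [c' hc'] := cw i iI.
exists (a * c + c'); exact: (eq_on_lin a hc hc').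
Qed.

(** By the inclusion of the index sets Om0 lies in [O], so that Omega minus [O] is an open
   subset of Om1. *)
Lemma pieceV_pieceH J v : I0 lam \subset I0H1 Omi (cl_union Omi J) -> pV v ->
  pieceH Om Omi (cl_union Omi J) v.
Proof.
move=> sI Hv; split=> [|i _]; last exact: pieceV_H1.
apply: H1_sub (Hv.1); [exact: open_Om1|exact: open_OmDO|].
rewrite -[X in X `<=` _]((interior_id _).1 (@open_OmDO J)); apply: interiorS.
move=> x [Ox nx]; split=> // -[i /= iI xi]; apply: nx.
by have := fintype.subsetP sI _ iI; rewrite inE => /asboolP; exact.
Qed.

Lemma spaceV_spaceH J v : I0 lam \subset I0H1 Omi (cl_union Omi J) -> sV v ->
  spaceH Om Omi (cl_union Omi J) v.
Proof.
move=> sI [pv zv _]; split; first exact: pieceV_pieceH.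
move=> eps eps0; have [w [pw bw] hw] := zv eps eps0; exists w.
  by split=> //; exact: pieceV_pieceH.
have pd : pV (v \- w) by apply: (lin_sub pieceV_lin).
by rewrite normH_nP; [rewrite -normV_nP|exact: pieceV_pieceH].
Qed.

(** The index condition is there because elements of V(lambda) are constant on the
   pieces with [lam i = +oo]. *)
Lemma test_fun_spaceV i phi : i \notin Ioo lam -> test_fun (Omi i) phi -> sV phi.
Proof.
move=> iI tphi; have pphi : pV phi.
  by split; apply: H1_test_fun tphi; [exact: open_Om1|exact: open_Om0].
split=> // [|j jI].
  apply: (zero_on_boundary_vanishes part pieceV_lin) => //; first exact: normV_nP.
  exact: vanishes_near_boundary_test_fun tphi.
exists 0; apply: aeW => x xj; apply: support_eq0 => sx.
have [_ _ sU] := tphi; have := dis (sU _ sx) xj => ij.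
by rewrite ij jI in iI.
Qed.

End lambda_spaces.

End spaces.

(** * Limits of piecewise H1 functions *)

Lemma cvg_eq_lim (R : realType) (u w : nat -> R) (a b : R) : u =1 w ->
  u m @[m --> \oo] --> a -> w m @[m --> \oo] --> b -> a = b.
Proof. by move=> /funext -> ca cb; exact: (cvg_unique _ ca cb). Qed.

Section gluing.
Context {R : realType} {n N : nat}.
Local Notation E := 'rV[R]_n.+1.
Local Notation mu := (lebesgue_rV R n.+1).
Variables (Om : set E) (Omi : 'I_N -> set E).
Implicit Types (v w : E -> R) (S : {set 'I_N}) (U : set E).

Hypothesis part : open_partition Om Omi.
Let oOmi i : open (Omi i). Proof. by case: part. Qed.
Let mOmi i : measurable (Omi i). Proof. exact: open_measurable_rV. Qed.
Let dis i j x : Omi i x -> Omi j x -> i = j. Proof. by case: part => _ _ _ h _; exact: h. Qed.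

Local Notation P := (pieceH1 Omi).
Local Notation nP := (fnorm (ipP Omi)).

Definition glue S (d : 'I_N -> E -> R) : E -> R :=
  fun x => \sum_(i in S) (d i \_ (Omi i)) x.

Lemma glueE S d i x : i \in S -> Omi i x -> glue S d x = d i x.
Proof.
move=> iS xi; rewrite /glue (bigD1 i) //= big1 ?addr0.
  by rewrite patchE mem_set.
move=> j /andP[jS ji]; rewrite patchE memNset // => xj.
by rewrite (dis xj xi) eqxx in ji.
Qed.

Lemma glue_out S d x : (forall i, i \in S -> ~ Omi i x) -> glue S d x = 0.
Proof. by move=> h; rewrite /glue big1 // => i iS; rewrite patchE memNset //; exact: h. Qed.

Lemma glue_off S d i x : i \notin S -> Omi i x -> glue S d x = 0.
Proof. by move=> iS xi; apply: glue_out => j jS xj; rewrite (dis xi xj) jS in iS. Qed.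

Lemma L2_glue S d : (forall i, i \in S -> L2 (Omi i) (d i)) -> L2 setT (glue S d).
Proof.
move=> Ld; split.
  have -> : glue S d = fun x => \sum_(i < N) (if i \in S then d i \_ (Omi i) else cst 0) x.
    by apply/funext => x; rewrite /glue big_mkcond; apply: eq_bigr => i _; case: ifP.
  apply: measurable_sum => i; case: ifPn => [iS|_]; last exact: measurable_cst.
  have [md _] := Ld i iS; exact: ((measurable_restrictT (d i) (mOmi i)).1 md).
have iF i : i \in S -> mu.-integrable setT (EFin \o ((fun x => d i x ^+ 2) \_ (Omi i))).
  move=> iS; rewrite -restrict_EFin; apply/(integrable_mkcond _ (mOmi i)).
  by case: (Ld i iS).
have := @integrable_sum _ _ _ mu setT measurableT _ (index_enum 'I_N)
  (fun i => i \in S) (fun i => EFin \o ((fun x => d i x ^+ 2) \_ (Omi i))) iF.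
apply: eq_integrable => // x _; rewrite /= sumEFin; congr EFin.
have [[i iS xi]|nx] := pselect (exists2 i, i \in S & Omi i x).
  rewrite (glueE d iS xi) (bigD1 i) //= big1 ?addr0 ?patchE ?mem_set //.
  move=> j /andP[jS ji]; rewrite patchE memNset // => xj.
  by rewrite (dis xj xi) eqxx in ji.
rewrite glue_out ?expr0n /=; last by move=> i iS xi; apply: nx; exists i.
by rewrite big1 // => i iS; rewrite patchE memNset // => xi; apply: nx; exists i.
Qed.

Lemma eq_on_glue U S v : pieces_cover Omi U S -> eq_on U v (glue S (fun=> v)).
Proof. by move=> [_ c]; apply: filterS c => x cx /cx[i iS xi]; rewrite (glueE _ iS xi). Qed.

Lemma pieceH1_glue S v : P v -> P (glue S (fun=> v)).
Proof.
move=> Hv i; have [mg _] : L2 setT (glue S (fun=> v)).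
  by apply: L2_glue => j _; case: (Hv j).
have mgi : measurable_fun (Omi i) (glue S (fun=> v)) by exact: measurable_funTS.
have [iS|iS] := boolP (i \in S).
  apply: (H1_ae (mOmi i) mgi _ (Hv i)).
  by apply: aeW => x xi; rewrite (glueE _ iS xi).
apply: (H1_ae (mOmi i) mgi _ (H1_cst0 (@oOmi i))).
by apply: aeW => x xi; rewrite (glue_off _ iS xi).
Qed.

Lemma ipL2_le_nP v i : P v -> Num.sqrt (ipL2 (Omi i) v v) <= nP v.
Proof.
move=> Hv; rewrite ler_wsqrtr // /ipP /wform (bigD1 i) //= !mul1r.
rewrite addrAC addrC lerDl; apply: addr_ge0; first exact: ipGrad_ge0.
by apply: sumr_ge0 => j _; rewrite !mul1r addr_ge0 ?ipGrad_ge0 ?ipL2_ge0.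
Qed.

Lemma wpartial_le_nP v i k : P v ->
  Num.sqrt (ipL2 (Omi i) (wpartial (Omi i) k v) (wpartial (Omi i) k v)) <= nP v.
Proof.
move=> Hv; rewrite ler_wsqrtr // /ipP /wform (bigD1 i) //= !mul1r -addrA.
rewrite (ipGrad_sum (@oOmi i) (Hv i) (Hv i)) (bigD1 k) //= -addrA lerDl.
rewrite addr_ge0 //; first by apply: sumr_ge0 => j _; exact: ipL2_ge0.
rewrite addr_ge0 ?ipL2_ge0 //.
by apply: sumr_ge0 => j _; rewrite !mul1r addr_ge0 ?ipGrad_ge0 ?ipL2_ge0.
Qed.

Lemma ipL2_cauchy_schwarz U v w : measurable U -> L2 U v -> L2 U w ->
  `|ipL2 U v w| <= Num.sqrt (ipL2 U v v) * Num.sqrt (ipL2 U w w).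
Proof.
move=> mU; apply: (@cauchy_schwarz _ _ (L2 U) _ (ipL2 U)).
- by split=> [|a f g]; [exact: L2_cst0|exact: L2_lin].
- split=> [f Lf a g h Lg Lh|g Lg a f h Lf Lh]; first exact: ipL2_lin.
  by rewrite ![ipL2 U _ g]ipL2C ipL2_lin.
- by move=> f g _ _; exact: ipL2C.
- by move=> f _; exact: ipL2_ge0.
Qed.

Lemma ipL2_linear i (f : E -> R) : L2 (Omi i) f -> linear_on P (fun w => ipL2 (Omi i) w f).
Proof.
move=> Lf a v w Hv Hw; rewrite ipL2C [ipL2 _ v f]ipL2C [ipL2 _ w f]ipL2C ipL2_lin //.
- by case: (Hv i).
- by case: (Hw i).
Qed.

Lemma ipL2_cvg i (f : E -> R) (v_ : nat -> E -> R) v :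
  L2 (Omi i) f -> (forall m, P (v_ m)) -> P v ->
  nP (v_ m \- v) @[m --> \oo] --> (0 : R) ->
  ipL2 (Omi i) (v_ m) f @[m --> \oo] --> ipL2 (Omi i) v f.
Proof.
move=> Lf; apply: (@bounded_functional_cvg _ _ P (ipP Omi) (pieceH1_linear part)
  (fun w => ipL2 (Omi i) w f) (Num.sqrt (ipL2 (Omi i) f f)) _ _ (ipL2_linear Lf)).
move=> w Hw; rewrite mulrC.
apply: le_trans (ipL2_cauchy_schwarz (mOmi i) (Hw i).1 Lf) _.
by rewrite ler_wpM2r ?sqrtr_ge0 // ipL2_le_nP.
Qed.

Lemma wpartial_cvg i k (f : E -> R) (v_ : nat -> E -> R) v :
  L2 (Omi i) f -> (forall m, P (v_ m)) -> P v ->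
  nP (v_ m \- v) @[m --> \oo] --> (0 : R) ->
  ipL2 (Omi i) (wpartial (Omi i) k (v_ m)) f @[m --> \oo] -->
  ipL2 (Omi i) (wpartial (Omi i) k v) f.
Proof.
move=> Lf; apply: (@bounded_functional_cvg _ _ P (ipP Omi) (pieceH1_linear part)
  (fun w => ipL2 (Omi i) (wpartial (Omi i) k w) f) (Num.sqrt (ipL2 (Omi i) f f))).
  move=> a u w Hu Hw.
  rewrite (ipL2_ae (wpartial_lin k a (@oOmi i) (Hu i) (Hw i)) (eq_on_refl _ f)).
  rewrite ipL2C ipL2_lin //; try exact: L2_wpartial.
  by rewrite [ipL2 _ f _]ipL2C [ipL2 _ f (wpartial _ _ w)]ipL2C.
move=> w Hw; rewrite mulrC.
apply: le_trans (ipL2_cauchy_schwarz (mOmi i) (L2_wpartial k (Hw i)) Lf) _.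
by rewrite ler_wpM2r ?sqrtr_ge0 // wpartial_le_nP.
Qed.

(** The limit exists piecewise; the point is that no jump appears across the
   interfaces inside [U]. The sum over the pieces of int v d_k phi + int (d_k v) phi is
   0 for each v_m, by integration by parts in all of [U], and it is continuous in the
   piecewise norm; so it is 0 for [v], which says that the glued piecewise derivative is
   a weak derivative on [U]. *)
Lemma H1_limit U S (v_ : nat -> E -> R) v : open U -> pieces_cover Omi U S ->
  (forall m, P (v_ m)) -> P v -> (forall m, H1 U (v_ m)) ->
  nP (v_ m \- v) @[m --> \oo] --> (0 : R) -> H1 U (glue S (fun=> v)).
Proof.
move=> oU cU HPm HP Hm cv; have mU := open_measurable_rV oU.
split; first by apply: (L2_sub measurableT mU) => //; apply: L2_glue => i _; case: (HP i).
move=> k; pose d := glue S (fun i => wpartial (Omi i) k v); exists d; split.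
  by apply: (L2_sub measurableT mU) => //; apply: L2_glue => i _; exact: L2_wpartial.
move=> phi tphi; have Lphi i : L2 (Omi i) phi by exact: test_fun_L2 tphi.
have Ldphi i : L2 (Omi i) (Defs.partial k phi) by exact: test_fun_L2_partial tphi.
pose T w := \sum_(i in S) (ipL2 (Omi i) w (Defs.partial k phi) +
  ipL2 (Omi i) (wpartial (Omi i) k w) phi).
have ibp w : P w -> T w = \int[mu]_(x in U) (glue S (fun=> w) x * Defs.partial k phi x) +
    \int[mu]_(x in U) (glue S (fun i => wpartial (Omi i) k w) x * phi x).
  move=> Hw; rewrite /T big_split /=; congr (_ + _).
    under eq_bigr do rewrite ipL2E; apply/esym.
    apply: (Rintegral_pieces part cU) => i iS; last by apply: L2_mul => //; case: (Hw i).
    by apply: aeW => x xi; rewrite (glueE _ iS xi).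
  under eq_bigr do rewrite ipL2E; apply/esym.
  apply: (Rintegral_pieces part cU) => i iS; last by apply: L2_mul => //; exact: L2_wpartial.
  by apply: aeW => x xi; rewrite (glueE _ iS xi).
have Tm m : T (v_ m) = 0.
  have wp := wpartialP k (Hm m); rewrite ibp //.
  have e1 : eq_on U (glue S (fun=> v_ m)) (v_ m) by apply: eq_on_sym; exact: eq_on_glue.
  have e2 : eq_on U (glue S (fun i => wpartial (Omi i) k (v_ m))) (wpartial U k (v_ m)).
    have h i : {ae mu, forall x, i \in S -> Omi i x ->
        wpartial (Omi i) k (v_ m) x = wpartial U k (v_ m) x}.
      have [iS|] := boolP (i \in S); last by move=> _; exact: aeW.
      apply: filterS (wpartial_sub k oU (@oOmi i) (cU.1 i iS) (Hm m)) => x hx _; exact: hx.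
    apply: filterS2 cU.2 (ae_forall h) => x cx hx /cx[i iS xi].
    by rewrite (glueE _ iS xi) hx.
  have := ipL2_ae e1 (eq_on_refl U (Defs.partial k phi)).
  have := ipL2_ae e2 (eq_on_refl U phi); rewrite !ipL2E => -> ->.
  by rewrite (wp.2 _ tphi) addNr.
have cT : T (v_ m) @[m --> \oo] --> T v.
  apply: cvg_big => [|i iS]; first exact: add_continuous.
  by apply: cvgD; [exact: ipL2_cvg|exact: wpartial_cvg].
have T0 : T v = 0 by exact: (cvg_eq_lim Tm cT (@cvg_cst _ (0 : R) _ _ _)).
by apply/eqP; rewrite -addr_eq0 -ibp // T0.
Qed.

(** If the measure of the piece is infinite, the constants in L2 are 0. Otherwise, the
   identity (v, f) (1, 1) = (v, 1) (1, f) holds for constants, hence for their limit, and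
   f = v - C with C the mean of v gives |v - C| = 0. *)
Lemma eq_on_cst_limit i (v_ : nat -> E -> R) v : (forall m, P (v_ m)) -> P v ->
  (forall m, exists c, eq_on (Omi i) (v_ m) (cst c)) ->
  nP (v_ m \- v) @[m --> \oo] --> (0 : R) -> exists c, eq_on (Omi i) v (cst c).
Proof.
move=> Hm Hv cst_m cv; have Lv := (Hv i).1; have mU := mOmi i.
set U := Omi i in Lv mU cst_m *.
have [finU|] := boolP (mu U < +oo)%E; last first.
  rewrite -leNgt leye_eq => /eqP infU.
  exists 0; apply: ipL2_eq0 => //.
  have c0 := ipL2_cvg Lv Hm Hv cv.
  apply: (cvg_eq_lim _ c0 (@cvg_cst _ (0 : R) _ _ _)) => m /=.
  have [c hc] := cst_m m.
  have cc : c = 0.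
    have [_ i2] := L2_ae mU (measurable_cst c) hc (Hm m i).1.
    apply/eqP; apply: contraTT i2 => cn0; apply/negP => /integrableP[_].
    rewrite (eq_integral (cst (`|c ^+ 2|%:E))) // integral_cst //= infU.
    by rewrite gt0_muley ?ltxx // lte_fin normr_gt0 sqrf_eq0.
  rewrite (ipL2_ae hc (eq_on_refl U v)) cc ipL2E.
  under eq_Rintegral do rewrite mul0r.
  by rewrite Rintegral_cst // mul0r.
have L1 : L2 U (cst 1).
  split; first exact: measurable_cst.
  apply: (@bounded_integrable _ _ _ mu U (fun x => cst 1 x ^+ 2) 1) => //.
    exact: measurable_funX.
  by move=> x _; rewrite expr1n normr1.
pose V := fine (mu U).
have [V0|Vn0] := eqVneq V 0.
  exists 0; have muU0 : mu U = 0%E by rewrite -[LHS]fineK ?ge0_fin_numE // -/V V0.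
  by exists U; split=> // x /not_implyP[].
pose C := ipL2 U v (cst 1) / V; exists C.
have i11 : ipL2 U (cst 1) (cst 1) = V.
  rewrite ipL2E; under eq_Rintegral do rewrite mulr1.
  by rewrite Rintegral_cst // mul1r.
have key f : L2 U f -> ipL2 U v f * V = ipL2 U v (cst 1) * ipL2 U (cst 1) f.
  move=> Lf; have c1 := ipL2_cvg Lf Hm Hv cv; have c2 := ipL2_cvg L1 Hm Hv cv.
  have c1V : ipL2 U (v_ m) f * V @[m --> \oo] --> ipL2 U v f * V.
    by apply: cvgM => //; exact: cvg_cst.
  have c21 : ipL2 U (v_ m) (cst 1) * ipL2 U (cst 1) f @[m --> \oo] -->
      ipL2 U v (cst 1) * ipL2 U (cst 1) f by apply: cvgM => //; exact: cvg_cst.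
  apply: (cvg_eq_lim _ c1V c21) => m /=; have [c hc] := cst_m m.
  have lc g : L2 U g -> ipL2 U (v_ m) g = c * ipL2 U (cst 1) g.
    move=> Lg; rewrite (ipL2_ae hc (eq_on_refl U g)) !ipL2E.
    rewrite -RintegralZl ?L2_mul //.
    by apply: eq_Rintegral => x _ /=; rewrite mul1r.
  by rewrite !lc // i11 mulrAC.
have Lf : L2 U ((- C) \*o cst 1 \+ v) by exact: L2_lin.
have f1 : ipL2 U (cst 1) ((- C) \*o cst 1 \+ v) = 0.
  by rewrite ipL2_lin // i11 (ipL2C _ _ v) /C; field.
have vf : ipL2 U v ((- C) \*o cst 1 \+ v) = 0.
  by apply: (mulIf Vn0); rewrite key // f1 mulr0 mul0r.
have ff : ipL2 U ((- C) \*o cst 1 \+ v) ((- C) \*o cst 1 \+ v) = 0.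
  rewrite ipL2_lin // ![ipL2 U ((- C) \*o cst 1 \+ v) _]ipL2C f1 vf; ring.
apply: filterS (ipL2_eq0 mU Lf ff) => x h /h /=; lra.
Qed.

End gluing.

(** * The elliptic problem that defines g(lambda) *)

Section equivalent_norms.
Context {X : Type} {R : realType}.
Variables (V : set (X -> R)) (B B' : (X -> R) -> (X -> R) -> R).
Hypothesis linV : lin_closed V.

Lemma complete_form_equiv (k k' : R) : 0 < k ->
  (forall v, V v -> fnorm B v <= k * fnorm B' v) ->
  (forall v, V v -> fnorm B' v <= k' * fnorm B v) ->
  complete_form V B -> complete_form V B'.
Proof.
move=> k0 h h' cB v_ Vn cau.
have [e e0|v Vv cv] := cB v_ Vn.
  have [M hM] := cau (e / k) (divr_gt0 e0 k0); exists M => m p Mm Mp.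
  apply: le_trans (h _ (lin_sub linV (Vn m) (Vn p))) _.
  by rewrite mulrC -ler_pdivlMr // hM.
exists v => //; apply: (@squeeze_cvg0 _ _ (fun m => k' * fnorm B (v_ m \- v))).
  by move=> m; rewrite ger0_norm ?fnorm_ge0 // h' //; exact: lin_sub.
by rewrite -(mulr0 k'); apply: cvgM => //; exact: cvg_cst.
Qed.

End equivalent_norms.

Section elliptic.
Context {R : realType} {n N : nat}.
Local Notation E := 'rV[R]_n.+1.
Local Notation mu := (lebesgue_rV R n.+1).
Variables (Om : set E) (Omi : 'I_N -> set E).
Implicit Types (lam : 'I_N -> \bar R) (v w z : E -> R).
Hypothesis part : open_partition Om Omi.
Let oOmi i : open (Omi i). Proof. by case: part. Qed.
Let mOmi i : measurable (Omi i). Proof. exact: open_measurable_rV. Qed.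
Let dis i j x : Omi i x -> Omi j x -> i = j. Proof. by case: part => _ _ _ h _; exact: h. Qed.

Local Notation P := (pieceH1 Omi).
Local Notation nP := (fnorm (ipP Omi)).

(** The directions in which g(lambda) can move: on Omega_0 the equation has no gradient
   term and determines g(lambda) independently of the finite positive values of lambda. *)
Definition freespace lam : set (E -> R) :=
  [set v | spaceV Om Omi lam v /\ forall i, i \in I0 lam -> eq_on (Omi i) v (cst 0)].

(** The left-hand side of the equation for g(lambda), by [is_g_formE]. *)
Definition gform lam : (E -> R) -> (E -> R) -> R :=
  wform Omi (fun i => fine (lam i)) (fun=> 1).

Lemma freespace_H1 lam v : freespace lam v -> P v.
Proof. by move=> [[/(pieceV_H1 part)]]. Qed.

Lemma freespace_lin lam : lin_closed (freespace lam).
Proof.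
have [s0 sl] := spaceV_lin part lam; split.
  by split=> // i _; exact: eq_on_refl.
move=> a v w [sv v0] [sw w0]; split=> [|i iI]; first exact: sl.
apply: eq_on_trans (eq_on_lin a (v0 i iI) (w0 i iI)) _.
by apply: aeW => x _ /=; rewrite mulr0 addr0.
Qed.

(** Elements of V(lambda) may jump between Omega_0 and the rest, so they can be cut
   off there. *)
Lemma spaceV_glue lam v : spaceV Om Omi lam v ->
  freespace lam (glue Omi (~: I0 lam) (fun=> v)).
Proof.
have pV_glue w : pieceV Om Omi lam w ->
    pieceV Om Omi lam (glue Omi (~: I0 lam) (fun=> w)).
  move=> pw; have [w1 w0] := pw.
  have [mg _] : L2 setT (glue Omi (~: I0 lam) (fun=> w)).
    by apply: (L2_glue part) => i _; case: (pieceV_H1 part pw i).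
  have m1 := open_measurable_rV (@open_Om1 _ _ _ Om Omi lam).
  have m0 := open_measurable_rV (@open_Om0 _ _ _ _ _ part lam).
  split.
    apply: (H1_ae m1 _ _ w1); first exact: measurable_funTS.
    exact (eq_on_glue part w (pieces_cover_Om1 part lam)).
  apply: (H1_ae m0 _ _ (H1_cst0 (@open_Om0 _ _ _ _ _ part lam))).
    exact: measurable_funTS.
  apply: aeW => x [i iI xi]; rewrite (glue_off part _ _ xi) //.
  by rewrite finset.in_setC negbK.
have pvl := pieceV_lin part lam.
move=> [pv zv cv]; split; last first.
  move=> i iI; apply: aeW => x xi; rewrite (glue_off part _ _ xi) //.
  by rewrite finset.in_setC negbK.
split; first exact: pV_glue.
  move=> eps eps0; have [w [pw bw] hw] := zv eps eps0.
  exists (glue Omi (~: I0 lam) (fun=> w)).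
    split; first exact: pV_glue.
    have [r r0 hr] := bw; exists r => //; apply: filterS hr => x hx bx.
    rewrite /glue big1 // => i _; rewrite patchE; case: ifP => // _; exact: hx.
  have pd : pieceV Om Omi lam (v \- w) by exact: (lin_sub pvl).
  have -> : glue Omi (~: I0 lam) (fun=> v) \- glue Omi (~: I0 lam) (fun=> w) =
      glue Omi (~: I0 lam) (fun=> v \- w).
    apply/funext => x; rewrite /= /glue -sumrB; apply: eq_bigr => i _.
    by rewrite !patchE; case: ifP => // _; rewrite subrr.
  rewrite (normV_nP part); last exact: pV_glue.
  apply: le_lt_trans hw; rewrite (normV_nP part) // ler_wsqrtr //.
  have Hd := pieceV_H1 part pd; have Hg := pieceH1_glue part (~: I0 lam) Hd.
  apply: ipP_le => i; have [iI|iI] := boolP (i \in ~: I0 lam).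
    have gd : eq_on (Omi i) (glue Omi (~: I0 lam) (fun=> v \- w)) (v \- w).
      by apply: aeW => x xi; rewrite (glueE part _ iI xi).
    by rewrite (ipGrad_ae (@oOmi i) (Hg i) (Hd i) (Hg i) (Hd i) gd gd) (ipL2_ae gd gd).
  have gd : eq_on (Omi i) (glue Omi (~: I0 lam) (fun=> v \- w)) (cst 0).
    by apply: aeW => x xi; rewrite (glue_off part _ iI xi).
  rewrite (ipGrad_cst0 (@oOmi i) (Hg i) gd) (ipL2_ae0 _ _ gd) // add0r.
  apply: addr_ge0; [exact: ipGrad_ge0|exact: ipL2_ge0].
move=> i iI; have [c hc] := cv i iI; exists c.
have iI0 : i \in ~: I0 lam.
  by move: iI; rewrite finset.in_setC !inE => /eqP ->.
apply: eq_on_trans hc; apply: aeW => x xi; by rewrite (glueE part _ iI0 xi).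
Qed.

(** Convergence in HH is convergence of the piecewise norms; the limit is again in
   V(lambda) because [H1] regularity across the interfaces, constants and boundary values
   pass to the limit. *)
Lemma freespace_complete J lam : I0 lam \subset I0H1 Omi (cl_union Omi J) ->
  complete_form (spaceH Om Omi (cl_union Omi J)) (ipP Omi) ->
  complete_form (freespace lam) (ipP Omi).
Proof.
move=> sI cH v_ Vm cau.
have fH m : spaceH Om Omi (cl_union Omi J) (v_ m).
  by apply: (spaceV_spaceH part sI); case: (Vm m).
have [v Hv cv] := cH v_ fH cau.
have Pv := spaceH_H1 part Hv; have Pm m := freespace_H1 (Vm m).
(* [v] vanishes almost everywhere on Omega_0; [v'] vanishes there everywhere. *)
pose v' := glue Omi (~: I0 lam) (fun=> v).
have Pv' : P v' by exact: (pieceH1_glue part).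
have v0 i : i \in I0 lam -> eq_on (Omi i) v (cst 0).
  move=> iI; apply: ipL2_eq0 => //; first by case: (Pv i).
  apply/esym; apply: (cvg_eq_lim _ (@cvg_cst _ (0 : R) _ _ _)
    (ipL2_cvg part (Pv i).1 Pm Pv cv)) => m /=.
  by rewrite (ipL2_ae0 _ (mOmi i) ((Vm m).2 i iI)).
have vv' i : eq_on (Omi i) v v'.
  have [iI|iI] := boolP (i \in ~: I0 lam).
    by apply: aeW => x xi; rewrite /v' (glueE part _ iI xi).
  rewrite finset.in_setC negbK in iI; apply: eq_on_trans (v0 i iI) _.
  apply: aeW => x xi; rewrite /v' (glue_off part _ _ xi) //.
  by rewrite finset.in_setC negbK.
have cv' : nP (v_ m \- v') @[m --> \oo] --> (0 : R).
  rewrite (_ : (fun m => nP (v_ m \- v')) = (fun m => nP (v_ m \- v))) //.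
  apply/funext => m; have P1 := lin_sub (pieceH1_linear part) (Pm m) Pv.
  have P2 := lin_sub (pieceH1_linear part) (Pm m) Pv'.
  have h i : eq_on (Omi i) (v_ m \- v') (v_ m \- v).
    by apply: filterS (vv' i) => x hx xi /=; rewrite hx.
  by rewrite /fnorm /ipP (wform_ae part _ _ P2 P1 P2 P1 h h).
exists v' => //.
have m0 := open_measurable_rV (@open_Om0 _ _ _ _ _ part lam).
have pv' : pieceV Om Omi lam v'.
  split.
    apply: (H1_limit part (@open_Om1 _ _ _ Om Omi lam) (pieces_cover_Om1 part lam)
      Pm Pv _ cv) => m.
    by have [[[]]] := Vm m.
  apply: (H1_ae m0 _ _ (H1_cst0 (@open_Om0 _ _ _ _ _ part lam))).
  - apply: measurable_funTS.
    have [mg _] : L2 setT v' by apply: (L2_glue part) => i _; case: (Pv i).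
    exact: mg.
  - apply: aeW => x [i iI xi]; rewrite /v' (glue_off part _ _ xi) //.
    by rewrite finset.in_setC negbK.
split; last first.
  by move=> i iI; apply: eq_on_trans (eq_on_sym (vv' i)) _; exact: v0.
split => //.
  apply: (zero_on_boundary_lim part (pieceV_lin part lam)) => //.
  - by move=> x; exact: pieceV_H1.
  - by move=> x; exact: normV_nP.
  - move=> eps eps0; have /cvgr0Pnorm_lt/(_ _ eps0)[M _ hM] := cv'.
    exists (v_ M); first by have [[? ? _] _] := Vm M; split.
    by have := hM M (leqnn M); rewrite /= ger0_norm ?fnorm_ge0.
move=> i iI; apply: (eq_on_cst_limit part Pm Pv' _ cv') => m.
by have [[_ _ c] _] := Vm m; exact: c.
Qed.

Section coercivity.
Variables (lam : 'I_N -> \bar R) (c : R).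
Hypothesis lam_ge0 : forall i, (0 <= lam i)%E.
Hypothesis c_gt0 : 0 < c.
Hypothesis c_le1 : c <= 1.
Hypothesis c_le : forall i, i \notin I0 lam :|: Ioo lam -> c <= fine (lam i).

Lemma gform_ge0 v : 0 <= gform lam v v.
Proof. by apply: wform_ge0 => // i; exact: fine_ge0. Qed.

(** On the pieces where the gradient coefficient is not bounded below, the elements
   of the space are constant, so that the missing term is 0. *)
Lemma gform_coercive v : freespace lam v -> c * ipP Omi v v <= gform lam v v.
Proof.
move=> Vv; have Pv := freespace_H1 Vv.
rewrite /ipP /gform /wform mulr_sumr; apply: ler_sum => i _; rewrite !mul1r mulrDr.
apply: lerD; last by rewrite ler_piMl ?ipL2_ge0.
have [iI|/c_le ci] := boolP (i \in I0 lam :|: Ioo lam); last first.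
  by rewrite ler_wpM2r ?ipGrad_ge0.
suff -> : ipGrad (Omi i) v v = 0 by rewrite !mulr0.
have [[_ _ cv] v0] := Vv; move: iI; rewrite finset.in_setU => /orP[/v0|/cv[d]].
  exact: ipGrad_cst0.
exact: ipGrad_cst0.
Qed.

Lemma gform_le v : gform lam v v <= (1 + \sum_i fine (lam i)) * ipP Omi v v.
Proof.
rewrite /ipP /gform /wform mulr_sumr; apply: ler_sum => i _; rewrite !mul1r mulrDr.
have s0 : fine (lam i) <= \sum_j fine (lam j).
  by rewrite (bigD1 i) //= lerDl sumr_ge0 // => j _; exact: fine_ge0.
have f0 : 0 <= fine (lam i) by exact: fine_ge0.
have := ipGrad_ge0 (Omi i) v; have := ipL2_ge0 (Omi i) v.
move: (ipGrad _ _ _) (ipL2 _ _ _) => p q p0 q0.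
move: s0; move: (\sum_j _) => s s0; nra.
Qed.

Lemma elliptic_solve J (G : (E -> R) -> R) :
  I0 lam \subset I0H1 Omi (cl_union Omi J) ->
  complete_form (spaceH Om Omi (cl_union Omi J)) (ipP Omi) ->
  linear_on (freespace lam) G ->
  (exists C, forall v, freespace lam v -> `|G v| <= C * nP v) ->
  exists2 z, freespace lam z & forall v, freespace lam v -> gform lam z v = G v.
Proof.
move=> sI cH linG [C hC]; have linf := freespace_lin lam.
have sc0 : 0 < Num.sqrt c by rewrite sqrtr_gt0.
have nle v : freespace lam v -> nP v <= (Num.sqrt c)^-1 * fnorm (gform lam) v.
  move=> Vv; rewrite mulrC ler_pdivlMr // mulrC /fnorm -sqrtrM ?(ltW c_gt0) //.
  by rewrite ler_wsqrtr // gform_coercive.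
have kle v : fnorm (gform lam) v <= Num.sqrt (1 + \sum_i fine (lam i)) * nP v.
  have s0 : 0 <= 1 + \sum_i fine (lam i).
    by rewrite addr_ge0 // sumr_ge0 // => i _; exact: fine_ge0.
  by rewrite /fnorm -(sqrtrM _ s0) ler_wsqrtr // gform_le.
have [bl1 bl2] := wform_bilinear part (fun i => fine (lam i)) (fun=> 1).
have sub v : freespace lam v -> P v := @freespace_H1 lam v.
apply: (@riesz_representation _ _ (freespace lam) (gform lam)) => //.
- split=> [v Vv a x y Vx Vy|w Vw a x y Vx Vy].
    by apply: bl1; exact: sub.
  by apply: bl2; exact: sub.
- by move=> v w _ _; exact: wformC.
- by move=> v _; exact: gform_ge0.
- have sci : 0 < (Num.sqrt c)^-1 by rewrite invr_gt0.
  exact: (complete_form_equiv linf sci nle (fun v _ => kle v) (freespace_complete sI cH)).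
- exists (`|C| / Num.sqrt c) => v Vv; apply: le_trans (hC v Vv) _.
  apply: (@le_trans _ _ (`|C| * nP v)); first by rewrite ler_wpM2r ?fnorm_ge0 ?ler_norm.
  by rewrite -mulrA ler_wpM2l // nle.
Qed.

End coercivity.

Lemma is_g_formE lam w v : spaceV Om Omi lam w -> spaceV Om Omi lam v ->
  \int[mu]_(x in Om `\` Om0 Omi lam)
        (coef Omi lam x * grad_dot (Om1 Om Omi lam) w v x + w x * v x)
    + \int[mu]_(x in Om0 Omi lam) (w x * v x) = gform lam w v.
Proof.
move=> [pw _ _] [pv _ _]; have Hw := pieceV_H1 part pw; have Hv := pieceV_H1 part pv.
have iL i : mu.-integrable (Omi i) (EFin \o (fun x => w x * v x)).
  by apply: L2_mul => //; [case: (Hw i)|case: (Hv i)].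
have iG i : mu.-integrable (Omi i)
    (EFin \o (fun x => fine (lam i) * grad_dot (Omi i) w v x)).
  exact: (integrableZl (mOmi i) _ (integrable_grad_dot (@oOmi i) (Hw i) (Hv i))).
rewrite (Rintegral_pieces part (pieces_cover_OmD part lam)
  (F := fun i x => fine (lam i) * grad_dot (Omi i) w v x + w x * v x)).
- rewrite (Rintegral_pieces part (pieces_cover_Om0 Omi lam)
    (F := fun i x => w x * v x)) //; last by move=> i _; exact: eq_on_refl.
  rewrite addrC /gform /wform [RHS](bigID (fun i => i \in I0 lam)) /=; congr (_ + _).
    by apply: eq_bigr => i; rewrite inE => /eqP ->; rewrite mul0r add0r mul1r ipL2E.
  apply: eq_big => [i|i iI]; first by rewrite finset.in_setC.
  rewrite RintegralD // mul1r RintegralZl ?ipGradE ?ipL2E //.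
  exact: integrable_grad_dot.
- move=> i iI; have sub := (pieces_cover_Om1 part lam).1 i iI.
  have := grad_dot_sub (@open_Om1 _ _ _ Om Omi lam) (@oOmi i) sub pw.1 pv.1.
  apply: filterS => x hx xi; rewrite hx //; congr (_ * _ + _).
  rewrite /coef (bigD1 i) //= indicE mem_set // mulr1 big1 ?addr0 // => j ji.
  rewrite indicE memNset ?mulr0 // => xj.
  by rewrite (dis xj xi) eqxx in ji.
- move=> i iI; exact: (integrableD (mOmi i) (iG i) (iL i)).
Qed.

Section solutions.
Variable F : (E -> R) -> R.

Lemma is_gP lam w : is_g Om Omi F lam w <->
  spaceV Om Omi lam w /\ forall v, spaceV Om Omi lam v -> gform lam w v = F v.
Proof.
by split=> -[sw h]; split=> // v sv; have := h v sv; rewrite is_g_formE.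
Qed.

(** The L2 part of the form alone is definite on V(lambda). *)
Lemma is_g_unique lam w w' : (forall i, (0 <= lam i)%E) ->
  is_g Om Omi F lam w -> is_g Om Omi F lam w' -> eq_on Om w w'.
Proof.
move=> l0 /is_gP[sw hw] /is_gP[sw' hw']; apply/eq_on_sub0/(eq_on_pieces part) => i.
have sd : spaceV Om Omi lam (w \- w') by exact: (lin_sub (spaceV_lin part lam)).
have [ps _ _] := sd; have Pd := pieceV_H1 part ps.
have [pw _ _] := sw; have [pw' _ _] := sw'.
have g0 : gform lam (w \- w') (w \- w') = 0.
  have [_ bl2] := wform_bilinear part (fun i => fine (lam i)) (fun=> 1).
  have := linear_on_sub (bl2 _ Pd) (pieceV_H1 part pw) (pieceV_H1 part pw').
  by rewrite -/(gform lam) /= hw // hw' // subrr.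
apply: ipL2_eq0 => //; first by case: (Pd i).
have : fine (lam i) * ipGrad (Omi i) (w \- w') (w \- w') +
    1 * ipL2 (Omi i) (w \- w') (w \- w') = 0.
  apply: (psumr_eq0P _ g0) => // j _.
  by rewrite addr_ge0 // mulr_ge0 ?ipGrad_ge0 ?ipL2_ge0 ?fine_ge0.
have := mulr_ge0 (fine_ge0 (l0 i)) (ipGrad_ge0 (Omi i) (w \- w')).
have := ipL2_ge0 (Omi i) (w \- w').
by rewrite mul1r; move: (_ * _) (ipL2 _ _ _) => p q; lra.
Qed.

Lemma is_g_g_of lam : (exists w, is_g Om Omi F lam w) ->
  is_g Om Omi F lam (g_of Om Omi F lam).
Proof. by move=> h; rewrite /g_of; exact: xgetPex h. Qed.

End solutions.

End elliptic.

(** * Differentiability of g(lambda) *)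

Lemma positive_lower_bound (R : realFieldType) (I : finType) (Q : pred I) (f : I -> R) :
  (forall i, Q i -> 0 < f i) ->
  exists c, [/\ 0 < c, c <= 1 & forall i, Q i -> c <= f i].
Proof.
move=> f0; exists (\big[Num.min/1]_(i | Q i) f i); split.
- by elim/big_ind: _ => // x y x0 y0; rewrite lt_min x0.
- exact: bigmin_le_id.
- by move=> i Qi; exact: bigmin_le_cond.
Qed.

Section perturbation.
Context {R : realType} {n N : nat}.
Local Notation E := 'rV[R]_n.+1.
Local Notation mu := (lebesgue_rV R n.+1).
Variables (Om : set E) (Omi : 'I_N -> set E).
Implicit Types (lam : 'I_N -> \bar R) (l : 'I_N -> R) (v w z : E -> R).

(** For small [t] the perturbation changes neither the sets where lambda is 0 or
   infinite nor, by more than a factor 2, the lower bound of its other values; the bound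
   [c] is uniform in [t]. *)
Lemma shift_lam_near lam l : (forall i, (0 <= lam i)%E) -> hatLambda lam l ->
  exists c t0, [/\ 0 < c, c <= 1, 0 < t0 & forall t, `|t| <= t0 ->
    [/\ I0 (shift_lam lam t l) = I0 lam, Ioo (shift_lam lam t l) = Ioo lam,
        forall i, (0 <= shift_lam lam t l i)%E,
        forall i, fine (shift_lam lam t l i) = fine (lam i) + t * l i &
        forall i, i \notin I0 lam :|: Ioo lam -> c <= fine (shift_lam lam t l i)]].
Proof.
move=> lam0 l0.
have free i : i \notin I0 lam :|: Ioo lam -> 0 < fine (lam i) /\ lam i = (fine (lam i))%:E.
  rewrite finset.in_setU !inE negb_or; have := lam0 i; case: (lam i) => //= r.
  by rewrite lee_fin eqe => r0 /andP[rn0 _]; rewrite lt_def rn0.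
have [c [c0 c1 hc]] := @positive_lower_bound R _ (fun i => i \notin I0 lam :|: Ioo lam)
  (fun i => fine (lam i)) (fun i iK => (free i iK).1).
pose L := \sum_i `|l i|; have L0 : 0 <= L by exact: sumr_ge0.
have lL i : `|l i| <= L by rewrite /L (bigD1 i) //= lerDl sumr_ge0.
exists (c / 2), (c / 2 / (L + 1)); split=> [|||t tt0].
- by rewrite divr_gt0.
- by rewrite ler_pdivrMr // (le_trans c1) // mul1r ler1n.
- by rewrite !divr_gt0 // ltr_wpDl.
have tl i : `|t * l i| <= c / 2.
  rewrite normrM; apply: (@le_trans _ _ (c / 2 / (L + 1) * (L + 1))).
    by apply: ler_pM => //; apply: le_trans (lL i) _; rewrite lerDl.
  by rewrite divfK // gt_eqF // ltr_wpDl.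
have bd i : i \in I0 lam :|: Ioo lam -> shift_lam lam t l i = lam i.
  by move=> /l0 li; rewrite /shift_lam li mulr0 adde0.
have fr i : i \notin I0 lam :|: Ioo lam ->
    shift_lam lam t l i = (fine (lam i) + t * l i)%:E.
  by move=> iK; rewrite /shift_lam {1}(free i iK).2 -EFinD.
have frc i : i \notin I0 lam :|: Ioo lam -> c / 2 <= fine (lam i) + t * l i.
  by move=> iK; have := hc i iK; have := tl i; rewrite ler_norml => /andP[]; lra.
split.
- apply/setP => i; rewrite !inE; have [iB|iK] := boolP (i \in I0 lam :|: Ioo lam).
    by rewrite bd.
  rewrite fr // eqe; have := frc i iK; have [fi0 ->] := free i iK; rewrite eqe => h.
  by rewrite !gt_eqF //; lra.
- apply/setP => i; rewrite !inE; have [iB|iK] := boolP (i \in I0 lam :|: Ioo lam).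
    by rewrite bd.
  by rewrite fr // (free i iK).2.
- move=> i; have [iB|iK] := boolP (i \in I0 lam :|: Ioo lam); first by rewrite bd.
  by rewrite fr // lee_fin; have := frc i iK; lra.
- move=> i; have [iB|iK] := boolP (i \in I0 lam :|: Ioo lam).
    by rewrite bd // l0 // mulr0 addr0.
  by rewrite fr.
- by move=> i iK; rewrite fr //=; exact: frc.
Qed.

Lemma spaceV_eq lam lam' : I0 lam = I0 lam' -> Ioo lam = Ioo lam' ->
  spaceV Om Omi lam = spaceV Om Omi lam'.
Proof. by move=> e1 e2; rewrite /spaceV /pieceV /normV /Om1 /Om0 e1 e2. Qed.

Lemma freespace_eq lam lam' : I0 lam = I0 lam' -> Ioo lam = Ioo lam' ->
  freespace Om Omi lam = freespace Om Omi lam'.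
Proof. by move=> e1 e2; rewrite /freespace (spaceV_eq e1 e2) e1. Qed.

Hypothesis part : open_partition Om Omi.
Let oOmi i : open (Omi i). Proof. by case: part. Qed.
Let mOmi i : measurable (Omi i). Proof. exact: open_measurable_rV. Qed.

Local Notation P := (pieceH1 Omi).
Local Notation nP := (fnorm (ipP Omi)).

(** The derivative of [gform] in the direction [l]. *)
Definition bform l : (E -> R) -> (E -> R) -> R := wform Omi l (fun=> 0).

Lemma ipGrad_le_nP i v w : P v -> P w -> `|ipGrad (Omi i) v w| <= nP v * nP w.
Proof.
have le v' : P v' -> fnorm (ipGrad (Omi i)) v' <= nP v'.
  move=> Hv; rewrite /fnorm ler_wsqrtr // /ipP /wform (bigD1 i) //= !mul1r -addrA lerDl.
  rewrite addr_ge0 ?ipL2_ge0 //.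
  by apply: sumr_ge0 => j _; rewrite !mul1r addr_ge0 ?ipGrad_ge0 ?ipL2_ge0.
have bil : bilinear_on P (ipGrad (Omi i)).
  have lin f : P f -> linear_on P (ipGrad (Omi i) f).
    by move=> Hf a g h Hg Hh; exact: (ipGrad_lin a (@oOmi i) (Hg i) (Hh i) (Hf i)).
  split=> [f /lin//|g Hg a f h Hf Hh].
  rewrite (ipGradC (Omi i) _ g) (lin g Hg a f h Hf Hh).
  by rewrite (ipGradC (Omi i) g f) (ipGradC (Omi i) g h).
move=> Hv Hw; apply: (@le_trans _ _ (fnorm (ipGrad (Omi i)) v * fnorm (ipGrad (Omi i)) w)).
  exact: (cauchy_schwarz (pieceH1_linear part) bil (fun f h _ _ => ipGradC (Omi i) f h)
    (fun f _ => ipGrad_ge0 (Omi i) f) Hv Hw).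
by apply: ler_pM; [exact: fnorm_ge0|exact: fnorm_ge0|exact: le|exact: le].
Qed.

Lemma bform_le l v w : P v -> P w ->
  `|bform l v w| <= (\sum_i `|l i|) * nP v * nP w.
Proof.
move=> Hv Hw; rewrite /bform /wform (le_trans (ler_norm_sum _ _ _)) //.
rewrite -mulrA mulr_suml; apply: ler_sum => i _.
by rewrite mul0r addr0 normrM ler_wpM2l // ipGrad_le_nP.
Qed.

Lemma gform_shift lam l t v w :
  (forall i, fine (shift_lam lam t l i) = fine (lam i) + t * l i) ->
  gform Omi (shift_lam lam t l) v w = gform Omi lam v w + t * bform l v w.
Proof.
move=> h; rewrite /gform /bform /wform mulr_sumr -big_split /=.
apply: eq_bigr => i _; rewrite h.
move: (ipGrad _ _ _) (ipL2 _ _ _) => p q; ring.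
Qed.

Lemma bform_glue lam l v w : hatLambda lam l -> P v -> P w ->
  bform l v (glue Omi (~: I0 lam) (fun=> w)) = bform l v w.
Proof.
move=> l0 Hv Hw; apply: eq_bigr => i _; rewrite !mul0r !addr0.
have [iI|iI] := boolP (i \in I0 lam).
  have -> : l i = 0 by apply: l0; rewrite finset.in_setU iI.
  by rewrite !mul0r.
have Hg := pieceH1_glue part (~: I0 lam) Hw.
have gd : eq_on (Omi i) (glue Omi (~: I0 lam) (fun=> w)) w.
  by apply: aeW => x xi; rewrite (glueE part _ _ xi) // finset.in_setC.
by rewrite (ipGrad_ae (@oOmi i) (Hv i) (Hv i) (Hg i) (Hw i) (eq_on_refl _ _) gd).
Qed.

Lemma gform_glue lam z w : freespace Om Omi lam z -> P w ->
  gform Omi lam z (glue Omi (~: I0 lam) (fun=> w)) = gform Omi lam z w.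
Proof.
move=> Hz Hw; have Pz := freespace_H1 part Hz; apply: eq_bigr => i _; rewrite !mul1r.
have [iI|iI] := boolP (i \in I0 lam).
  have z0 := Hz.2 i iI; rewrite !(ipL2_ae0 _ (mOmi i) z0).
  by move: iI; rewrite inE => /eqP ->; rewrite !mul0r.
have Hg := pieceH1_glue part (~: I0 lam) Hw.
have gd : eq_on (Omi i) (glue Omi (~: I0 lam) (fun=> w)) w.
  by apply: aeW => x xi; rewrite (glueE part _ _ xi) // finset.in_setC.
rewrite (ipGrad_ae (@oOmi i) (Pz i) (Pz i) (Hg i) (Hw i) (eq_on_refl _ _) gd).
by rewrite (ipL2_ae (eq_on_refl (Omi i) z) gd).
Qed.

Variables (J : {set 'I_N}) (F : (E -> R) -> R).
Local Notation O := (cl_union Omi J).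
Local Notation HH := (spaceH Om Omi O).
Local Notation normHH := (normH Om Omi O).
Hypothesis complHH : complete_form HH (ipP Omi).

Variable lam : 'I_N -> \bar R.
Hypothesis lam_ge0 : forall i, (0 <= lam i)%E.
Hypothesis I0_sub : I0 lam \subset I0H1 Omi O.
Local Notation g := (g_of Om Omi F lam).
Hypothesis hg : exists w, is_g Om Omi F lam w.
Local Notation FV := (freespace Om Omi lam).

Let g_sV : spaceV Om Omi lam g.
Proof. by have /(is_gP part)[] := is_g_g_of hg. Qed.

Lemma g_spaceH : HH g.
Proof. exact: (spaceV_spaceH part I0_sub). Qed.

Let Pg : P g. Proof. exact: spaceH_H1 g_spaceH. Qed.

Lemma freespace_spaceH z : FV z -> HH z.
Proof. by move=> [sz _]; exact: (spaceV_spaceH part I0_sub). Qed.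

(** Instead of solving the perturbed equation on V(lambda), where the form need not be
   coercive, the correction [z] is found in [freespace]. Testing with functions of
   [freespace] is enough, as neither side sees the values on Omega_0. *)
Lemma shift_solution l (t : R) (c : R) : hatLambda lam l -> 0 < c -> c <= 1 ->
  [/\ I0 (shift_lam lam t l) = I0 lam, Ioo (shift_lam lam t l) = Ioo lam,
      forall i, (0 <= shift_lam lam t l i)%E,
      forall i, fine (shift_lam lam t l i) = fine (lam i) + t * l i &
      forall i, i \notin I0 lam :|: Ioo lam -> c <= fine (shift_lam lam t l i)] ->
  exists z, [/\ FV z,
    forall v, FV v -> gform Omi (shift_lam lam t l) z v = - t * bform l g v &
    is_g Om Omi F (shift_lam lam t l) (g \+ z)].
Proof.
move=> l0 c0 c1 [e1 e2 s0 sf sc]; set lt := shift_lam lam t l.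
have fe : freespace Om Omi lt = FV by exact: freespace_eq.
have se : spaceV Om Omi lt = spaceV Om Omi lam by exact: spaceV_eq.
have sub v : FV v -> P v := @freespace_H1 _ _ _ _ _ part lam v.
have [bb1 _] := wform_bilinear part l (fun=> 0).
have [|||||z Vz hz] := @elliptic_solve _ _ _ Om Omi part lt c s0 c0 c1 _ J
  (fun v => - t * bform l g v).
- by rewrite e1 e2.
- by rewrite e1.
- exact: complHH.
- rewrite fe => a v w Vv Vw; rewrite /bform (bb1 _ Pg _ _ _ (sub _ Vv) (sub _ Vw)).
  ring.
- exists (`|t| * ((\sum_i `|l i|) * nP g)) => v; rewrite fe => Vv.
  rewrite normrM normrN -mulrA ler_wpM2l //; exact: (bform_le l Pg (sub _ Vv)).
rewrite fe in Vz hz; exists z; split=> //.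
apply/(is_gP part); rewrite se; have svl := spaceV_lin part lam; split.
  by apply: (lin_add svl) => //; case: Vz.
move=> v sv; have Pv : P v by have [/(pieceV_H1 part)] := sv.
have Vg := spaceV_glue part sv.
have [_ gb2] := wform_bilinear part (fun i => fine (lt i)) (fun=> 1).
have := linear_on_add (gb2 _ Pv) Pg (sub _ Vz); rewrite -/(gform Omi lt) /= => ->.
have -> : gform Omi lt z v = - t * bform l g v.
  rewrite -(bform_glue l0 Pg Pv) -hz //.
  have := @gform_glue lt z v; rewrite fe e1 => -> //.
rewrite (gform_shift _ _ sf).
have /(is_gP part)[_ ->] := is_g_g_of hg; last by [].
move: (F v) (bform l g v) => p q; ring.
Qed.

Lemma normHH_nP v : HH v -> normHH v = nP v.
Proof. by move=> [pv _]; exact: normH_nP. Qed.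

Lemma g_shift_spaceH l t : I0 (shift_lam lam t l) = I0 lam ->
  (exists w, is_g Om Omi F (shift_lam lam t l) w) ->
  HH (g_of Om Omi F (shift_lam lam t l)).
Proof.
move=> e1 /is_g_g_of /(is_gP part)[sg _].
by apply: (spaceV_spaceH part _ sg); rewrite e1.
Qed.

(** Implicit differentiation. With z_t the correction at lam_t, the error
   y = z_t / t - w satisfies gform(lam_t; y, v) = - t bform(l; w, v); testing with v = y and
   the coercivity that is uniform in [t] bound the norm of y by a multiple of |t|. *)
Lemma g_derivable l : hatLambda lam l -> exists w,
  [/\ FV w, forall v, FV v -> gform Omi lam w v = - bform l g v &
      is_g_derive Om Omi F O lam l w].
Proof.
move=> l0; have [c [t0 [c0 c1 t00 near_t]]] := shift_lam_near lam_ge0 l0.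
have HHl := spaceH_lin part J.
have sub v : FV v -> P v := @freespace_H1 _ _ _ _ _ part lam v.
have FVl := freespace_lin part lam.
have [bb1 _] := wform_bilinear part l (fun=> 0).
have t0near : forall t : R, `|t| <= t0 -> exists z, [/\ FV z,
    forall v, FV v -> gform Omi (shift_lam lam t l) z v = - t * bform l g v &
    is_g Om Omi F (shift_lam lam t l) (g \+ z)].
  by move=> t tt0; apply: (shift_solution l0 c0 c1); exact: near_t.
have [w Vw hw] : exists2 w, FV w & forall v, FV v -> gform Omi lam w v = - bform l g v.
  have [e1 e2 s0 sf sc] : [/\ I0 (shift_lam lam 0 l) = I0 lam,
      Ioo (shift_lam lam 0 l) = Ioo lam,
      forall i, (0 <= shift_lam lam 0 l i)%E,
      forall i, fine (shift_lam lam 0 l i) = fine (lam i) + 0 * l i &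
      forall i, i \notin I0 lam :|: Ioo lam -> c <= fine (shift_lam lam 0 l i)].
    by apply: near_t; rewrite normr0 ltW.
  apply: (@elliptic_solve _ _ _ Om Omi part lam c lam_ge0 c0 c1 _ J
    (fun v => - bform l g v)) => //.
  - by move=> i /sc; rewrite sf mul0r addr0.
  - move=> a v x Vv Vx; rewrite /bform (bb1 _ Pg _ _ _ (sub _ Vv) (sub _ Vx)).
    ring.
  - exists ((\sum_i `|l i|) * nP g) => v Vv.
    rewrite normrN; exact: (bform_le l Pg (sub _ Vv)).
exists w; split=> //; have Pw := sub _ Vw.
split; first exact: freespace_spaceH.
  exists t0 => //= t; rewrite /= sub0r normrN => /ltW/t0near[z [_ _ hz]].
  by exists (g \+ z).
pose L := \sum_i `|l i|.
have key t : `|t| <= t0 -> t != 0 ->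
    normHH (t^-1 \*o (g_of Om Omi F (shift_lam lam t l) \- g) \- w) <=
    `|t| * (L * nP w / c).
  move=> tt0 tn0; have [z [Vz hz gz]] := t0near t tt0.
  have [e1 e2 s0 sf sc] := near_t t tt0; set lt := shift_lam lam t l.
  set gt := g_of Om Omi F lt.
  have Hgt : HH gt by apply: g_shift_spaceH => //; exists (g \+ z).
  have Pgt := spaceH_H1 part Hgt.
  have gtE : eq_on Om gt (g \+ z).
    have gg : is_g Om Omi F lt gt.
      by apply: (@is_g_g_of _ _ _ Om Omi F lt); exists (g \+ z).
    exact: (is_g_unique part s0 gg gz).
  set q := t^-1 \*o (gt \- g) \- w; set y := t^-1 \*o z \- w.
  have Hq : HH q.
    apply: (lin_sub HHl); last exact: freespace_spaceH.
    exact: (lin_scale HHl t^-1 (lin_sub HHl Hgt g_spaceH)).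
  have Vy : FV y by apply: (lin_sub FVl) => //; exact: (lin_scale FVl).
  have Py := sub _ Vy; have Pq := spaceH_H1 part Hq.
  have qy : forall i, eq_on (Omi i) q y.
    move=> i; apply: filterS ((iffLR (eq_on_pieces part _ _) gtE) i) => x h xi.
    by rewrite /q /y /= h //=; congr (_ * _ - _); rewrite addrAC subrr add0r.
  have -> : normHH q = nP y.
    by rewrite normHH_nP // /fnorm /ipP (wform_ae part _ _ Pq Py Pq Py qy qy).
  have gy : gform Omi lt y y = - t * bform l w y.
    have [_ gb2] := wform_bilinear part (fun i => fine (lt i)) (fun=> 1).
    have := linear_on_sub (gb2 _ Py) (lin_scale (pieceH1_linear part) t^-1 (sub _ Vz)) Pw.
    have := linear_on_scale (pieceH1_linear part) (gb2 _ Py) t^-1 (sub _ Vz).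
    rewrite -/(gform Omi lt) /= => -> ->.
    rewrite hz // (gform_shift _ _ sf) hw //.
    move: (bform l g y) (bform l w y) => p r; field; exact: tn0.
  have co : c * ipP Omi y y <= gform Omi lt y y.
    apply: (gform_coercive part c1); last by rewrite (freespace_eq e1 e2).
    by move=> i; rewrite e1 e2; exact: sc.
  rewrite gy -(sqr_fnorm (@ipP_psd _ _ _ Omi) Py) in co.
  have bl := bform_le l Pw Py.
  have := ler_norm (- t * bform l w y); rewrite normrM normrN => h1.
  have h2 : c * nP y ^+ 2 <= `|t| * (L * nP w * nP y).
    by apply: (le_trans co); apply: (le_trans h1); rewrite ler_wpM2l.
  have [->|y0] := eqVneq (nP y) 0.
    by rewrite !mulr_ge0 ?fnorm_ge0 ?invr_ge0 ?(ltW c0) // sumr_ge0.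
  have yp : 0 < nP y by rewrite lt_def y0 fnorm_ge0.
  rewrite mulrA ler_pdivlMr // -(ler_pM2r yp); move: h2.
  by rewrite expr2; move: (nP y) (nP w) L `|t| => a1 a2 a3 a4; nra.
apply/cvgr0Pnorm_le => eps eps0; pose D := L * nP w / c + 1.
have D0 : 0 < D.
  by rewrite ltr_wpDl // divr_ge0 ?(ltW c0) // mulr_ge0 ?fnorm_ge0 // sumr_ge0.
near=> t.
have tt0 : `|t| <= t0 by near: t; exact: dnbhs0_le.
have tn0 : t != 0 by near: t; exact: nbhs_dnbhs_neq.
rewrite ger0_norm ?sqrtr_ge0 //; apply: (le_trans (key t tt0 tn0)).
apply: (@le_trans _ _ (`|t| * D)); first by rewrite ler_wpM2l // lerDl.
by rewrite -ler_pdivlMr //; near: t; apply: dnbhs0_le; rewrite divr_gt0.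
Unshelve. all: by end_near. Qed.

Lemma is_g_derive_unique l w w' : hatLambda lam l ->
  is_g_derive Om Omi F O lam l w -> is_g_derive Om Omi F O lam l w' -> eq_on Om w w'.
Proof.
move=> l0 [Hw ex cw] [Hw' _ cw']; have HHl := spaceH_lin part J.
have [c [t0 [c0 c1 t00 near_t]]] := shift_lam_near lam_ge0 l0.
have Pw := spaceH_H1 part Hw; have Pw' := spaceH_H1 part Hw'.
have Hd := lin_sub HHl Hw Hw'; have Pd := spaceH_H1 part Hd.
suff d0 : nP (w \- w') = 0.
  apply/eq_on_sub0/(ipP_eq0 part Pd).
  by rewrite -(sqr_fnorm (@ipP_psd _ _ _ Omi) Pd) d0 expr0n.
apply/le_anti; rewrite fnorm_ge0 andbT; apply/ler_addgt0Pl => eps eps0; rewrite addr0.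
have e20 : 0 < eps / 2 by rewrite divr_gt0.
have /cvgr0Pnorm_le/(_ _ e20) h1 := cw; have /cvgr0Pnorm_le/(_ _ e20) h2 := cw'.
pose q t : E -> R := t^-1 \*o (g_of Om Omi F (shift_lam lam t l) \- g).
have /filter_ex[t [ht1 ht2 [et tt0]]] : \forall t \near (0 : R)^',
   [/\ `|normHH (q t \- w)| <= eps / 2, `|normHH (q t \- w')| <= eps / 2 &
       (exists w', is_g Om Omi F (shift_lam lam t l) w') /\ `|t| <= t0].
  near=> t; split; [by near: t; exact: h1|by near: t; exact: h2|].
  split; last by near: t; exact: dnbhs0_le.
  by near: t; exact: nbhs_dnbhs.
have [e1 _ _ _ _] := near_t t tt0.
have Hgt := g_shift_spaceH e1 et.
have Hq : HH (q t) by exact: (lin_scale HHl t^-1 (lin_sub HHl Hgt g_spaceH)).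
have Pq := spaceH_H1 part Hq.
have := fnorm_dist (pieceH1_linear part) (ipP_bilinear part) (@ipP_sym _ _ _ Omi)
  (@ipP_psd _ _ _ Omi) Pw Pq Pw'.
rewrite (fnorm_subC (pieceH1_linear part) (ipP_bilinear part) Pw Pq).
rewrite -(normHH_nP (lin_sub HHl Hq Hw)) -(normHH_nP (lin_sub HHl Hq Hw')).
move: ht1 ht2; rewrite !ger0_norm ?sqrtr_ge0 // => a b h.
by apply: (le_trans h); rewrite [leRHS]splitr lerD.
Unshelve. all: by end_near. Qed.

End perturbation.

(** * The first-order condition *)

Section quadratic_minimum.
Context {X : Type} {R : realType}.
Variables (V : set (X -> R)) (B A : (X -> R) -> (X -> R) -> R) (G : (X -> R) -> R).
Hypotheses (linV : lin_closed V) (bilB : bilinear_on V B) (bilA : bilinear_on V A).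
Hypothesis symB : forall v w, V v -> V w -> B v w = B w v.
Hypothesis psdB : forall v, V v -> 0 <= B v v.
Hypothesis symA : forall v w, V v -> V w -> A v w = A w v.
Hypothesis linG : linear_on V G.
Local Notation nrm := (fnorm B).
Variables (kappa M C : R).
Hypothesis kappa_gt0 : 0 < kappa.
Hypothesis A_le : forall v w, V v -> V w -> `|A v w| <= M * nrm v * nrm w.
Hypothesis G_le : forall v, V v -> `|G v| <= C * nrm v.
Local Notation f v := (kappa / 2 * A v v - G v).

(** The difference quotient of f along the curve is, for g_t = g + t q_t,
   (kappa A(g, q_t) - G(q_t)) + t kappa / 2 A(q_t, q_t), with q_t --> w. It is
   nonnegative for t > 0 and nonpositive for t < 0, so the first term vanishes in the
   limit. *)
Lemma quadratic_minimum_derive (g w : X -> R) (g_ : R -> X -> R) : V g -> V w ->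
  (\forall t \near (0 : R)^', V (g_ t) /\ f g <= f (g_ t)) ->
  nrm (t^-1 \*o (g_ t \- g) \- w) @[t --> (0 : R)^'] --> (0 : R) ->
  kappa * A g w = G w.
Proof.
move=> Vg Vw hmin cw; pose L v := kappa * A g v - G v.
have linL : linear_on V L.
  by move=> a x y Vx Vy; rewrite /L (bilA.1 _ Vg) // linG //; ring.
pose K := kappa * (`|M| * nrm g) + `|C|; pose K2 := kappa / 2 * `|M| * (nrm w + 1) ^+ 2.
have n0 v : 0 <= nrm v by exact: fnorm_ge0.
have K0 : 0 <= K by rewrite addr_ge0 // !mulr_ge0 // ltW.
have K20 : 0 <= K2 by rewrite /K2 mulr_ge0 ?sqr_ge0 // mulr_ge0 // divr_ge0 // ltW.
have L_le v : V v -> `|L v| <= K * nrm v.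
  move=> Vv; apply: (le_trans (ler_normB _ _)); rewrite mulrDl; apply: lerD.
    rewrite normrM gtr0_norm // -!mulrA ler_wpM2l ?(ltW kappa_gt0) //.
    apply: (le_trans (A_le Vg Vv)); rewrite -mulrA ler_wpM2r ?mulr_ge0 //.
    exact: ler_norm.
  by apply: (le_trans (G_le Vv)); rewrite ler_wpM2r // ler_norm.
(* [s] is the sign of the parameter; both inequalities follow at once. *)
suff key (s : R) : `|s| = 1 -> - (s * L w) <= 0.
  have /key := normr1 R; have /key : `|-1| = 1 :> R by rewrite normrN normr1.
  rewrite /L; lra.
move=> s1; apply/ler_addgt0Pl => eps eps0; rewrite addr0.
pose D := K + K2 + 1; have D0 : 0 < D by rewrite ltr_wpDl // addr_ge0.
pose d := Num.min 1 (eps / D).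
have d0 : 0 < d by rewrite lt_min ltr01 divr_gt0.
have /cvgr0Pnorm_le/(_ _ d0) hd := cw.
have [r /= r0 hr] : \forall t \near (0 : R)^', [/\ V (g_ t), f g <= f (g_ t) &
    nrm (t^-1 \*o (g_ t \- g) \- w) <= d].
  by apply: filterS2 hmin hd => t [Vt ft]; rewrite ger0_norm.
pose t := s * Num.min d (r / 2); have rd0 : 0 < Num.min d (r / 2).
  by rewrite lt_min d0 divr_gt0.
have nt : `|t| = Num.min d (r / 2) by rewrite normrM s1 mul1r gtr0_norm.
have tn0 : t != 0 by rewrite -normr_gt0 nt.
have [|Vt ft nq] := hr t _ tn0.
  by rewrite /= sub0r normrN nt gt_min orbC ltr_pdivrMr // ltr_pMr // ltr1n.
move: nt rd0; set tau := Num.min d (r / 2) => nt tau0.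
have taud : tau <= d by rewrite ge_min lexx.
have d1 : d <= 1 by rewrite ge_min lexx.
have dD : d * D <= eps by rewrite -ler_pdivlMr // ge_min lexx orbT.
pose q := t^-1 \*o (g_ t \- g).
have Vq : V q by exact: (lin_scale linV t^-1 (lin_sub linV Vt Vg)).
have Vqw := lin_sub linV Vq Vw.
have gt : g_ t = t \*o q \+ g by apply/funext => x; rewrite /q /= mulrA mulfV // mul1r subrK.
have nq1 : nrm q <= nrm w + 1.
  have -> : q = (q \- w) \+ w by apply/funext => x /=; ring.
  apply: (le_trans (fnorm_add linV bilB symB psdB Vqw Vw)).
  by rewrite addrC lerD2l (le_trans nq).
have Aqq : A q q <= `|M| * (nrm w + 1) ^+ 2.
  apply: (le_trans (ler_norm _)); apply: (le_trans (A_le Vq Vq)).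
  rewrite -mulrA -expr2; apply: (@le_trans _ _ (`|M| * nrm q ^+ 2)).
    by rewrite ler_wpM2r ?sqr_ge0 // ler_norm.
  by rewrite ler_wpM2l // ler_pXn2r // nnegrE ?addr_ge0.
have Lqw : s * L q <= s * L w + K * d.
  have := linear_on_sub linL Vq Vw => e.
  have -> : s * L q = s * L w + s * (L q - L w) by ring.
  rewrite lerD2l -e (le_trans (ler_norm _)) // normrM s1 mul1r.
  by apply: (le_trans (L_le _ Vqw)); rewrite ler_wpM2l.
have : 0 <= s * L q + kappa / 2 * tau * A q q.
  rewrite -(pmulr_rge0 _ tau0).
  have ss : s * s = 1 by rewrite -expr2 -[LHS]ger0_norm ?sqr_ge0 // normrX s1 expr1n.
  move: ft; rewrite gt (form_lin_sq linV bilA symA) // linG // (symA Vq Vg).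
  have -> : t ^+ 2 = tau * tau by rewrite exprMn expr2 ss mul1r expr2.
  rewrite /t -/tau /L.
  move: (A q q) (A g q) (A g g) (G q) (G g) => a b c x y; rewrite -subr_ge0 => h.
  apply: (le_trans h); rewrite le_eqVlt; apply/orP; left; apply/eqP; by field.
move=> pos; have K2d : kappa / 2 * tau * A q q <= K2 * d.
  have k0 : 0 <= kappa / 2 * tau by rewrite mulr_ge0 ?(ltW tau0) // divr_ge0 // ltW.
  apply: (le_trans (ler_wpM2l k0 Aqq)); apply: (@le_trans _ _ (K2 * tau)).
    by rewrite le_eqVlt /K2 -!mulrA; apply/orP; left; apply/eqP; by field.
  by rewrite ler_wpM2l.
move: pos Lqw dD d0 K2d; rewrite /D.
move: (kappa / 2 * tau * A q q) (s * L q) (s * L w) => a b c; clearbody K K2; lra.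
Qed.
End quadratic_minimum.

(** * Spans and dimension *)

Section spans.
Context {R : realType} {n : nat}.
Local Notation E := 'rV[R]_n.+1.
Local Notation mu := (lebesgue_rV R n.+1).
Variable Om : set E.
Implicit Types (S T : set (E -> R)) (v w : E -> R).

Lemma lin_closed_comb (V : set (E -> R)) m (c : 'I_m -> R) (b : 'I_m -> E -> R) :
  lin_closed V -> (forall i, V (b i)) -> V (lin_comb c b).
Proof.
move=> linV; elim: m c b => [|m ih] c b Vb.
  rewrite (_ : lin_comb c b = cst 0); first by case: linV.
  by apply/funext => x; rewrite /lin_comb big_ord0.
rewrite (_ : lin_comb c b = c ord0 \*o b ord0 \+
    lin_comb (fun i => c (lift ord0 i)) (fun i => b (lift ord0 i))).
  by apply linV.2 => //; exact: ih.
by apply/funext => x; rewrite /lin_comb big_ord_recl.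
Qed.

Lemma span_sub S (V : set (E -> R)) : lin_closed V -> S `<=` V -> Defs.span S `<=` V.
Proof. by move=> linV SV w [m [c [b [Sb ->]]]]; apply: lin_closed_comb => // i; exact: SV. Qed.

Lemma span_lin S : lin_closed (Defs.span S).
Proof.
split.
  exists 0%N, (fun=> 0), (fun _ _ => 0); split; first by case.
  by apply/funext => x; rewrite /lin_comb big_ord0.
move=> a _ _ [m [c [b [Sb ->]]]] [m' [c' [b' [Sb' ->]]]].
exists (m + m')%N, (fun i => match fintype.split i with inl j => a * c j | inr j => c' j end),
  (fun i => match fintype.split i with inl j => b j | inr j => b' j end); split.
  by move=> i; case: fintype.split.
apply/funext => x; rewrite /lin_comb /= big_split_ord /= mulr_sumr; congr (_ + _).
  apply: eq_bigr => i _; rewrite (_ : fintype.split _ = inl i) ?mulrA //.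
  exact: (unsplitK (inl i)).
by apply: eq_bigr => i _; rewrite (_ : fintype.split _ = inr i) //; exact: (unsplitK (inr i)).
Qed.

Lemma mem_span S w : S w -> Defs.span S w.
Proof.
move=> Sw; exists 1%N, (fun=> 1), (fun=> w); split=> //.
by apply/funext => x; rewrite /lin_comb big_ord1 mul1r.
Qed.

Section bases.
Context {I : finType}.
Variable W : I -> E -> R.
Implicit Types (A D K : {set I}) (k : I) (c : I -> R) (x : E).

Definition comb (A : {set I}) (c : I -> R) : E -> R := fun x => \sum_(i in A) c i * W i x.

Definition indep (A : {set I}) : Prop :=
  forall c, eq_on Om (comb A c) (cst 0) -> forall i, i \in A -> c i = 0.

Lemma comb_setU1 A k c x : k \notin A -> comb (k |: A)%SET c x = c k * W k x + comb A c x.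
Proof. by move=> kA; rewrite /comb big_setU1. Qed.

Lemma indep_extend A k : k \notin A -> indep A -> ~ indep (k |: A)%SET ->
  exists c, eq_on Om (W k) (comb A c).
Proof.
move=> kA iA nk; apply: contrapT => hne; apply: nk => c c0.
have ck : c k = 0.
  apply/eqP; apply/negPn/negP => ck; apply: hne; exists (fun i => - (c k)^-1 * c i).
  apply: filterS c0 => x h Ux; have := h Ux; rewrite comb_setU1 // => e.
  have -> : comb A (fun i => - (c k)^-1 * c i) x = - (c k)^-1 * comb A c x.
    by rewrite /comb mulr_sumr; apply: eq_bigr => i _; rewrite mulrA.
  have -> : comb A c x = - (c k * W k x) by apply/eqP; rewrite -addr_eq0 addrC e.
  by rewrite mulrNN mulKf.
move=> i; rewrite finset.in_setU1 => /predU1P[->//|iAi]; apply: iA iAi.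
by apply: filterS c0 => x h Ux; rewrite -(h Ux) comb_setU1 // ck mul0r add0r.
Qed.

(** A maximal independent family between [D] and [K] is a basis. *)
Lemma dim_between T (D K : {set I}) : D \subset K -> indep D ->
  (forall i, i \in K -> T (W i)) ->
  (forall w, T w -> exists c, eq_on Om w (comb K c)) ->
  exists m, [/\ has_dim Om T m, (#|D| <= m)%N & (m <= #|K|)%N].
Proof.
move=> DK iD TW TK; pose P A := (A \subset K) && `[< indep A >].
have [A /maxsetP[/andP[AK /asboolP iA] Amax] DA] : {A | maxset P A & D \subset A}.
  by apply: maxset_exists; rewrite /P DK; apply/asboolP.
have gen k : exists c, k \in K -> eq_on Om (W k) (comb A c).
  have [kA|kA] := boolP (k \in A).
    exists (fun i => (i == k)%:R) => _; apply: aeW => x _.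
    rewrite /comb (bigD1 k) //= eqxx mul1r big1 ?addr0 // => i /andP[_ /negbTE ->].
    by rewrite mul0r.
  have [kK|_] := boolP (k \in K); last by exists (fun=> 0).
  have [|c hc] := indep_extend kA iA; last by exists c.
  move=> ik; have : k \in A.
    rewrite -(Amax (k |: A)%SET) ?finset.in_setU1 ?eqxx //; last exact: finset.subsetUr.
    by apply/andP; split; [rewrite finset.subUset finset.sub1set kK|apply/asboolP].
  by rewrite (negbTE kA).
pose d k := projT1 (cid (gen k)).
have hd k : k \in K -> eq_on Om (W k) (comb A (d k)) by rewrite /d; case: cid.
exists #|A|; split; [|exact: subset_leq_card|exact: subset_leq_card].
exists (fun i => W (enum_val i)); split.
- by move=> i; apply: TW; apply: (fintype.subsetP AK); exact: enum_valP.
- move=> c c0 i.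
  have [a0 a0A] : exists i0, i0 \in A by exists (enum_val i); exact: enum_valP.
  have := iA (fun k => c (enum_rank_in a0A k)) _ (enum_val i) (enum_valP i).
  rewrite enum_valK_in; apply; apply: filterS c0 => x h Ux; rewrite -(h Ux).
  rewrite /comb /lin_comb big_enum_val; apply: eq_bigr => j _; by rewrite enum_valK_in.
- move=> w /TK[c hc]; exists (fun i => \sum_(k in K) c k * d k (enum_val i)).
  have hall : {ae mu, forall x k, k \in K -> Om x -> W k x = comb A (d k) x}.
    apply: ae_forall => k; have [kK|_] := boolP (k \in K); last exact: aeW.
    by apply: filterS (hd k kK) => x h _.
  apply: filterS2 hc hall => x h1 h2 Ux; rewrite h1 // /lin_comb.
  rewrite -(big_enum_val (fun a => (\sum_(k in K) c k * d k a) * W a x)).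
  under [RHS]eq_bigr do rewrite mulr_suml.
  rewrite exchange_big /=; apply: eq_bigr => k kK; rewrite h2 // /comb mulr_sumr.
  by apply: eq_bigr => i _; rewrite mulrA.
Qed.

End bases.
End spans.

Section comb_linear.
Context {R : realType} {n : nat}.
Local Notation E := 'rV[R]_n.+1.
Variables (V : set (E -> R)) (linV : lin_closed V).

Lemma linear_on_lin_comb F m (c : 'I_m -> R) (b : 'I_m -> E -> R) :
  linear_on V F -> (forall i, V (b i)) -> F (lin_comb c b) = \sum_i c i * F (b i).
Proof.
move=> linF; elim: m c b => [|m ih] c b Vb.
  rewrite big_ord0 -(linear_on0 linV linF); congr (F _).
  by apply/funext => x; rewrite /lin_comb big_ord0.
rewrite big_ord_recl -ih // -linF //; last exact: lin_closed_comb.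
by congr (F _); apply/funext => x; rewrite /lin_comb big_ord_recl.
Qed.

Variables (I : finType) (W : I -> E -> R) (A : {set I}) (c : I -> R).
Hypothesis VW : forall i, i \in A -> V (W i).

Let combE : comb W A c = lin_comb (c \o enum_val) (W \o (@enum_val _ (mem A))).
Proof.
by apply/funext => x; rewrite /comb /lin_comb (big_enum_val (fun i => c i * W i x)).
Qed.

Lemma comb_closed : V (comb W A c).
Proof. by rewrite combE; apply: lin_closed_comb => // i; exact/VW/enum_valP. Qed.

Lemma linear_on_comb F : linear_on V F -> F (comb W A c) = \sum_(i in A) c i * F (W i).
Proof.
move=> linF; rewrite combE linear_on_lin_comb // => [|i]; last exact/VW/enum_valP.
by rewrite (big_enum_val (fun i => c i * F (W i))).
Qed.

End comb_linear.

(** * Independence of the derivatives *)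

Section sensitivities.
Context {R : realType} {n N : nat}.
Local Notation E := 'rV[R]_n.+1.
Local Notation mu := (lebesgue_rV R n.+1).
Variables (Om : set E) (Omi : 'I_N -> set E).
Hypothesis part : open_partition Om Omi.
Implicit Types (l : 'I_N -> R) (v w z : E -> R).
Let oOmi i : open (Omi i). Proof. by case: part. Qed.
Let mOmi i : measurable (Omi i). Proof. exact: open_measurable_rV. Qed.
Local Notation P := (pieceH1 Omi).

Variables (F : (E -> R) -> R) (lam : 'I_N -> \bar R).
Hypothesis lam_ge0 : forall i, (0 <= lam i)%E.
Local Notation g := (g_of Om Omi F lam).
Hypothesis hg : exists w, is_g Om Omi F lam w.
Local Notation FV := (freespace Om Omi lam).

Let g_sV : spaceV Om Omi lam g.
Proof. by have /(is_gP part)[] := is_g_g_of hg. Qed.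

Let Pg : P g. Proof. by have [/(pieceV_H1 part)] := g_sV. Qed.

Let sub v : FV v -> P v. Proof. exact: freespace_H1. Qed.

Lemma test_fun_off i j phi : j != i -> test_fun (Omi i) phi -> eq_on (Omi j) phi (cst 0).
Proof.
have [_ _ _ dis _] := part; move=> ji [_ _ sphi]; apply: aeW => x xj.
apply: contrapT => /eqP px; move/eqP: ji; apply; apply: (dis _ _ x) => //.
by apply: sphi; exact: subset_closure.
Qed.

Lemma pieceH1_test_fun i phi : test_fun (Omi i) phi -> P phi.
Proof. by move=> tphi j; exact: H1_test_fun tphi. Qed.

Lemma ipGrad_test_fun_off i j v phi : P v -> j != i -> test_fun (Omi i) phi ->
  ipGrad (Omi j) v phi = 0.
Proof.
move=> Pv ji tphi; have Pphi := pieceH1_test_fun tphi.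
have p0 : P (cst 0) by case: (pieceH1_linear part).
rewrite (ipGrad_ae (@oOmi j) (Pv j) (Pv j) (Pphi j) (p0 j) (eq_on_refl _ _)
  (test_fun_off ji tphi)).
apply: (linear_on0 (pieceH1_linear part)) => a x y Px Py.
exact: (ipGrad_lin a (@oOmi j) (Px j) (Py j) (Pv j)).
Qed.

Lemma freespace_test_fun i phi : i \notin I0 lam :|: Ioo lam ->
  test_fun (Omi i) phi -> FV phi.
Proof.
rewrite finset.in_setU negb_or => /andP[i0 ioo] tphi.
split; first exact: (test_fun_spaceV part ioo).
by move=> j j0; apply: test_fun_off tphi; apply: contraNneq i0 => <-.
Qed.

(** A test function of one piece is admissible in the equation for g(lambda), and only
   that piece contributes. This equation compares g with g0 on the piece. *)
Lemma g_test_fun i phi : i \notin Ioo lam -> test_fun (Omi i) phi ->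
  F phi = fine (lam i) * ipGrad (Omi i) g phi + \int[mu]_(x in Omi i) (g x * phi x).
Proof.
move=> ioo tphi; have /(is_gP part)[_ <-] := is_g_g_of hg; last first.
  exact: (test_fun_spaceV part ioo).
rewrite /gform /wform (bigD1 i) //= mul1r ipL2E big1 ?addr0 // => j ji.
rewrite (ipGrad_test_fun_off Pg ji tphi) mulr0 add0r mul1r ipL2C ipL2_ae0 //.
exact: test_fun_off tphi.
Qed.

(** Where lambda is 0, the equation for g(lambda), tested with functions supported in
   the piece, says that g is g0. *)
Lemma d_indices_sub : d_indices Om Omi F lam \subset ~: (I0 lam :|: Ioo lam).
Proof.
apply/fintype.subsetP => i; rewrite inE => /andP[ioo /asboolP ng].
rewrite finset.in_setC finset.in_setU negb_or ioo andbT; apply/negP => i0; apply: ng.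
move=> phi tphi; rewrite (g_test_fun ioo tphi).
by move: i0; rewrite inE => /eqP ->; rewrite mul0r add0r.
Qed.

Lemma bform_delta i v : bform Omi (fun j => (j == i)%:R) g v = ipGrad (Omi i) g v.
Proof.
rewrite /bform /wform (bigD1 i) //= eqxx mul1r mul0r addr0 big1 ?addr0 // => j /negbTE ->.
by rewrite !mul0r addr0.
Qed.

Lemma gform_injective z : FV z -> gform Omi lam z z = 0 -> eq_on Om z (cst 0).
Proof.
move=> Vz z0; have l0 : hatLambda lam (fun=> 0 : R) by [].
have [c [t0 [c0 c1 t00 near_t]]] := shift_lam_near lam_ge0 l0.
have [|_ _ _ sf sc] := near_t 0; first by rewrite normr0 ltW.
have cl i : i \notin I0 lam :|: Ioo lam -> c <= fine (lam i).
  by move=> /sc; rewrite sf mulr0 addr0.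
have := gform_coercive part c1 cl Vz; rewrite z0 pmulr_rle0 // => le0.
apply: (ipP_eq0 part (sub Vz)); apply/le_anti; rewrite le0.
exact: (@ipP_psd _ _ _ Omi _ (sub Vz)).
Qed.

Variable W : 'I_N -> E -> R.
Local Notation K := (~: (I0 lam :|: Ioo lam)).
Hypothesis FW : forall i, i \in K -> FV (W i).
Hypothesis hW : forall i v, i \in K -> FV v -> gform Omi lam (W i) v = - ipGrad (Omi i) g v.

Let gcomb (A : {set 'I_N}) c v : A \subset K -> FV v ->
  gform Omi lam (comb W A c) v = - \sum_(i in A) c i * ipGrad (Omi i) g v.
Proof.
move=> AK Vv; have [_ gb2] := wform_bilinear part (fun i => fine (lam i)) (fun=> 1).
have := @linear_on_comb _ _ P (pieceH1_linear part) _ W A c _ _ (gb2 _ (sub Vv)).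
rewrite -/(gform Omi lam) => -> => [|i iA]; last by apply/sub/FW/(fintype.subsetP AK).
rewrite -sumrN; apply: eq_bigr => i iA; rewrite hW //; last exact: (fintype.subsetP AK).
by rewrite mulrN.
Qed.

(** Both sides solve the same equation, whose right-hand side is linear in [l], and
   the form is definite on [freespace]. *)
Lemma derivative_comb l w : hatLambda lam l -> FV w ->
  (forall v, FV v -> gform Omi lam w v = - bform Omi l g v) -> eq_on Om w (comb W K l).
Proof.
move=> l0 Vw hw; have FVl := freespace_lin part lam.
have Vc : FV (comb W K l) by exact: (comb_closed FVl).
have Vd := lin_sub FVl Vw Vc; apply/eq_on_sub0/gform_injective => //.
have [_ gb2] := wform_bilinear part (fun i => fine (lam i)) (fun=> 1).
have := linear_on_sub (gb2 _ (sub Vd)) (sub Vw) (sub Vc).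
rewrite -/(gform Omi lam) /= => ->; rewrite hw // gcomb // /bform /wform.
rewrite opprK addrC; apply/eqP; rewrite subr_eq0; apply/eqP.
rewrite [RHS](bigID (mem K)) /= [X in _ + X]big1 ?addr0 => [|i]; last first.
  by rewrite finset.in_setC negbK => /l0 ->; rewrite !mul0r addr0.
by apply: eq_bigr => i _; rewrite mul0r addr0.
Qed.

(** Testing a vanishing combination with functions supported in the piece [i] isolates
   the i-th coefficient times the gradient term of g there; if the coefficient is not
   0, the gradient term has to vanish, and then g = g0 on the piece. *)
Lemma d_indices_indep : indep Om W (d_indices Om Omi F lam).
Proof.
move=> c c0 i iD; have DK := d_indices_sub; have iK := fintype.subsetP DK _ iD.
move: (iD); rewrite inE => /andP[ioo /asboolP ng]; apply/eqP/negPn/negP => ci.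
apply: ng => phi tphi; rewrite (g_test_fun ioo tphi).
have Vphi : FV phi by apply: freespace_test_fun tphi; rewrite -finset.in_setC.
suff -> : ipGrad (Omi i) g phi = 0 by rewrite mulr0 add0r.
apply: (mulfI ci); rewrite mulr0; apply: oppr_inj; rewrite oppr0.
transitivity (gform Omi lam (comb W (d_indices Om Omi F lam) c) phi).
  rewrite gcomb // (bigD1 i) //= big1 ?addr0 // => j /andP[_ ji].
  by rewrite (ipGrad_test_fun_off Pg ji tphi) mulr0.
have [_ gb2] := wform_bilinear part (fun i => fine (lam i)) (fun=> 1).
have lin0 := linear_on0 (pieceH1_linear part) (gb2 _ (sub Vphi)).
rewrite -lin0 /gform; have FVl := freespace_lin part lam.
apply: (wform_ae part) => //; [|by case: (pieceH1_linear part)|exact: sub|exact: sub| |].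
- by apply/sub/(comb_closed FVl) => j /(fintype.subsetP DK)/FW.
- exact/(eq_on_pieces part).
- by move=> j; exact: eq_on_refl.
Qed.

End sensitivities.

Section galerkin.
Context {R : realType} {n N : nat}.
Local Notation E := 'rV[R]_n.+1.
Variables (Om : set E) (Omi : 'I_N -> set E).
Hypothesis part : open_partition Om Omi.
Variables (J : {set 'I_N}).
Local Notation O := (cl_union Omi J).
Local Notation HH := (spaceH Om Omi O).
Local Notation nrm := (normH Om Omi O).
Variables (F : (E -> R) -> R) (B : (E -> R) -> (E -> R) -> R) (kappa M C : R).
Hypothesis kappa_gt0 : 0 < kappa.
Hypothesis linF : linear_on HH F.
Hypothesis bilB : bilinear_on HH B.
Hypothesis symB : forall v w, HH v -> HH w -> B v w = B w v.
Hypothesis B_le : forall v w, HH v -> HH w -> `|B v w| <= M * nrm v * nrm w.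
Hypothesis F_le : forall v, HH v -> `|F v| <= C * nrm v.
Variable lam : 'I_N -> \bar R.
Hypothesis lam_min : j_minimizer Om Omi F B kappa O lam.
Local Notation g := (g_of Om Omi F lam).

(** Nearby parameters in the directions of [hatLambda] are admissible, so g(lambda)
   minimizes f along a curve that passes through it in both directions. *)
Lemma minimizer_derivative l w : hatLambda lam l ->
  is_g_derive Om Omi F O lam l w -> kappa * B g w = F w.
Proof.
move=> l0 [Hw ex cw]; have [[[lam0 [i0 hi0]] I0s hg] jmin] := lam_min.
have HHl := spaceH_lin part J.
have [c [t0 [c0 c1 t00 near_t]]] := shift_lam_near lam0 l0.
have Hg : HH g := g_spaceH part I0s hg.
pose g_ t := g_of Om Omi F (shift_lam lam t l).
have Hsub v : HH v -> pieceH1 Omi v by exact: spaceH_H1.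
have ipP_bilinear_HH : bilinear_on HH (ipP Omi).
  have [b1 b2] := ipP_bilinear part; split=> v /Hsub Pv a x y /Hsub Px /Hsub Py.
    exact: b1.
  exact: b2.
have nE v : HH v -> nrm v = fnorm (ipP Omi) v := @normHH_nP _ _ _ _ _ part J v.
have near_adm : \forall t \near (0 : R)^', HH (g_ t) /\
    kappa / 2 * B g g - F g <= kappa / 2 * B (g_ t) (g_ t) - F (g_ t).
  near=> t.
  have [|e1 e2 s0 _ _] := near_t t; first by near: t; exact: dnbhs0_le.
  have et : exists w', is_g Om Omi F (shift_lam lam t l) w'.
    by near: t; exact: nbhs_dnbhs.
  split; first exact: g_shift_spaceH.
  apply: jmin; split=> //; last by rewrite e1.
  by split=> //; exists i0; rewrite e1 e2.
apply: (quadratic_minimum_derive HHl ipP_bilinear_HH bilB _ _ symB linF (M := M) (C := C)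
  kappa_gt0 _ _ Hg Hw near_adm).
- by move=> v x Hv Hx; apply: ipP_sym; exact: Hsub.
- by move=> v /Hsub; exact: ipP_psd.
- by move=> v x Hv Hx; rewrite -!nE //; exact: B_le.
- by move=> v Hv; rewrite -nE //; exact: F_le.
apply: cvg_trans cw; apply: near_eq_cvg; apply: filterS near_adm => t [Ht _].
apply: nE; apply: (lin_sub HHl) => //.
exact: (lin_scale HHl t^-1 (lin_sub HHl Ht Hg)).
Unshelve. all: by end_near. Qed.

End galerkin.

(** * Projections and the dimension of the tangent space *)

Theorem corollary3p12 (R : realType) (n N : nat)
    (Om : set 'rV[R]_n.+1) (Omi : 'I_N -> set 'rV[R]_n.+1)
    (Om_lipschitz : lipschitz_domain Om)
    (Om_partition : lipschitz_partition Om Omi)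
    (kappa : R) (kappa_gt0 : 0 < kappa)
    (e : ('rV[R]_n.+1 -> R) -> R)
    (e1 : ('rV[R]_n.+1 -> R) -> ('rV[R]_n.+1 -> R) -> R)
    (e2 : ('rV[R]_n.+1 -> R) -> ('rV[R]_n.+1 -> R) -> ('rV[R]_n.+1 -> R) -> R)
    (u : 'rV[R]_n.+1 -> R) (uH : H10 Om u)
    (J : {set 'I_N}) (J_largest : largest_H1_union Om Omi (e1 u) J) :
  let O := cl_union Omi J in
  let HH := spaceH Om Omi O in
  let nrm := normH Om Omi O in
  forall
    (e_ae : forall v w, HH v -> HH w -> eq_on Om v w -> e v = e w)
    (e_derivatives : derivatives_on HH e e1 e2)
    (uhat : 'rV[R]_n.+1 -> R) (uhatH : HH uhat)
    (uhat_min : forall v, HH v -> e uhat <= e v)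
    (e_smooth : three_times_differentiable_near HH nrm e e1 e2 uhat)
    (delta0 alpha0 : R) (delta0_gt0 : 0 < delta0) (alpha0_gt0 : 0 < alpha0)
    (e2_coercive_near : forall w, HH w -> nrm (w \- uhat) <= delta0 ->
      forall v, HH v -> alpha0 * nrm v ^+ 2 <= e2 w v v)
    (e2_invertible : forall G, in_dual HH nrm G ->
      exists v, [/\ HH v, (forall w, HH w -> e2 uhat v w = G w) &
        forall v', HH v' -> (forall w, HH w -> e2 uhat v' w = G w) ->
          eq_on Om v' v])
    (m M : R) (m_gt0 : 0 < m) (m_lt_M : m < M)
    (e2_bounded : forall v w, HH v -> HH w ->
      `|e2 u v w| <= M * nrm v * nrm w)
    (e2_coercive : forall v, HH v -> m * nrm v ^+ 2 <= e2 u v v)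
    (lam : 'I_N -> \bar R)
    (lam_min : j_minimizer Om Omi (e1 u) (e2 u) kappa O lam),
  let g := g_of Om Omi (e1 u) lam in
  let Tu := spaceT Om Omi (e1 u) O lam in
  forall
    (Pu : ('rV[R]_n.+1 -> R) -> ('rV[R]_n.+1 -> R))
    (Pu_proj : forall w, HH w ->
      Tu (Pu w) /\ forall v, Tu v -> e2 u (w \- Pu w) v = 0)
    (h : 'rV[R]_n.+1 -> R) (hH : HH h)
    (h_newton : forall v, HH v -> e2 u h v = e1 u v),
  eq_on Om (Pu h) (Pu (kappa \*o g)) /\
  exists dimT : nat,
    [/\ has_dim Om Tu dimT,
        (#|d_indices Om Omi (e1 u) lam| <= dimT)%N &
        (dimT <= N - #|I0 lam| - #|Ioo lam|)%N].
Proof.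
move=> O HH nrm e_ae ed uhat uhatH _ esm delta0 alpha0 delta0_gt0 alpha0_gt0 coer inv.
move=> m M m_gt0 _ e2_le e2_co lam lam_min g Tu Pu Pu_proj h hH h_newton.
have part := lipschitz_open_partition Om_lipschitz Om_partition.
have HHl : lin_closed HH := spaceH_lin part J.
have sub v : HH v -> pieceH1 Omi v by exact: spaceH_H1.
have nE v : HH v -> nrm v = fnorm (ipP Omi) v := @normHH_nP _ _ _ _ _ part J v.
have Hu : HH u by exact: H10_spaceH.
have [[lin1 _] bil2 sym2 _] := ed u Hu.
have [_ bilh _ _] := ed uhat uhatH.
have bilPH : bilinear_on HH (ipP Omi).
  have [b1 b2] := ipP_bilinear part; split=> v /sub Pv a x y /sub Px /sub Py.
    exact: b1.
  exact: b2.
have symPH v w : HH v -> HH w -> ipP Omi v w = ipP Omi w v.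
  by move=> Hv Hw; apply: ipP_sym; exact: sub.
have psdPH v : HH v -> 0 <= ipP Omi v v by move=> /sub; exact: ipP_psd.
have uu0 : nrm (uhat \- uhat) = 0.
  rewrite nE; last exact: lin_sub.
  have -> : uhat \- uhat = cst 0 by apply/funext => x /=; rewrite subrr.
  exact: (fnorm0 HHl).
(* HH is complete since e''(uhat; ., .) is coercive and represents its dual. *)
have complHH : complete_form HH (ipP Omi).
  have [r [e3 [r0 hr]]] := esm.
  have [|_ [_ [C hC]] _ _] := hr uhat uhatH; first by rewrite uu0.
  apply: (complete_of_representable HHl bilPH symPH psdPH alpha0_gt0 bilh (C := C)).
  - by move=> v Hv; rewrite -nE //; apply: coer; rewrite ?uu0 // ltW.
  - by move=> v w Hv Hw; rewrite -!nE //; exact: hC.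
  - move=> G [linG [C' hC']]; have [|v [Hv hv _]] := inv G; last by exists v.
    by split=> //; exists C' => v Hv; rewrite nE //; exact: hC'.
have F_le v : HH v -> `|e1 u v| <= (M * nrm h) * nrm v.
  by move=> Hv; rewrite -h_newton //; exact: e2_le.
have [[[lam0 _] I0s hg] _] := lam_min.
have Hg : HH g := g_spaceH part I0s hg.
(* kappa g - h is orthogonal to the generators of T_u, hence to T_u. *)
have galerkin v : Tu v -> HH v /\ e2 u (kappa \*o g \- h) v = 0.
  have Hd : HH (kappa \*o g \- h) by apply: (lin_sub HHl) => //; exact: (lin_scale HHl).
  have lind := bil2.1 _ Hd.
  move: v; apply: span_sub.
    split; first by split; [case: HHl|exact: (linear_on0 HHl lind)].
    move=> a v w [Hv v0] [Hw w0]; split; first by apply HHl.2.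
    by rewrite lind // v0 w0 mulr0 addr0.
  move=> w [l l0 dw]; have Hw : HH w by case: dw.
  split=> //; rewrite (linear_on_sub (bil2.2 _ Hw)) //; last exact: (lin_scale HHl).
  rewrite (linear_on_scale HHl (bil2.2 _ Hw)) // h_newton //.
  rewrite (minimizer_derivative part kappa_gt0 lin1 bil2 sym2 e2_le F_le lam_min l0 dw).
  by rewrite subrr.
have Tul : lin_closed Tu by exact: span_lin.
have Hkg : HH (kappa \*o g) by exact: (lin_scale HHl).
split.
  have [Th ph] := Pu_proj h hH; have [Tg pg] := Pu_proj _ Hkg.
  have Td := lin_sub Tul Th Tg; have [Hd kd] := galerkin _ Td.
  have [HTh _] := galerkin _ Th; have [HTg _] := galerkin _ Tg.
  set D := Pu h \- Pu (kappa \*o g) in Td Hd kd *.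
  have D0 : e2 u D D = 0.
    have linD := linear_on_sub (bil2.2 _ Hd).
    have := ph _ Td; have := pg _ Td; have := linD _ _ HTh HTg; move: kd.
    rewrite (linD _ _ Hkg hH) (linD _ _ Hkg HTg) (linD _ _ hH HTh) -/D => k1 -> k2 k3.
    lra.
  apply/eq_on_sub0/(ipP_eq0 part (sub _ Hd)).
  have := e2_co _ Hd; rewrite D0 pmulr_rle0 // nE // (sqr_fnorm psdPH Hd) => le0.
  by apply/le_anti; rewrite le0 psdPH.
(* The derivatives W_i in the directions of the indicators of the free pieces. *)
have solve i : exists w, i \in ~: (I0 lam :|: Ioo lam) ->
    [/\ freespace Om Omi lam w,
      forall v, freespace Om Omi lam v -> gform Omi lam w v = - ipGrad (Omi i) g v &
      is_g_derive Om Omi (e1 u) O lam (fun j => (j == i)%:R) w].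
  have [iK|_] := boolP (i \in _); last by exists (cst 0).
  have [|w [Vw hw dw]] := g_derivable part complHH lam0 I0s hg (l := fun j => (j == i)%:R).
    by move=> j jB; apply/eqP; rewrite pnatr_eq0 eqb0; apply: contraTneq iK => <-;
      rewrite finset.in_setC jB.
  by exists w => _; split=> // v Vv; rewrite hw // bform_delta.
pose W i := projT1 (cid (solve i)).
have hW i : i \in ~: (I0 lam :|: Ioo lam) -> [/\ freespace Om Omi lam (W i),
      forall v, freespace Om Omi lam v -> gform Omi lam (W i) v = - ipGrad (Omi i) g v &
      is_g_derive Om Omi (e1 u) O lam (fun j => (j == i)%:R) (W i)].
  by rewrite /W; case: cid.
have FW i : i \in ~: (I0 lam :|: Ioo lam) -> freespace Om Omi lam (W i).
  by move=> /hW[].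
have gW i v : i \in ~: (I0 lam :|: Ioo lam) -> freespace Om Omi lam v ->
    gform Omi lam (W i) v = - ipGrad (Omi i) g v.
  by move=> /hW[_ h1 _]; exact: h1.
have cardK : #|~: (I0 lam :|: Ioo lam)| = (N - #|I0 lam| - #|Ioo lam|)%N.
  rewrite cardsCs finset.setCK card_ord cardsU (_ : _ :&: _ = finset.set0)
    ?cards0 ?subn0 ?subnDA //.
  apply/setP => i; rewrite !inE; apply/negP => /andP[/eqP ->].
  by rewrite eq_sym.
rewrite -cardK; apply: (dim_between (W := W)).
- exact: d_indices_sub.
- exact: (d_indices_indep part hg FW gW).
- move=> i iK; apply: mem_span; exists (fun j => (j == i)%:R); last by case: (hW i iK).
  by move=> j jB; apply/eqP; rewrite pnatr_eq0 eqb0; apply: contraTneq iK => <-;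
    rewrite finset.in_setC jB.
- pose V := [set w | exists c, eq_on Om w (comb W (~: (I0 lam :|: Ioo lam)) c)].
  change (Tu `<=` V); apply: span_sub.
    split.
      exists (fun=> 0); apply: aeW => x _; rewrite /comb big1 // => i _.
      by rewrite mul0r.
    move=> a v v' [c hc] [c' hc']; exists (fun i => a * c i + c' i).
    apply: filterS2 hc hc' => x h1 h2 Ux; rewrite /= h1 // h2 // /comb mulr_sumr -big_split.
    by apply: eq_bigr => i _; rewrite mulrDl mulrA.
  move=> z [l l0 dz]; exists l.
  have [w' [Vw' hw' dw']] := g_derivable part complHH lam0 I0s hg l0.
  apply: eq_on_trans (is_g_derive_unique part lam0 I0s hg l0 dz dw') _.
  exact: (derivative_comb part lam0 FW gW l0 Vw' hw').
Qed.
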